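(* Let $d\ge 9$ be an integer and $m=4$. Let $A_1\subset\mathbb{P}^4$ be a connected curvilinear zero-dimensional scheme of degree $3$ spanning a plane and let $A_2\subset\mathbb{P}^4$ be a connected curvilinear zero-dimensional scheme of degree $2$. Assume $\langle A_1\rangle\cap\langle A_2\rangle=\emptyset$, i.e. $A_1\cap A_2=\emptyset$ and $\dim\langle A_1\cup A_2\rangle=4$. Set $A:=A_1\cup A_2$ and let $P\in\langle\nu_d(A)\rangle$ be such that $P\notin\langle\nu_d(A')\rangle$ for any closed subscheme $A'\subsetneq A$. Then $r_{m,d}(P)=3d-1$. For any $B\in\mathcal{S}(P)$ there is a unique decomposition $B=B_1\sqcup B_2$ with $B\cap A_{red}=\emptyset$, $\sharp(B_1)=2d-1$, $\sharp(B_2)=d$, $B_1\subset\langle A_1\rangle$, $B_2\subset\langle A_2\rangle$, each $B_i$ evincing the rank of a uniquely determined point $P_i\in\langle\nu_d(A_i)\rangle$ (i.e. $B_i\in\mathcal{S}(P_i)$). The scheme $A_1\cup B_1$ is contained in a reduced conic $C\subset\langle A_1\rangle$. Conversely, for any $P_i\in\langle\nu_d(A_i)\rangle$, $i=1,2$, such that $P_i\notin\langle\nu_d(A')\rangle$ for any closed subscheme $A'\subsetneq A_i$, any $B_i\in\mathcal{S}(P_i)$, $i=1,2$, and any $P\in\langle\{P_1,P_2\}\rangle\setminus\{P_1,P_2\}$, we have $B_1\cap B_2=\emptyset$ and $B_1\cup B_2\in\mathcal{S}(P)$.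
   Context: Work over an algebraically closed field of characteristic $0$. $\nu_d:\mathbb{P}^m\to\mathbb{P}^r$, $r=\binom{m+d}{m}-1$, is the degree $d$ Veronese embedding (here $m=4$) and $\langle\ \rangle$ denotes linear span (of a set or of a closed subscheme). A zero-dimensional scheme is curvilinear if its Zariski tangent space at each point has dimension at most $1$ (equivalently, it is locally contained in a smooth curve). The rank $r_{m,d}(P)$ of $P\in\mathbb{P}^r$ is the minimal cardinality of a finite set $B\subset\mathbb{P}^m$ with $P\in\langle\nu_d(B)\rangle$, and $\mathcal{S}(P)$ is the set of all finite sets $B\subset\mathbb{P}^m$ such that $P\in\langle\nu_d(B)\rangle$ and $\sharp(B)=r_{m,d}(P)$ (such a $B$ is said to evince the rank of $P$). *)

(* Defs.v *)
From HB Require Import structures.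
From mathcomp Require Import all_boot all_order all_algebra.
From mathcomp Require Import finmap mpoly boolp.

Set Implicit Arguments.
Unset Strict Implicit.
Unset Printing Implicit Defensive.

Import GRing.Theory.
Local Open Scope ring_scope.

(* The subspace cut out by a predicate closed under linear combinations
   (see [mem_vspace_of]); 0 for any other predicate. *)
Definition vspace_of (K : fieldType) (V : vectType K) (P : V -> Prop) :
    {vspace V} :=
  match pselect (exists U : {vspace V}, forall v, v \in U <-> P v) with
  | left exU => sval (cid exU)
  | right _ => 0%VS
  end.

Lemma mem_vspace_of (K : fieldType) (V : vectType K) (P : V -> Prop) :
  P 0 -> (forall a u v, P u -> P v -> P (a *: u + v)) ->
  forall v, v \in vspace_of P <-> P v.
Proof.
move=> P0 Plin.
suff exU : exists U : {vspace V}, forall v, v \in U <-> P v.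
  by rewrite /vspace_of; case: pselect => // h; apply: (svalP (cid h)).
pose inP n := `[< exists2 U : {vspace V}, \dim U = n & {in U, forall v, P v} >].
have ex_n : exists n, inP n.
  exists 0; apply/asboolP; exists 0%VS; first exact: dimv0.
  by move=> v; rewrite memv0 => /eqP->.
have le_n n : inP n -> (n <= \dim {:V})%N.
  by move=> /asboolP[U <- _]; apply: dimvS; apply: subvf.
case: (ex_maxnP ex_n le_n) => n /asboolP[U dimU UP] maxn.
exists U => v; split=> [/UP//|Pv].
have UvP : {in (<[v]> + U)%VS, forall w, P w}.
  by move=> w /memv_addP[_ /vlineP[a ->] [u /UP Pu ->]]; apply: Plin.
have le_dim : (\dim (<[v]> + U) <= \dim U)%N.
  by rewrite dimU; apply: maxn; apply/asboolP; exists (<[v]> + U)%VS.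
have /eqP-> : U == (<[v]> + U)%VS by rewrite eqEdim addvSr.
by apply: (subvP (addvSl _ _)); apply: memv_line.
Qed.

(* A point of P^m is a line through the origin of K^(m+1); likewise linear
   subspaces of P^m are represented by subspaces of K^(m+1), of dimension one
   more, and a point Q lies in the linear subspace U when (Q <= U)%VS. *)
Record point (K : fieldType) (m : nat) := Point {
  line :> {vspace 'rV[K]_m.+1};
  _ : \dim line == 1%N }.

HB.instance Definition _ (K : fieldType) (m : nat) :=
  [isSub for @line K m].
HB.instance Definition _ (K : fieldType) (m : nat) :=
  [Choice of point K m by <:].

Lemma dim_point (K : fieldType) (m : nat) (Q : point K m) : \dim Q = 1%N.
Proof. by case: Q => U /= /eqP. Qed.

Lemma point_vpick (K : fieldType) (m : nat) (Q : point K m) :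
  vpick Q != 0 /\ (Q : {vspace _}) = <[vpick Q]>%VS.
Proof.
have nz : vpick Q != 0.
  by rewrite vpick0 -dimv_eq0 dim_point.
split=> //; apply/eqP; rewrite eq_sym eqEdim.
by rewrite -memvE memv_pick dim_point dim_vline nz.
Qed.

Lemma dim_line_of (K : fieldType) (m : nat) (v : 'rV[K]_m.+1) :
  v != 0 -> \dim <[v]> == 1%N.
Proof. by rewrite dim_vline => ->. Qed.

Definition point_of (K : fieldType) (m : nat) (v : 'rV[K]_m.+1)
  (nz_v : v != 0) : point K m := Point (dim_line_of nz_v).

Definition set_span (K : fieldType) (m : nat) (B : {fset point K m}) :
  {vspace 'rV[K]_m.+1} := (\sum_(Q <- B) (Q : {vspace _}))%VS.

Definition evalv (K : fieldType) (n : nat) (f : {mpoly K[n]}) (v : 'rV[K]_n) :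
  K := f.@[v ord0].

Definition vanishes (K : fieldType) (m : nat) (f : {mpoly K[m.+1]})
    (Q : point K m) : Prop :=
  forall v, v \in (Q : {vspace _}) -> v != 0 -> evalv f v = 0.

(* Closed subschemes of P^m, through their bijection with the saturated
   homogeneous ideals of K[X_0, ..., X_m]. *)
Record subscheme (K : fieldType) (m : nat) := Subscheme {
  ideal :> {mpoly K[m.+1]} -> Prop;
  ideal0 : ideal 0;
  idealD : forall f g, ideal f -> ideal g -> ideal (f + g);
  idealM : forall g f, ideal f -> ideal (g * f);
  ideal_homog : forall k f, ideal f -> ideal (pihomog mdeg k f);
  ideal_sat : forall k f,
    (forall u : 'X_{1..m.+1}, mdeg u = k -> ideal ('X_[u] * f)) -> ideal f }.

Definition subscheme_le (K : fieldType) (m : nat) (Z W : subscheme K m) : Prop :=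
  forall f, W f -> Z f.

Definition subscheme_lt (K : fieldType) (m : nat) (Z W : subscheme K m) : Prop :=
  subscheme_le Z W /\ ~ subscheme_le W Z.

Lemma union_homog (K : fieldType) (m : nat) (Z W : subscheme K m) k f :
  Z f /\ W f -> Z (pihomog mdeg k f) /\ W (pihomog mdeg k f).
Proof. by case=> Zf Wf; split; apply: ideal_homog. Qed.

Lemma union_sat (K : fieldType) (m : nat) (Z W : subscheme K m) k f :
  (forall u : 'X_{1..m.+1}, mdeg u = k -> Z ('X_[u] * f) /\ W ('X_[u] * f)) ->
  Z f /\ W f.
Proof. by move=> h; split; apply: (@ideal_sat _ _ _ k) => u /h[]. Qed.

Definition union (K : fieldType) (m : nat) (Z W : subscheme K m) :
    subscheme K m :=
  @Subscheme K m (fun f => Z f /\ W f)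
    (conj (ideal0 Z) (ideal0 W))
    (fun f g If Ig => conj (idealD If.1 Ig.1) (idealD If.2 Ig.2))
    (fun g f If => conj (idealM g If.1) (idealM g If.2))
    (@union_homog K m Z W) (@union_sat K m Z W).

(* The largest homogeneous ideal contained in the ideal J. *)
Section HomogeneousCore.
Variables (K : fieldType) (n : nat) (J : {mpoly K[n]} -> Prop).

Definition hcore (f : {mpoly K[n]}) : Prop := forall k, J (pihomog mdeg k f).

Hypotheses (J0 : J 0) (JD : forall f g, J f -> J g -> J (f + g)).
Hypothesis (JM : forall g f, J f -> J (g * f)).

Lemma hcore0 : hcore 0.
Proof. by move=> k; rewrite pihomog0. Qed.

Lemma hcoreD f g : hcore f -> hcore g -> hcore (f + g).
Proof. by move=> Jf Jg k; rewrite pihomogD; apply: JD. Qed.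

Lemma pihomog_mulX (u : 'X_{1..n}) (f : {mpoly K[n]}) k :
  pihomog mdeg k ('X_[u] * f) =
    if (mdeg u <= k)%N then 'X_[u] * pihomog mdeg (k - mdeg u) f else 0.
Proof.
have def_f := @pihomog_partitionE _ _ mdeg _ f (leqnn _).
rewrite {1}def_f mulr_sumr raddf_sum /=.
have hom i : 'X_[u] * pihomog mdeg i f \is (mdeg u + i).-homog for mdeg.
  by apply: dhomogM; [rewrite dhomogX | exact: pihomogP].
case: leqP => [le_uk | lt_ku]; last first.
  apply: big1 => i _; apply: pihomog_ne0 (hom i).
  by apply/eqP=> e; move: lt_ku; rewrite -e ltnNge leq_addr.
rewrite [in RHS]def_f raddf_sum mulr_sumr /=.
apply: eq_bigr => i _; case: (eqVneq (mdeg u + i)%N k) => [e | ne].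
  by rewrite -e pihomog_dE // addKn pihomog_id.
rewrite (pihomog_ne0 ne (hom i)) (@pihomog_ne0 _ _ mdeg i) ?mulr0 //.
  by apply: contraNneq ne => ->; rewrite subnKC.
exact: pihomogP.
Qed.

Lemma hcoreM g f : hcore f -> hcore (g * f).
Proof.
move=> Jf; elim/mpolyind: g => [|c u g _ _ Jg]; first by rewrite mul0r; apply: hcore0.
rewrite mulrDl; apply: hcoreD Jg => k.
rewrite -scalerAl linearZ /= pihomog_mulX -mul_mpolyC; apply: JM.
by case: ifP => // _; apply: JM.
Qed.

Lemma hcore_homog k f : hcore f -> hcore (pihomog mdeg k f).
Proof.
move=> Jf l; case: (eqVneq k l) => [<- | ne]; first by rewrite pihomog_id.
by rewrite (pihomog_ne0 ne (pihomogP _ _ _)).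
Qed.

Hypothesis J_sat : forall k f,
  (forall u : 'X_{1..n}, mdeg u = k -> J ('X_[u] * f)) -> J f.

Lemma hcore_sat k f :
  (forall u : 'X_{1..n}, mdeg u = k -> hcore ('X_[u] * f)) -> hcore f.
Proof.
move=> h l; apply: (@J_sat k) => u du.
by have := h u du (l + k)%N; rewrite pihomog_mulX du leq_addl addnK.
Qed.

End HomogeneousCore.

Section FiniteSet.
Variables (K : fieldType) (m : nat) (B : {fset point K m}).

Definition vanishes_on (f : {mpoly K[m.+1]}) : Prop :=
  forall Q, Q \in B -> vanishes f Q.

Lemma vanishes_on0 : vanishes_on 0.
Proof. by move=> Q _ v _ _; rewrite /evalv meval0. Qed.

Lemma vanishes_onD f g : vanishes_on f -> vanishes_on g -> vanishes_on (f + g).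
Proof.
move=> vf vg Q QB v vQ nz; rewrite /evalv mevalD.
by rewrite [X in X + _](vf Q QB v vQ nz) [X in _ + X](vg Q QB v vQ nz) addr0.
Qed.

Lemma vanishes_onM g f : vanishes_on f -> vanishes_on (g * f).
Proof.
move=> vf Q QB v vQ nz; rewrite /evalv mevalM.
by rewrite [X in _ * X](vf Q QB v vQ nz) mulr0.
Qed.

Lemma vanishes_on_sat k f :
  (forall u : 'X_{1..m.+1}, mdeg u = k -> vanishes_on ('X_[u] * f)) ->
  vanishes_on f.
Proof.
move=> h Q QB v vQ nz; have /rV0Pn[i nz_vi] := nz.
have du : mdeg (U_(i) *+ k)%MM = k by rewrite mdegMn mdeg1 mul1n.
have := h _ du Q QB v vQ nz; rewrite /evalv mevalM.
by rewrite -mpolyXn rmorphXn /= mevalXU => /eqP; rewrite mulf_eq0 expf_eq0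
  (negbTE nz_vi) andbF => /eqP.
Qed.

Definition reduced_set : subscheme K m :=
  @Subscheme K m (hcore vanishes_on)
    (hcore0 vanishes_on0) (hcoreD vanishes_onD)
    (hcoreM vanishes_on0 vanishes_onD vanishes_onM)
    (hcore_homog vanishes_on0) (hcore_sat vanishes_on_sat).

End FiniteSet.

Definition supp (K : fieldType) (m : nat) (Z : subscheme K m) (Q : point K m) :
  Prop := forall f, Z f -> vanishes f Q.

(* Linear span: the intersection of the hyperplanes containing Z. *)
Definition scheme_span (K : fieldType) (m : nat) (Z : subscheme K m) :
    {vspace 'rV[K]_m.+1} :=
  vspace_of (fun v => forall l, Z l -> l \is 1.-homog -> evalv l v = 0).

Lemma evalv_linear (K : fieldType) (n : nat) (l : {mpoly K[n]}) a u v :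
  l \is 1.-homog -> evalv l (a *: u + v) = a * evalv l u + evalv l v.
Proof.
move=> /dhomogP hl; have ev x : evalv l x =
    \sum_(w <- msupp l) l@_w * 'X_[w].@[x ord0].
  rewrite /evalv {1}(mpolyE l) raddf_sum /=.
  by apply: eq_bigr => w _; rewrite mevalZ.
rewrite !ev mulr_sumr -big_split.
rewrite big_seq [RHS]big_seq /=; apply: eq_bigr => w /hl /eqP.
rewrite mdeg_eq1 => /existsP[i /eqP->]; rewrite !mevalXU !mxE.
by rewrite mulrDr mulrCA.
Qed.

Lemma mem_scheme_span (K : fieldType) (m : nat) (Z : subscheme K m) v :
  v \in scheme_span Z <-> (forall l, Z l -> l \is 1.-homog -> evalv l v = 0).
Proof.
apply: mem_vspace_of => [l _ hl | a u w hu hw l Zl hl].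
  rewrite -[X in evalv _ X](addNr 0) -scaleN1r evalv_linear //.
  by rewrite mulN1r addNr.
by rewrite evalv_linear // hu // hw // mulr0 addr0.
Qed.

(* The dimension of the degree t part of K[X_0, ..., X_m] / I_Z. *)
Definition hilbert (K : fieldType) (m : nat) (Z : subscheme K m) (t : nat) :
    nat :=
  (\dim {: dhomog m.+1 K t}
   - \dim (vspace_of (fun f : dhomog m.+1 K t => Z (val f))))%N.

Lemma mem_degree_part (K : fieldType) (m : nat) (Z : subscheme K m) (t : nat)
    (f : dhomog m.+1 K t) :
  f \in vspace_of (fun f : dhomog m.+1 K t => Z (val f)) <-> Z (val f).
Proof.
apply: (mem_vspace_of (P := fun f : dhomog m.+1 K t => Z (val f))).
  exact: ideal0.
move=> a g h Zg Zh; rewrite linearP /= -mul_mpolyC.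
by apply: idealD => //; apply: idealM.
Qed.

(* Zero-dimensional of degree n: the Hilbert polynomial is the constant n. *)
Definition zerodim_of_degree (K : fieldType) (m : nat) (Z : subscheme K m)
    (n : nat) : Prop :=
  exists t0, forall t, (t0 <= t)%N -> hilbert Z t = n.

(* The support is connected for the Zariski topology of P^m, whose closed sets
   are the supports of the closed subschemes. *)
Definition connected_scheme (K : fieldType) (m : nat) (Z : subscheme K m) :
    Prop :=
  (exists Q, supp Z Q) /\
  forall F G : subscheme K m,
    (forall Q, supp Z Q <-> supp F Q \/ supp G Q) ->
    (forall Q, ~ (supp F Q /\ supp G Q)) ->
    (forall Q, ~ supp F Q) \/ (forall Q, ~ supp G Q).

(* For Q = [v], the tangent vectors at Q are the K[eps]-points [v + eps w] of
   Z, with w taken modulo Q; f (v + eps w) = f v + eps (df)_v w. *)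
Definition tangent_cone (K : fieldType) (m : nat) (Z : subscheme K m)
    (Q : point K m) : {vspace 'rV[K]_m.+1} :=
  vspace_of (fun w : 'rV[K]_m.+1 => forall f v, Z f -> v \in (Q : {vspace _}) -> v != 0 ->
    \sum_(i < m.+1) evalv (mderiv i f) v * w ord0 i = 0).

Lemma mem_tangent_cone (K : fieldType) (m : nat) (Z : subscheme K m)
    (Q : point K m) w :
  w \in tangent_cone Z Q <->
  (forall f v, Z f -> v \in (Q : {vspace _}) -> v != 0 ->
     \sum_(i < m.+1) evalv (mderiv i f) v * w ord0 i = 0).
Proof.
apply: mem_vspace_of => [f v _ _ _ | a u w' hu hw f v Zf vQ nz].
  by apply: big1 => i _; rewrite mxE mulr0.
transitivity (a * (\sum_(i < m.+1) evalv (mderiv i f) v * u ord0 i) +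
              \sum_(i < m.+1) evalv (mderiv i f) v * w' ord0 i); last first.
  by rewrite (hu f v Zf vQ nz) (hw f v Zf vQ nz) mulr0 addr0.
rewrite mulr_sumr -big_split /=; apply: eq_bigr => i _.
by rewrite !mxE mulrDr mulrCA.
Qed.

Definition tangent_dim (K : fieldType) (m : nat) (Z : subscheme K m)
  (Q : point K m) : nat := (\dim (tangent_cone Z Q) - \dim Q)%N.

Definition curvilinear (K : fieldType) (m : nat) (Z : subscheme K m) : Prop :=
  forall Q, supp Z Q -> (tangent_dim Z Q <= 1)%N.

(* A saturated homogeneous ideal is radical iff its subscheme is reduced. *)
Definition reduced_scheme (K : fieldType) (m : nat) (Z : subscheme K m) :
  Prop := forall f k, Z (f ^+ k) -> Z f.

(* C is the zero scheme, in the plane P(U), of a quadratic form q which is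
   nonzero on that plane. *)
Definition conic_in (K : fieldType) (m : nat) (U : {vspace 'rV[K]_m.+1})
    (C : subscheme K m) : Prop :=
  \dim U = 3%N /\
  exists q : {mpoly K[m.+1]},
    [/\ q \is 2.-homog,
        exists2 v, v \in U & evalv q v != 0
      & forall f, C f <->
          exists g, forall v, v \in U -> evalv f v = evalv g v * evalv q v].

Section Veronese.
Variables (K : fieldType) (m d : nat).

Definition vdim : nat := 'C(m + d, m).-1.

(* The degree d monomials in X_0, ..., X_m, indexed by 0, ..., r. *)
Definition monomials : seq 'X_{1..m.+1} :=
  [seq s2m (val t) | t <- enum (basis m.+1 d)].

Lemma size_monomials : size monomials = vdim.+1.
Proof.
rewrite /monomials size_basis /vdim prednK ?bin_gt0 ?leq_addr //.
by rewrite -bin_sub ?leq_addr // addKn addnC.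
Qed.

Lemma mem_monomials u : (u \in monomials) = (mdeg u == d).
Proof. by rewrite basis_cover. Qed.

Definition vmono (i : 'I_vdim.+1) : 'X_{1..m.+1} := nth 0%MM monomials i.

Lemma vmono_onto u : mdeg u = d -> exists i, vmono i = u.
Proof.
move=> du; have u_in : u \in monomials by rewrite mem_monomials du.
have lt_u : (index u monomials < vdim.+1)%N by rewrite -size_monomials index_mem.
by exists (Ordinal lt_u); rewrite /vmono nth_index.
Qed.

Definition veronese_vec (v : 'rV[K]_m.+1) : 'rV[K]_vdim.+1 :=
  \row_i evalv 'X_[vmono i] v.

Lemma veronese_vec_neq0 v : v != 0 -> veronese_vec v != 0.
Proof.
move=> /rV0Pn[j nz_vj].
have [|i def_i] := @vmono_onto (U_(j) *+ d)%MM.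
  by rewrite mdegMn mdeg1 mul1n.
apply/rV0Pn; exists i.
by rewrite mxE /evalv def_i -mpolyXn rmorphXn /= mevalXU expf_neq0.
Qed.

Definition veronese (Q : point K m) : point K vdim :=
  point_of (veronese_vec_neq0 (point_vpick Q).1).

Lemma veronese_vecZ a v : veronese_vec (a *: v) = a ^+ d *: veronese_vec v.
Proof.
apply/rowP=> i; rewrite !mxE /evalv !mevalX.
have /eqP <- : mdeg (vmono i) == d.
  by rewrite -mem_monomials mem_nth // size_monomials.
rewrite mdegE -prodrXr -big_split /=; apply: eq_bigr => j _.
by rewrite mxE exprMn.
Qed.

(* [veronese] does not depend on the chosen representative. *)
Lemma veroneseE v (nz_v : v != 0) :
  veronese (point_of nz_v) = point_of (veronese_vec_neq0 nz_v).
Proof.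
have [nz_w def_w] := point_vpick (point_of nz_v).
apply: val_inj; rewrite /=; set w := vpick _ in nz_w def_w *.
have /vlineP[a def_wa] : w \in <[v]>%VS.
  by rewrite -[<[v]>%VS]/(line (point_of nz_v)) def_w memv_line.
have nz_a : a != 0.
  by apply: contraNneq nz_w => a0; rewrite def_wa a0 scale0r.
rewrite def_wa veronese_vecZ; apply/eqP; rewrite eqEdim -memvE.
rewrite rpredZ ?memv_line // !dim_vline scaler_eq0 negb_or.
by rewrite expf_neq0 ?veronese_vec_neq0.
Qed.

(* Scheme-theoretic image of Z under the Veronese embedding: the kernel of
   K[Y_0, ..., Y_r] -> K[X_0, ..., X_m] / I_Z, Y_i |-> i-th monomial, computed
   degree by degree so that it is homogeneous also when d = 0. *)
Definition veronese_pull (F : {mpoly K[vdim.+1]}) : {mpoly K[m.+1]} :=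
  F \mPo [tuple 'X_[vmono i] | i < vdim.+1].

Variable Z : subscheme K m.

Definition pull_in (F : {mpoly K[vdim.+1]}) : Prop := Z (veronese_pull F).

Lemma pull_in0 : pull_in 0.
Proof. by rewrite /pull_in /veronese_pull comp_mpoly0; apply: ideal0. Qed.

Lemma pull_inD F G : pull_in F -> pull_in G -> pull_in (F + G).
Proof. by rewrite /pull_in /veronese_pull comp_mpolyD; apply: idealD. Qed.

Lemma pull_inM G F : pull_in F -> pull_in (G * F).
Proof. by rewrite /pull_in /veronese_pull rmorphM; apply: idealM. Qed.

Lemma pull_in_sat k F :
  (forall u : 'X_{1..vdim.+1}, mdeg u = k -> pull_in ('X_[u] * F)) -> pull_in F.
Proof.
move=> h; apply: (@ideal_sat _ _ Z (m.+1 * (k * d))%N) => w dw.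
have [i le_i] : exists i, (k * d <= w i)%N.
  have [->|kd_gt0] := posnP (k * d)%N; first by exists ord0.
  apply: contra_eqP dw => /forallNP lt_w; rewrite mdegE neq_ltn; apply/orP; left.
  apply: (@leq_ltn_trans (\sum_(i < m.+1) (k * d).-1)%N).
    apply: leq_sum => i _; rewrite -ltnS prednK //.
    by rewrite ltnNge; apply/negP/lt_w.
  by rewrite sum_nat_const card_ord ltn_pmul2l // prednK.
have [|j def_j] := @vmono_onto (U_(i) *+ d)%MM.
  by rewrite mdegMn mdeg1 mul1n.
have du : mdeg (U_(j) *+ k)%MM = k by rewrite mdegMn mdeg1 mul1n.
have := h _ du; rewrite /pull_in /veronese_pull rmorphM /=.
rewrite -mpolyXn rmorphXn /= comp_mpolyXU -tnth_nth tnth_mktuple def_j mpolyXn.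
have le_w : (U_(i) *+ d *+ k <= w)%MM.
  apply/mnm_lepP=> l; rewrite !mulmnE mnm1E.
  by case: eqP => [<-|_]; rewrite ?mul0n // mul1n mulnC.
by rewrite -(submK le_w) mpolyXD -mulrA; apply: idealM.
Qed.

Definition veronese_scheme : subscheme K vdim :=
  @Subscheme K vdim (hcore pull_in)
    (hcore0 pull_in0) (hcoreD pull_inD)
    (hcoreM pull_in0 pull_inD pull_inM)
    (hcore_homog pull_in0) (hcore_sat pull_in_sat).

End Veronese.

Section Rank.
Variables (K : fieldType) (m d : nat).
Implicit Types (P : point K (vdim m d)) (B : {fset point K m}).

Definition spanned_by B P : Prop :=
  (P <= set_span [fset veronese d Q | Q in B]%fset)%VS.

Definition spanned_minimally_by (A : subscheme K m) P : Prop :=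
  (P <= scheme_span (veronese_scheme d A))%VS /\
  forall A' : subscheme K m, subscheme_lt A' A ->
    ~ (P <= scheme_span (veronese_scheme d A'))%VS.

Definition spanning_card P (n : nat) : Prop :=
  exists2 B, #|` B|%fset = n & spanned_by B P.

(* With the value 0, which is no point's rank, if no finite set spans P. *)
Definition rank P : nat :=
  match pselect (exists n, `[< spanning_card P n >]) with
  | left exn => ex_minn exn
  | right _ => 0%N
  end.

Lemma rank_le P B : spanned_by B P -> (rank P <= #|` B|%fset)%N.
Proof.
move=> sB; rewrite /rank; case: pselect => // exn.
by case: ex_minnP => n _; apply; apply/asboolP; exists B.
Qed.

Lemma rank_attained P B : spanned_by B P ->
  exists2 B', #|` B'|%fset = rank P & spanned_by B' P.
Proof.
move=> sB; rewrite /rank; case: pselect => [exn|]; last first.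
  by case; exists #|` B|%fset; apply/asboolP; exists B.
by case: ex_minnP => n /asboolP.
Qed.

Definition evinces_rank P B : Prop := spanned_by B P /\ #|` B|%fset = rank P.

End Rank.

Definition rank_decomposition (K : fieldType) (m d : nat)
    (A1 A2 : subscheme K m) (B B1 B2 : {fset point K m}) : Prop :=
  [/\ B = (B1 `|` B2)%fset /\ (B1 `&` B2 = fset0)%fset,
      #|` B1|%fset = (2 * d - 1)%N /\ #|` B2|%fset = d,
      forall Q, Q \in B1 -> (Q <= scheme_span A1)%VS,
      forall Q, Q \in B2 -> (Q <= scheme_span A2)%VS
    & (exists! P1 : point K (vdim m d),
         (P1 <= scheme_span (veronese_scheme d A1))%VS /\ evinces_rank P1 B1) /\
      (exists! P2 : point K (vdim m d),
         (P2 <= scheme_span (veronese_scheme d A2))%VS /\ evinces_rank P2 B2)].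

(* Main.v *)
Require Import Defs.
From HB Require Import structures.
From mathcomp Require Import all_boot all_order all_algebra.
From mathcomp Require Import finmap mpoly boolp separable ring zify.

Set Implicit Arguments.
Unset Strict Implicit.
Unset Printing Implicit Defensive.

Import GRing.Theory.
Local Open Scope ring_scope.

(** A point of the Veronese space is a functional phi on forms of degree d. It is spanned
   by the image of a finite set B when phi is a combination of the evaluations at the
   points of B, and by that of a scheme Z when phi vanishes on the forms of degree d in
   the ideal of Z. All the arguments concern such functionals.

   A local scheme of degree r which spans a space of the largest possible dimension, and
   which is curvilinear, is the germ of a rational normal curve: for some vectors
   e_0, ..., e_(r-1), called here the germ, with pole e_0, its ideal consists of the forms
   f for which f (e_0 + t e_1 + ... + t^(r-1) e_(r-1)) vanishes to order r at t = 0
   ([germ_of_scheme], [double_germ], [curvilinear_triple_germ]). The point is that a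
   linear form which does not vanish at the support is regular modulo the ideal, by a
   graded form of the Nullstellensatz. A functional spanned minimally by a union of germs
   takes, on each germ, the coefficient of t^(r-1) in the product of the restriction of f
   with a polynomial p such that p(0) <> 0 ([minimal_germ_functional]). Multiplication by
   a form which does not vanish at the poles yields a functional of the same kind in lower
   degree.

   This gives lower bounds for the number of points ([card_decomposition_ge]). If phi is
   a combination of the evaluations at the points of B, then B spans the space of the
   germs. A linear form h which is nonzero at the poles can vanish at as many points of B
   as the codimension of the poles; the functional f |-> phi (h f), in degree one less, is
   a combination of the evaluations at the other points. By induction B has at least
   2d - 1 points for a triple germ, d for a double germ and 3d - 1 for their union. The
   bounds are attained ([germ_decomposition_exists]): a functional on a germ kills the
   multiples of a polynomial q + a t^k, which has k distinct roots for general a, in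
   characteristic zero.

   Let now B attain the bound for the union. It does not meet the poles, because the
   evaluation at a pole can be subtracted from phi without changing its kind
   ([two_germs_off_pole]). A hyperplane which contains no pole contains at most three
   points of B, and some combinatorics with the coordinates in a basis from B then shows
   that each point lies on one of the two spans ([two_germs_split]). As the spans are
   complementary, the projections to them separate phi and B
   ([decomposition_component]), and the two parts attain the bounds for the two germs. The
   points P_1 and P_2 are unique, since otherwise some functional on a germ would be
   decomposed with a point less ([germ_point_unique]).

   The conics of the plane which contain the triple germ form a net. A count of the same
   kind, with products of a conic and of lines through pairs of points, shows that a
   member of the net contains the 2d - 1 points ([exists_conic]). It is not a double line,
   and the forms vanishing on it are the multiples of its equation ([quadric_radical]), so
   that it is reduced.

   Conversely, if P lies on the line through P_1 and P_2, which are spanned minimally by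
   the two germs, and differs from both, then it is spanned minimally by their union. The
   bound 3d - 1 forces minimal sets B_1 and B_2 for P_1 and P_2 to be disjoint, and their
   union to be minimal. *)

(** * Values of forms *)

Section Forms.
Variables (K : fieldType) (n : nat).
Implicit Types (f g p q : {mpoly K[n]}) (v w : 'rV[K]_n).

Lemma evalv0 v : evalv (0 : {mpoly K[n]}) v = 0.
Proof. exact: meval0. Qed.

Lemma evalvD f g v : evalv (f + g) v = evalv f v + evalv g v.
Proof. exact: mevalD. Qed.

Lemma evalvB f g v : evalv (f - g) v = evalv f v - evalv g v.
Proof. exact: mevalB. Qed.

Lemma evalvM f g v : evalv (f * g) v = evalv f v * evalv g v.
Proof. exact: mevalM. Qed.

Lemma evalvX f k v : evalv (f ^+ k) v = evalv f v ^+ k.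
Proof. by rewrite /evalv rmorphXn. Qed.

Lemma evalvZ a f v : evalv (a *: f) v = a * evalv f v.
Proof. exact: mevalZ. Qed.

Lemma evalvC a v : evalv a%:MP v = a.
Proof. exact: mevalC. Qed.

Lemma evalvXU i v : evalv 'X_i v = v 0 i.
Proof. exact: mevalXU. Qed.

Lemma evalv_sum (I : Type) (r : seq I) (P : pred I) (F : I -> {mpoly K[n]}) v :
  evalv (\sum_(i <- r | P i) F i) v = \sum_(i <- r | P i) evalv (F i) v.
Proof. by rewrite /evalv raddf_sum. Qed.

Lemma dhomogXU (i : 'I_n) : ('X_i : {mpoly K[n]}) \is 1.-homog.
Proof. by rewrite dhomogX; apply/eqP; apply: mdeg1. Qed.

Lemma dhomog0_const f : f \is 0.-homog -> exists a, f = a%:MP.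
Proof.
move=> hf; exists f@_0%MM; apply/mpolyP => u; rewrite mcoeffC.
have [->|nz] := eqVneq 0%MM u; first by rewrite mulr1.
by rewrite mulr0; apply: dhomog_nemf_coeff hf _; rewrite mdeg_eq0 eq_sym.
Qed.

Lemma dhomog_lin_exp f k : f \is 1.-homog -> f ^+ k \is k.-homog.
Proof. by move=> hf; have := dhomogMn k hf; rewrite mul1n. Qed.

Lemma dhomog_ind (P : nat -> {mpoly K[n]} -> Prop) :
  (forall k, P k 0) ->
  (forall k f g, f \is k.-homog -> g \is k.-homog -> P k f -> P k g ->
     P k (f + g)) ->
  (forall a, P 0%N a%:MP) ->
  (forall k i f, f \is k.-homog -> P k f -> P k.+1 ('X_i * f)) ->
  forall k f, f \is k.-homog -> P k f.
Proof.
move=> P0 PD PC PX.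
have mon k : forall m : 'X_{1..n}, mdeg m = k -> forall a, P k (a *: 'X_[m]).
  elim: k => [|k IH] m dm a.
    have /eqP-> : m == 0%MM by rewrite -mdeg_eq0 dm.
    by rewrite mpolyX0 alg_mpolyC; apply: PC.
  have /existsP[i mi] : [exists i, m i != 0%N].
    apply/contra_eqT: dm => /existsPn m0; rewrite mdegE big1 // => i _.
    by have := m0 i; rewrite negbK => /eqP.
  have le_m : (U_(i) <= m)%MM by rewrite lep1mP.
  have dm' : mdeg (m - U_(i))%MM = k.
    by move: dm; rewrite -{1}(submK le_m) mdegD mdeg1 addn1 => -[].
  rewrite -(submK le_m) addmC mpolyXD scalerAr; apply: PX; last exact: IH.
  by rewrite dhomogZ // dhomogX; apply/eqP.
move=> k f hf; rewrite (mpolyE f).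
suff [] : P k (\sum_(m <- msupp f) f@_m *: 'X_[m]) /\
          \sum_(m <- msupp f) f@_m *: 'X_[m] \is k.-homog by [].
rewrite big_seq; elim/big_ind: _ => [|x y [Px hx] [Py hy]|m mf].
- by split; [apply: P0 | rewrite rpred0].
- by split; [apply: PD | rewrite rpredD].
have dm := dhomog_mf hf mf.
by split; [apply: mon | rewrite dhomogZ // dhomogX dm].
Qed.

Lemma evalv_scale k f a v :
  f \is k.-homog -> evalv f (a *: v) = a ^+ k * evalv f v.
Proof.
move: k f; apply: dhomog_ind => [k|k f g _ _ IHf IHg|c|k i f _ IH].
- by rewrite /evalv !meval0 mulr0.
- by rewrite !evalvD IHf IHg mulrDr.
- by rewrite !evalvC mul1r.
by rewrite !evalvM IH {1 3}/evalv !mevalXU mxE exprS; ring.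
Qed.

Definition linear_form (h : {scalar 'rV[K]_n}) : {mpoly K[n]} :=
  \sum_i h (delta_mx 0 i) *: 'X_i.

Lemma linear_form_homog h : linear_form h \is 1.-homog.
Proof. by apply: rpred_sum => i _; rewrite dhomogZ // dhomogXU. Qed.

Lemma evalv_linear_form h v : evalv (linear_form h) v = h v.
Proof.
rewrite evalv_sum {2}(row_sum_delta v) linear_sum /=.
by apply: eq_bigr => i _; rewrite evalvZ /evalv mevalXU linearZ /= mulrC.
Qed.

Lemma evalv_lin0 f : f \is 1.-homog -> evalv f 0 = 0.
Proof. by move=> hf; rewrite -(scale0r 0) (evalv_scale _ _ hf) mul0r. Qed.

Lemma evalv_linD f v w :
  f \is 1.-homog -> evalv f (v + w) = evalv f v + evalv f w.
Proof. by move=> hf; rewrite -[v in LHS]scale1r evalv_linear // mul1r. Qed.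

Lemma evalv_linZ f a v : f \is 1.-homog -> evalv f (a *: v) = a * evalv f v.
Proof. by move=> hf; rewrite (evalv_scale _ _ hf). Qed.

Lemma evalv_linB f v w :
  f \is 1.-homog -> evalv f (v - w) = evalv f v - evalv f w.
Proof. by move=> hf; rewrite evalv_linD // -scaleN1r evalv_linZ // mulN1r. Qed.

Lemma evalv_lin_sum f (I : Type) (r : seq I) (P : pred I) (F : I -> 'rV[K]_n) :
  f \is 1.-homog ->
  evalv f (\sum_(i <- r | P i) F i) = \sum_(i <- r | P i) evalv f (F i).
Proof.
move=> hf; apply: (big_morph (evalv f)); last exact: evalv_lin0.
by move=> v w; apply: evalv_linD.
Qed.

Lemma evalv_span0 f s : f \is 1.-homog ->
  (forall v, v \in s -> evalv f v = 0) ->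
  forall w, w \in <<s>>%VS -> evalv f w = 0.
Proof.
move=> hf fs w ws; rewrite (coord_span (X := in_tuple s) ws).
rewrite evalv_lin_sum // big1 // => i _.
by rewrite evalv_linZ // fs ?mulr0 // mem_nth.
Qed.

(** The coefficients of a linear form are its values at the basis vectors. Over a
   finite field, a form of higher degree may vanish everywhere. *)
Lemma linear_form_ext f g : f \is 1.-homog -> g \is 1.-homog ->
  (forall v, evalv f v = evalv g v) -> f = g.
Proof.
move=> hf hg fg; apply/mpolyP => m.
have hc (h : {mpoly K[n]}) : h \is 1.-homog ->
    h@_m = if mdeg m == 1%N then \sum_(i | m == U_(i)%MM) evalv h (delta_mx 0 i)
           else 0.
  move=> hh; case: eqP => [/eqP|/eqP ne]; last first.
    exact: dhomog_nemf_coeff hh ne.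
  rewrite mdeg_eq1 => /existsP[i /eqP ->].
  rewrite (big_pred1 i) => [|j]; last by rewrite /= eq_mnm1 eq_sym.
  rewrite /evalv mevalE.
  have -> : h@_U_(i) = \sum_(m <- msupp h) h@_m * (m == U_(i)%MM)%:R.
    rewrite {1}(mpolyE h) raddf_sum; apply: eq_bigr => m' _ /=.
    by rewrite mcoeffZ mcoeffX.
  rewrite big_seq [RHS]big_seq; apply: eq_bigr => m' /(dhomog_mf hh) /eqP.
  rewrite mdeg_eq1 => /existsP[j /eqP->]; congr (_ * _).
  rewrite (bigD1 j) //= big1 ?mulr1 => [|k /negPf kj].
    by rewrite mxE eqxx mnm1E eqxx expr1 eq_mnm1 eq_sym.
  by rewrite mnm1E eq_sym kj expr0.
by rewrite (hc f) // (hc g) //; case: ifP => // _; apply: eq_bigr => i _.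
Qed.

Lemma separating_form (U : {vspace 'rV[K]_n}) v : v \notin U ->
  exists l, [/\ l \is 1.-homog, forall u, u \in U -> evalv l u = 0
                & evalv l v = 1].
Proof.
move=> vU; pose X := [tuple of v :: vbasis U].
have freeX : free X.
  by rewrite free_cons (basis_free (vbasisP U)) (span_basis (vbasisP U)) vU.
exists (linear_form (coord X 0)); split=> [|u uU|].
- exact: linear_form_homog.
- rewrite evalv_linear_form (coord_vbasis uU) linear_sum big1 // => i _ /=.
  rewrite linearZ /= -[(vbasis U)`_i]/(X`_(lift 0 i)) coord_free //.
  by rewrite eq_sym (negPf (neq_lift _ _)) mulr0.
by rewrite evalv_linear_form; exact: (coord_free 0 0 freeX).
Qed.

Lemma dual_form (s : seq 'rV[K]_n) : free s ->
  exists x : nat -> {mpoly K[n]}, forall i, x i \is 1.-homog /\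
    forall j, (j < size s)%N -> evalv (x i) s`_j = (i == j)%:R.
Proof.
move=> fs; pose X := in_tuple s.
exists (fun i => if insub i is Some i' then linear_form (coord X i') else 0).
move=> i; case: insubP => [i' lt_i <-|ge_i]; split=> [|j lt_j].
- exact: linear_form_homog.
- rewrite evalv_linear_form; have := coord_free (X := X) (Ordinal lt_j) i' fs.
  by rewrite eq_sym.
- exact: dhomog0.
by rewrite /evalv meval0 (gtn_eqF (leq_trans lt_j _)) // leqNgt.
Qed.

Lemma dual_form_expand (s : seq 'rV[K]_n) (x : nat -> {mpoly K[n]}) v :
  (forall i, x i \is 1.-homog /\
     forall j, (j < size s)%N -> evalv (x i) s`_j = (i == j)%:R) ->
  v \in <<s>>%VS -> v = \sum_(i < size s) evalv (x i) v *: s`_i.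
Proof.
move=> xP vs; rewrite {1}(coord_span (X := in_tuple s) vs).
apply: eq_bigr => i _; congr (_ *: _); have [hx xs] := xP i.
rewrite {2}(coord_span (X := in_tuple s) vs) evalv_lin_sum // (bigD1 i) //=.
rewrite evalv_linZ // xs // eqxx mulr1 big1 ?addr0 // => j ji.
by rewrite evalv_linZ // xs // (_ : (i == j :> nat) = false) ?mulr0 // eq_sym; apply: negPf.
Qed.

Lemma dhomog_prod_pencil p q (zs : seq K) : p \is 1.-homog -> q \is 1.-homog ->
  \prod_(z <- zs) (p - z *: q) \is (size zs).-homog.
Proof.
move=> hp hq; elim: zs => [|z zs IH]; first by rewrite big_nil dhomog1.
by rewrite big_cons; apply: (@dhomogM _ _ _ 1) => //; rewrite rpredB ?dhomogZ.
Qed.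

End Forms.

(** * Functionals decomposed as sums of evaluations *)

Section Decompositions.
Variables (K : fieldType) (n : nat).
Implicit Types (f g h : {mpoly K[n]}) (v w : 'rV[K]_n) (s : seq 'rV[K]_n).

Definition zeros h : pred 'rV[K]_n := fun v => evalv h v == 0.

Definition decomposes d (phi : {mpoly K[n]} -> K) s :=
  exists c : 'rV[K]_n -> K, forall f, f \is d.-homog ->
    phi f = \sum_(v <- s) c v * evalv f v.

Lemma decomposes_mul d phi s k h : h \is k.-homog ->
  decomposes (k + d) phi s ->
  decomposes d (fun f => phi (h * f)) [seq v <- s | evalv h v != 0].
Proof.
move=> hh [c def_phi]; exists (fun v => c v * evalv h v) => f hf.
rewrite def_phi ?dhomogM // big_filter [RHS]big_mkcond /=.
apply: eq_bigr => v _; rewrite evalvM mulrA.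
by case: eqP => [->|//]; rewrite mulr0 mul0r.
Qed.

Lemma free_subseq s : exists X, [/\ {subset X <= s}, free X & <<X>>%VS = <<s>>%VS].
Proof.
elim: s => [|v s [X [sX fX eX]]]; first by exists [::]; split; rewrite ?nil_free.
case: (boolP (v \in <<X>>%VS)) => vX.
  exists X; split=> //; first by move=> w /sX; rewrite inE orbC => ->.
  by rewrite span_cons -eX; apply/esym/addv_idPr; rewrite -memvE.
exists (v :: X); split; last by rewrite !span_cons eX.
  by move=> w; rewrite !inE => /orP[->//|/sX ->]; rewrite orbT.
by rewrite free_cons vX.
Qed.

(** Multiplication by a linear form which vanishes on s kills phi. *)
Lemma decomposition_spans (W : {vspace 'rV[K]_n}) d phi s :
  (forall h, h \is 1.-homog ->
     (forall f, f \is d.-homog -> phi (h * f) = 0) ->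
     forall w, w \in W -> evalv h w = 0) ->
  decomposes d.+1 phi s -> (W <= <<s>>)%VS.
Proof.
move=> conc [c def_phi]; apply: contraT => /subvPn[w wW /separating_form].
case=> l [hl l0 lw]; have := conc l hl _ w wW.
rewrite lw => /(_ _)/eqP; rewrite oner_eq0; apply => f hf.
rewrite def_phi; last by rewrite -add1n dhomogM.
rewrite big_seq big1 // => v vs; rewrite evalvM l0 ?memv_span //.
by rewrite mul0r mulr0.
Qed.

Lemma count_uniq_sub (T : eqType) (a : pred T) (s t : seq T) :
  uniq s -> {subset s <= t} -> (count a s <= count a t)%N.
Proof.
move=> us st; rewrite -!size_filter; apply: uniq_leq_size.
  exact: filter_uniq.
by move=> x; rewrite !mem_filter => /andP[-> /st].
Qed.

End Decompositions.

Lemma exists_notin (K : closedFieldType) (s : seq K) : exists x, x \notin s.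
Proof.
case: s => [|a s]; first by exists 0.
pose p := \prod_(z <- a :: s) ('X - z%:P) + 1.
have /closed_rootP[x /rootP px] : size p != 1.
  by rewrite size_polyDl size_prod_XsubC // size_poly1.
exists x; apply/negP => xs; move: px.
rewrite hornerD hornerC; move/eqP: (root_prod_XsubC (a :: s) x).
rewrite xs /root => /eqP/eqP ->; rewrite add0r => /eqP.
by rewrite oner_eq0.
Qed.

Section LowerBound.
Variables (K : closedFieldType) (n : nat).
Implicit Types (f g h : {mpoly K[n]}) (v w : 'rV[K]_n) (s : seq 'rV[K]_n).

(** If h vanishes at a further pole e, some coordinate dual to X is nonzero at e, and
   adding a general multiple of it to h spoils a single zero in X. *)
Lemma form_avoiding es X : free X ->
  (forall e, e \in es -> e \in <<X>>%VS /\ e != 0) ->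
  exists h, [/\ h \is 1.-homog, forall e, e \in es -> evalv h e != 0
    & (size X <= size es + count (zeros h) X)%N].
Proof.
move=> fX; elim: es => [|e es IH] esP.
  exists 0; split=> //; first exact: dhomog0.
  rewrite leq_eqVlt; apply/orP; left; rewrite eq_sym -all_count.
  by apply/allP => v _; rewrite /zeros /evalv meval0.
have [e' e's|h [hh hes hX]] := IH; first by apply: esP; rewrite inE e's orbT.
have [he0|nz_he] := eqVneq (evalv h e) 0; last first.
  exists h; split=> //; last by apply: leq_trans hX _; rewrite leq_add2r.
  by move=> e'; rewrite inE => /orP[/eqP->|/hes].
have [eX nz_e] := esP e (mem_head _ _).
have [x xP] := dual_form fX.
have [i [lt_i nz_xe]] : exists i, (i < size X)%N /\ evalv (x i) e != 0.
  apply: contrapT => nex; case/eqP: nz_e; rewrite (dual_form_expand xP eX).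
  apply: big1 => i _; have [->|nz] := eqVneq (evalv (x i) e) 0; first exact: scale0r.
  by case: nex; exists i.
have [t] := exists_notin (0 :: [seq - evalv h e' / evalv (x i) e' | e' <- es]).
rewrite inE negb_or => /andP[nz_t /mapP tP].
exists (h + t *: x i); split.
- by rewrite rpredD // dhomogZ //; case: (xP i).
- move=> e'; rewrite inE => /orP[/eqP->|e's].
    by rewrite evalvD evalvZ he0 add0r mulf_neq0.
  apply/eqP => h0; case: tP; exists e' => //; move: h0.
  rewrite evalvD evalvZ; have [->|nz] := eqVneq (evalv (x i) e') 0.
    by rewrite mulr0 addr0 => /eqP; rewrite (negPf (hes _ e's)).
  by move=> h0; rewrite (addr0_eq h0) mulfK.
apply: leq_trans hX _; rewrite /= addSnnS leq_add2l.
apply: (@leq_trans (count (predU (pred1 X`_i) (zeros (h + t *: x i))) X));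
  last first.
  have := count_predUI (pred1 X`_i) (zeros (h + t *: x i)) X.
  rewrite (count_uniq_mem _ (free_uniq fX)) mem_nth // add1n => <-.
  exact: leq_addr.
rewrite -!size_filter; apply: uniq_leq_size (filter_uniq _ (free_uniq fX)) _.
move=> v; rewrite !mem_filter => /andP[hv0 vX]; rewrite vX andbT.
have /(nthP 0)[j lt_j def_v] := vX; rewrite -def_v /= in hv0 *; rewrite /zeros.
rewrite evalvD evalvZ (xP i).2 // (eqP hv0) add0r.
by have [->|_] := eqVneq i j; rewrite ?eqxx // mulr0 eqxx orbT.
Qed.

(** The cardinality bound grows, with the degree, by the codimension of the
   poles: a linear form which is nonzero at the poles, but vanishes at as many
   of the given points as possible, lowers the degree by one. *)
Lemma card_decomposition_ge (W : {vspace 'rV[K]_n}) es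
    (F : nat -> ({mpoly K[n]} -> K) -> Prop) :
  (forall e, e \in es -> e \in W /\ e != 0) ->
  (forall d phi h, F d.+1 phi -> h \is 1.-homog ->
     (forall e, e \in es -> evalv h e != 0) -> F d (fun f => phi (h * f))) ->
  (forall d phi h, F d.+2 phi -> h \is 1.-homog ->
     (forall f, f \is d.+1.-homog -> phi (h * f) = 0) ->
     forall w, w \in W -> evalv h w = 0) ->
  forall d phi s, F d.+2 phi -> decomposes d.+2 phi s ->
    ((\dim W - size es) * d + \dim W <= size s)%N.
Proof.
move=> esW mulF concF.
have Wspan d phi s : F d.+2 phi -> decomposes d.+2 phi s -> (W <= <<s>>)%VS.
  by move=> Fphi; apply: decomposition_spans => h; apply: concF.
elim=> [|d IH] phi s Fphi dec.
  by rewrite muln0 (leq_trans (dimvS (Wspan _ _ _ Fphi dec))) ?dim_span.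
have [X [sX fX eX]] := free_subseq s.
have leW : (\dim W <= size X)%N.
  by rewrite -(eqP fX) eX dimvS // (Wspan _ _ _ Fphi dec).
have [e /esW[eW nz_e]|h [hh hes hX]] := @form_avoiding es X fX.
  by rewrite nz_e eX (subvP (Wspan _ _ _ Fphi dec)).
have := IH _ _ (mulF _ _ _ Fphi hh hes) (decomposes_mul hh dec).
rewrite size_filter => le.
rewrite -(count_predC (zeros h) s) mulnSr addnAC addnC leq_add //.
rewrite leq_subLR (leq_trans leW) // (leq_trans hX) // leq_add2l.
exact: count_uniq_sub (free_uniq fX) sX.
Qed.

End LowerBound.

(** * Functionals on germs of rational normal curves *)

Section Along.
Variables (K : fieldType) (n : nat).
Implicit Types (f g h : {mpoly K[n]}) (v w : 'rV[K]_n) (E : seq 'rV[K]_n).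

(** The restriction of a form to the parametrized curve
   t |-> e_0 + t e_1 + ... + t^(r-1) e_(r-1). *)
Definition along E f : {poly K} :=
  mmap (@polyC K) (fun i => Poly [seq v 0 i | v : 'rV[K]_n <- E]) f.

Lemma alongD E f g : along E (f + g) = along E f + along E g.
Proof. exact: mmapD. Qed.

Lemma alongB E f g : along E (f - g) = along E f - along E g.
Proof. exact: mmapB. Qed.

Lemma alongM E f g : along E (f * g) = along E f * along E g.
Proof. exact: (rmorphM (mmap _ _)). Qed.

Lemma alongXn E f k : along E (f ^+ k) = along E f ^+ k.
Proof. exact: (rmorphXn (mmap _ _)). Qed.

Lemma alongC E a : along E a%:MP = a%:P.
Proof. exact: mmapC. Qed.

Lemma along0 E : along E 0 = 0.
Proof. exact: mmap0. Qed.

Lemma alongZ E a f : along E (a *: f) = a *: along E f.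
Proof. by rewrite /along mmapZ mul_polyC. Qed.

Lemma alongX E i : along E 'X_i = Poly [seq v 0 i | v : 'rV[K]_n <- E].
Proof. by rewrite /along mmapX mmap1U. Qed.

Definition curve E (z : K) : 'rV[K]_n := \sum_(j < size E) z ^+ j *: E`_j.

Lemma horner_along E f z : (along E f).[z] = evalv f (curve E z).
Proof.
have [k lek] := ubnP (msize f).
elim/mpolyind: f {k lek} => [|a m f _ _ IH].
  by rewrite along0 horner0 /evalv meval0.
rewrite alongD hornerD evalvD IH; congr (_ + _).
rewrite alongZ hornerZ evalvZ; congr (_ * _).
rewrite /along mmapX /mmap1 horner_prod /evalv mevalX; apply: eq_bigr => i _.
rewrite horner_exp; congr (_ ^+ _).
rewrite (@horner_coef_wide _ (size E)); last first.
  by apply: leq_trans (size_Poly _) _; rewrite size_map.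
rewrite /curve summxE; apply: eq_bigr => j _.
by rewrite coef_Poly (nth_map 0) // mxE mulrC.
Qed.

Lemma curve0 E : (0 < size E)%N -> curve E 0 = E`_0.
Proof.
case: E => // e E _; rewrite /curve /= big_ord_recl /= expr0 scale1r.
by rewrite big1 ?addr0 // => j _; rewrite exprS mul0r scale0r.
Qed.

Lemma along_coef0 E f : (0 < size E)%N -> (along E f)`_0 = evalv f E`_0.
Proof. by move=> E0; rewrite -horner_coef0 horner_along curve0. Qed.

Lemma size_along k E f : f \is k.-homog ->
  (size (along E f) <= (k * (size E).-1).+1)%N.
Proof.
move: k f; apply: dhomog_ind => [k|k f g _ _ IHf IHg|a|k i f _ IH].
- by rewrite along0 size_poly0.
- by rewrite alongD (leq_trans (size_polyD _ _)) // geq_max IHf.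
- by rewrite alongC size_polyC leq_b1.
rewrite alongM (leq_trans (size_polyMleq _ _)) //.
have : (size (along E 'X_i) <= (size E).-1.+1)%N.
  rewrite alongX (leq_trans (size_Poly _)) // size_map.
  by case: E {IH}.
case: (size (along E 'X_i)) => [_|a].
  by rewrite add0n (leq_trans (leq_pred _)) // (leq_trans IH) // ltnS leq_mul2r leqnSn orbT.
by rewrite addSn /= ltnS => le; rewrite mulSn -addnS leq_add.
Qed.

Lemma along_lin E f j : f \is 1.-homog ->
  (along E f)`_j = if (j < size E)%N then evalv f E`_j else 0.
Proof.
move=> hf; have -> : along E f = Poly [seq evalv f v | v <- E].
  have hP : forall k f, f \is k.-homog -> k = 1%N ->
      along E f = Poly [seq evalv f v | v <- E].
    apply: dhomog_ind => [k _|k f1 f2 _ _ IH1 IH2 k1|//|k i g hg _ [k0]].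
    - rewrite along0; apply/polyP => i; rewrite coef_Poly coef0.
      have [lt_i|ge_i] := ltnP i (size E); last by rewrite nth_default ?size_map.
      by rewrite (nth_map 0) // /evalv meval0.
    - rewrite alongD IH1 // IH2 //; apply/polyP => i; rewrite coefD !coef_Poly.
      have [lt_i|ge_i] := ltnP i (size E).
        by rewrite !(nth_map 0) // evalvD.
      by rewrite !nth_default ?size_map // addr0.
    have [a ->] : exists a, g = a%:MP by have := hg; rewrite k0 => /dhomog0_const.
    rewrite alongM alongC alongX; apply/polyP => l; rewrite mulrC coefCM !coef_Poly.
    have [lt_l|ge_l] := ltnP l (size E).
      by rewrite !(nth_map 0) // evalvM evalvC {1}/evalv mevalXU mulrC.
    by rewrite !nth_default ?size_map // mulr0.
  exact: hP hf _.
rewrite coef_Poly; case: ltnP => [lt_j|ge_j]; first by rewrite (nth_map 0).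
by rewrite nth_default ?size_map.
Qed.

Lemma along_dual E x i : x \is 1.-homog -> (i < size E)%N ->
  (forall j, (j < size E)%N -> evalv x E`_j = (i == j)%:R) ->
  along E x = 'X^i.
Proof.
move=> hx lt_i xE; apply/polyP => j; rewrite along_lin // coefXn eq_sym.
case: ltnP => [/xE//|ge_j]; case: eqP => // e.
by move: lt_i; rewrite e ltnNge ge_j.
Qed.

Lemma low_coefs_cancel (p q : {poly K}) r : p`_0 != 0 ->
  (forall k, (k < r)%N -> (p * q)`_k = 0) -> forall k, (k < r)%N -> q`_k = 0.
Proof.
move=> p0 pq k; have [m le_km] := ubnP k; elim: m k le_km => // m IH k le_km lt_k.
have := pq k lt_k; rewrite coefM big_ord_recl subn0 /= big1 => [|i _].
  by rewrite addr0 => /eqP; rewrite mulf_eq0 (negPf p0) => /eqP.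
rewrite (IH (k - bump 0 i)%N) ?mulr0 //.
  apply: (@leq_trans k); last by rewrite -ltnS.
  by rewrite ltn_subrL (leq_ltn_trans _ (ltn_ord i)).
by rewrite (leq_ltn_trans _ lt_k) // leq_subr.
Qed.

Lemma low_coefs_mul (p q : {poly K}) r :
  (forall k, (k < r)%N -> q`_k = 0) -> forall k, (k < r)%N -> (p * q)`_k = 0.
Proof.
move=> q0 k lt_k; rewrite coefM big1 // => i _; rewrite q0 ?mulr0 //.
by rewrite (leq_ltn_trans _ lt_k) // leq_subr.
Qed.

End Along.

Section GermFunctionals.
Variables (K : fieldType) (n : nat) (I : finType) (E : I -> seq 'rV[K]_n).
Implicit Types (f g h : {mpoly K[n]}) (v w : 'rV[K]_n).

(** Coordinates adapted to all the germs at once, which exist when the germs are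
   linearly independent. *)
Definition dual_forms := forall i j, (j < size (E i))%N ->
  exists2 x, x \is 1.-homog & forall i' j', (j' < size (E i'))%N ->
    evalv x (E i')`_j' = ((i == i') && (j == j'))%:R.

(** The linear functionals on forms of degree d which vanish on the ideal of
   the union of the germs, but not on that of a proper subscheme. On the i-th germ, a
   functional on polynomials modulo t^r is the coefficient of t^(r-1) in a product by
   p i, and it does not kill t^(r-1) if p i has a nonzero constant term. In this
   encoding, multiplication by a form multiplies p i by the restriction of the form. *)
Definition germ_functional (d : nat) (phi : {mpoly K[n]} -> K) :=
  exists2 p : I -> {poly K}, forall i, (p i)`_0 != 0 &
    forall f, f \is d.-homog ->
      phi f = \sum_i (p i * along (E i) f)`_(size (E i)).-1.

Hypotheses (E_gt0 : forall i, (0 < size (E i))%N) (E_dual : dual_forms).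

Lemma germ_pole_neq0 i : (E i)`_0 != 0.
Proof.
have [x hx xE] := E_dual (E_gt0 i); apply/eqP => e0.
have := xE i 0%N (E_gt0 i); rewrite e0 evalv_lin0 // !eqxx => /eqP.
by rewrite eq_sym oner_eq0.
Qed.

Lemma germ_functional_mul k d phi h :
  germ_functional (k + d) phi -> h \is k.-homog ->
  (forall i, evalv h (E i)`_0 != 0) ->
  germ_functional d (fun f => phi (h * f)).
Proof.
move=> [p p0 def_phi] hh nzh; exists (fun i => p i * along (E i) h) => [i|f hf].
  by rewrite coef0M mulf_neq0 // along_coef0.
rewrite def_phi ?dhomogM //; apply: eq_bigr => i _.
by rewrite alongM mulrA.
Qed.

(** The forms x_0^d x_j, for the coordinates x_0, x_1, ... along each germ. *)
Lemma germ_monomials d : exists t : I -> nat -> {mpoly K[n]}, forall i j,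
  t i j \is d.+1.-homog /\ ((j < size (E i))%N -> forall i',
    along (E i') (t i j) = if i == i' then 'X^j else 0).
Proof.
have /choice[x xP] (ij : I * nat) : exists x, x \is 1.-homog /\
   ((ij.2 < size (E ij.1))%N -> forall i' j', (j' < size (E i'))%N ->
       evalv x (E i')`_j' = ((ij.1 == i') && (ij.2 == j'))%:R).
  have [lt|_] := ltnP ij.2 (size (E ij.1)); last by exists 0; split=> //; apply: dhomog0.
  by have [x hx xE] := E_dual lt; exists x.
exists (fun i j => x (i, 0%N) ^+ d * x (i, j)) => i j.
have [[hx0 x0E] [hx xE]] := (xP (i, 0%N), xP (i, j)).
split=> [|lt_j i']; first by have := dhomogM (dhomog_lin_exp d hx0) hx; rewrite addn1.
rewrite alongM alongXn; case: eqP => [<-|ne].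
  rewrite (along_dual hx0 (E_gt0 i)) => [|l lt]; last by rewrite x0E //= eqxx.
  rewrite (along_dual hx lt_j) => [|l lt]; last by rewrite xE //= eqxx.
  by rewrite expr0 expr1n mul1r.
rewrite (_ : along _ (x (i, j)) = 0) ?mulr0 //.
apply/polyP => l; rewrite along_lin // coef0; case: ifP => // lt.
by rewrite xE //=; case: eqP ne.
Qed.

(** Testing phi on the products of g by the monomials along the i-th germ recovers
   the coefficients of p i times g on that germ. *)
Lemma germ_functional_faithful k d phi g :
  germ_functional (k + d.+1) phi -> g \is k.-homog ->
  (forall f, f \is d.+1.-homog -> phi (g * f) = 0) ->
  forall i j, (j < size (E i))%N -> (along (E i) g)`_j = 0.
Proof.
move=> [p p0 def_phi] hg phig0 i; apply: low_coefs_cancel (p0 i) _ => j lt_j.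
have [t tP] := germ_monomials d.
have lt_j' : ((size (E i)).-1 - j < size (E i))%N.
  by rewrite (leq_ltn_trans (leq_subr _ _)) // prednK.
have [ht tE] := tP i ((size (E i)).-1 - j)%N.
have := phig0 _ ht; rewrite def_phi ?dhomogM // (bigD1 i) //=.
rewrite big1 ?addr0 => [|i' ni']; last first.
  by rewrite alongM tE // eq_sym (negPf ni') !mulr0 coef0.
rewrite alongM tE // eqxx mulrA coefMXn ltnNge leq_subr /= subKn //.
by rewrite -ltnS prednK.
Qed.

Lemma germ_functional_concise d phi h :
  germ_functional d.+2 phi -> h \is 1.-homog ->
  (forall f, f \is d.+1.-homog -> phi (h * f) = 0) ->
  forall w, w \in (\sum_i <<E i>>)%VS -> evalv h w = 0.
Proof.
move=> gphi hh h0; have hE := @germ_functional_faithful 1 d phi h gphi hh h0.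
move=> w /memv_sumP[u uE ->]; rewrite evalv_lin_sum // big1 // => i _.
apply: evalv_span0 (uE i isT) => // _ /(nthP 0)[j lt_j <-].
by have := hE i j lt_j; rewrite along_lin // lt_j.
Qed.

(** Evaluation at the pole of a germ only affects the top coefficient of the
   polynomial attached to that germ. *)
Lemma germ_functional_pole d phi i a : (1 < size (E i))%N ->
  germ_functional d phi ->
  germ_functional d (fun f => phi f - a * evalv f (E i)`_0).
Proof.
move=> Ei [p p0 def_phi].
exists (fun j => p j - (if j == i then a *: 'X^((size (E i)).-1) else 0)) => [j|f hf].
  rewrite coefB; case: ifP => _; last by rewrite coef0 subr0.
  by rewrite coefZ coefXn -(subnKC Ei) /= mulr0 subr0.
rewrite def_phi // [in RHS](bigD1 i) //= [in LHS](bigD1 i) //= eqxx.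
rewrite mulrBl coefB -scalerAl coefZ coefXnM ltnn subnn along_coef0 //.
rewrite addrAC; congr (_ + _); apply: eq_bigr => j /negPf ->.
by rewrite subr0.
Qed.

(** The points of s proportional to the pole contribute a multiple of the evaluation
   at the pole. *)
Lemma decomposes_off_pole d phi i s : (1 < size (E i))%N ->
  germ_functional d phi -> decomposes d phi s ->
  exists2 psi, germ_functional d psi &
    decomposes d psi [seq v <- s | v \notin <[(E i)`_0]>%VS].
Proof.
move=> Ei gphi [c def_phi].
have [x hx xE] := E_dual (E_gt0 i).
pose a := \sum_(v <- s | v \in <[(E i)`_0]>%VS) c v * evalv x v ^+ d.
exists (fun f => phi f - a * evalv f (E i)`_0); first exact: germ_functional_pole.
exists c => f hf; rewrite def_phi // big_filter.
rewrite (bigID (fun v => v \in <[(E i)`_0]>%VS)) /= addrC mulr_suml.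
apply/eqP; rewrite subr_eq; apply/eqP; congr (_ + _).
apply: eq_bigr => v /vlineP[b ->]; rewrite (evalv_scale _ _ hf).
by rewrite (evalv_linZ _ _ hx) xE // !eqxx mulr1 mulrA.
Qed.

End GermFunctionals.

(** * The least number of points for a functional on germs *)

Section Bounds.
Variables (K : closedFieldType) (n : nat).
Implicit Types (f g h : {mpoly K[n]}) (v w : 'rV[K]_n) (s : seq 'rV[K]_n).

Lemma germ_decomposition_ge (I : finType) (E : I -> seq 'rV[K]_n) d phi s :
  (forall i, (0 < size (E i))%N) -> dual_forms E ->
  germ_functional E d.+2 phi -> decomposes d.+2 phi s ->
  ((\dim (\sum_i <<E i>>) - #|I|) * d + \dim (\sum_i <<E i>>) <= size s)%N.
Proof.
move=> E0 Ed gphi dec.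
have -> : #|I| = size [seq (E i)`_0 | i : I] by rewrite size_map cardE.
apply: card_decomposition_ge gphi dec => [_ /mapP[i _ ->]|e phi' h gphi hh nz|].
- split; first by rewrite (subvP (sumv_sup i isT (subvv _))) // memv_span // mem_nth.
  exact: germ_pole_neq0.
- apply: (@germ_functional_mul _ _ _ _ E0 1) gphi hh _ => i.
  by apply: nz; apply: map_f; rewrite mem_enum.
exact: germ_functional_concise.
Qed.

Definition one_germ (E : seq 'rV[K]_n) (i : unit) := E.
Definition two_germs (E1 E2 : seq 'rV[K]_n) (i : bool) := if i then E1 else E2.

Lemma one_germ_dual E : free E -> dual_forms (one_germ E).
Proof.
move=> fE [] j lt_j; have [x xP] := dual_form fE.
by exists (x j) => [|[] j' lt_j']; rewrite ?eqxx //; case: (xP j) => // _ ->.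
Qed.

Lemma two_germs_dual E1 E2 : free (E1 ++ E2) -> dual_forms (two_germs E1 E2).
Proof.
move=> fE i j lt_j; have [x xP] := dual_form fE.
pose sh (i : bool) j := (if i then j else size E1 + j)%N.
have shP i' j' : (j' < size (two_germs E1 E2 i'))%N ->
    (sh i' j' < size (E1 ++ E2))%N /\ (E1 ++ E2)`_(sh i' j') = (two_germs E1 E2 i')`_j'.
  case: i' => /= lt; rewrite size_cat nth_cat /sh.
    by rewrite (leq_trans lt) ?leq_addr // lt.
  by rewrite ltn_add2l lt ltnNge leq_addr /= addKn.
exists (x (sh i j)) => [|i' j' lt_j']; first by case: (xP (sh i j)).
have [lt <-] := shP _ _ lt_j'; rewrite (xP _).2 //; congr (_%:R).
case: i i' lt_j lt_j' {lt} => [] [] /= lt_j lt_j' //; rewrite ?eqn_add2l //.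
  by rewrite (ltn_eqF (leq_trans lt_j (leq_addr _ _))).
by rewrite eq_sym (ltn_eqF (leq_trans lt_j' (leq_addr _ _))).
Qed.

Lemma one_germ_ge E d phi s : (0 < size E)%N -> free E ->
  germ_functional (one_germ E) d.+2 phi -> decomposes d.+2 phi s ->
  ((size E).-1 * d.+1 < size s)%N.
Proof.
move=> E0 fE gphi dec.
have := germ_decomposition_ge (fun _ => E0) (one_germ_dual fE) gphi dec.
rewrite (bigD1 tt) //= big1 => [|[]//]; rewrite addv0 (eqP fE) card_unit.
by rewrite subn1 -{2}(prednK E0) addnS -mulnSr.
Qed.

Lemma two_germs_ge E1 E2 d phi s : (0 < size E1)%N -> (0 < size E2)%N ->
  free (E1 ++ E2) -> germ_functional (two_germs E1 E2) d.+2 phi ->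
  decomposes d.+2 phi s ->
  (((size E1).-1 + (size E2).-1) * d.+1 + 2 <= size s)%N.
Proof.
move=> E10 E20 fE gphi dec.
have E0 i : (0 < size (two_germs E1 E2 i))%N by case: i.
have := germ_decomposition_ge E0 (two_germs_dual fE) gphi dec.
rewrite big_bool /= -span_cat (eqP fE) card_bool size_cat.
case: (size E1) E10 => // a _; case: (size E2) E20 => // b _.
by rewrite addSn addnS subn2 /= addnS /= mulnS; lia.
Qed.

End Bounds.

Section UpperBound.
Variables (K : closedFieldType).
Hypothesis charK0 : [pchar K] =i pred0.

Lemma natf_neq0 k : (0 < k)%N -> k%:R != 0 :> K.
Proof. by rewrite ((pcharf0P K).1 charK0) lt0n. Qed.

(** A multiple root of q + a X^k is a root of X q' - k q, which does not depend on a,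
   and it is a root for a single value of a. *)
Lemma separable_extension (q : {poly K}) k : q`_0 != 0 -> (size q <= k)%N ->
  exists a, exists2 zs, uniq zs & size zs = k /\
    (a != 0 /\ q + a *: 'X^k = a *: \prod_(z <- zs) ('X - z%:P)).
Proof.
move=> q0 le_q.
have k0 : (0 < k)%N.
  by rewrite lt0n; apply: contraNneq q0 => k0; move: le_q; rewrite k0 leqn0 size_poly_eq0 => /eqP->; rewrite coef0.
pose w := 'X * q^`() - k%:R *: q.
have w0 : w != 0.
  apply/eqP => /(congr1 (fun p : {poly K} => p`_0)); rewrite coefB coefXM /= coefZ coef0 sub0r.
  by move/eqP; rewrite oppr_eq0 mulf_eq0 (negPf q0) (negPf (natf_neq0 k0)).
have [rs def_w] := closed_field_poly_normal w.
have [a] := exists_notin (0 :: [seq - q.[t] / t ^+ k | t <- rs]).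
rewrite inE negb_or => /andP[nz_a /mapP aP].
pose P := q + a *: 'X^k.
have sP : size P = k.+1.
  by rewrite /P addrC size_polyDl size_scale ?size_polyXn // ltnS.
have lP : lead_coef P = a.
  by rewrite /lead_coef sP /= coefD coefZ coefXn eqxx mulr1 nth_default ?add0r.
have [zs def_P] := closed_field_poly_normal P; rewrite lP in def_P.
exists a, zs; last first.
  split=> //; have := congr1 (fun p : {poly K} => size p) def_P.
  by rewrite size_scale // size_prod_XsubC sP => -[].
have root_P t : root P t -> t != 0.
  move=> Pt; apply: contraNneq q0 => t0; move: Pt; rewrite t0 /root /P hornerD hornerZ hornerXn.
  by rewrite expr0n (gtn_eqF k0) mulr0 addr0 horner_coef0.
suff : separable_poly P by rewrite def_P separable_poly.unlock derivZ coprimepZl // coprimepZr // -separable_prod_XsubC separable_poly.unlock.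
rewrite separable_poly.unlock; apply/Pdiv.ClosedField.coprimepP => t Pt; apply/negP => /eqP dPt.
have nz_t := root_P t Pt.
have Pt0 : q.[t] = - (a * t ^+ k).
  by move: Pt; rewrite /root hornerD hornerZ hornerXn addr_eq0 => /eqP.
have dPt0 : q^`().[t] = - (a * (t ^+ k.-1 *+ k)).
  move/eqP: dPt; rewrite derivD derivZ derivXn hornerD hornerZ hornerMn hornerXn.
  by rewrite addr_eq0 => /eqP.
case: aP; exists t; last by rewrite Pt0 opprK mulfK // expf_neq0.
suff : root w t by rewrite def_w rootZ ?lead_coef_eq0 // root_prod_XsubC.
rewrite /root /w hornerD hornerM hornerN hornerZ hornerX Pt0 dPt0.
by rewrite -[in t ^+ k](prednK k0) exprS -mulr_natr; apply/eqP; ring.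
Qed.

Lemma interpolation (zs : seq K) : uniq zs -> exists L : K -> {poly K},
  forall R : {poly K}, (size R <= size zs)%N -> R = \sum_(z <- zs) R.[z] *: L z.
Proof.
move=> uz; pose num z := \prod_(y <- zs | y != z) ('X - y%:P).
exists (fun z => (num z).[z]^-1 *: num z) => R sR.
apply/eqP; rewrite -subr_eq0; apply: contraT => nz.
suff : (size zs < size (R - \sum_(z <- zs) R.[z] *: ((num z).[z]^-1 *: num z))%R)%N.
  rewrite ltnNge => /negP[]; rewrite (leq_trans (size_polyD _ _)) // geq_max sR /=.
  rewrite size_polyN big_seq.
  elim/big_ind: _ => [|P Q sP sQ|z zzs]; first by rewrite size_poly0.
    by rewrite (leq_trans (size_polyD _ _)) // geq_max sP.
  do 2![apply: leq_trans (size_scale_leq _ _) _].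
  rewrite /num -big_filter size_prod_XsubC size_filter.
  rewrite -(count_predC (fun y => y != z) zs) -addn1 leq_add2l.
  by rewrite -has_count; apply/hasP; exists z => //=; rewrite negbK.
apply: max_poly_roots nz _ (uz); apply/allP => z zzs.
have num0 y : y != z -> (num y).[z] = 0.
  move=> yz; rewrite horner_prod; apply/eqP; rewrite prodf_seq_eq0; apply/hasP.
  by exists z => //=; rewrite eq_sym yz hornerXsubC subrr eqxx.
rewrite rootE hornerD hornerN horner_sum (bigD1_seq z) //= big1 => [|y yz]; last first.
  by rewrite !hornerZ num0 ?mulr0.
rewrite !hornerZ mulVf ?mulr1 ?addr0 ?subrr // horner_prod prodf_seq_neq0.
by apply/allP => y _; apply/implyP => yz; rewrite hornerXsubC subr_eq0 eq_sym.
Qed.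

(** A functional supported on the germ is a functional on univariate
   polynomials F, taking the coefficient of degree r - 1 in p F. For q inverse to p
   modulo X^r, it kills all the multiples of P = q + a X^k of the relevant degree;
   so it is a combination of evaluations at the roots of P. *)
Lemma germ_decomposition_exists n (E : seq 'rV[K]_n) d phi :
  (1 < size E)%N -> free E -> germ_functional (one_germ E) d.+2 phi ->
  exists s, [/\ size s = ((size E).-1 * d.+1).+1, forall v, v \in s -> v != 0
    & decomposes d.+2 phi s].
Proof.
move=> E1 fE [p' p'0 def_phi]; pose p := p' tt; pose r := size E.
have p0 : p`_0 != 0 by apply: p'0.
have {}def_phi f : f \is d.+2.-homog -> phi f = (p * along E f)`_r.-1.
  by move=> hf; rewrite def_phi // (bigD1 tt) //= big1 ?addr0 // => -[].
pose k := (r.-1 * d.+1).+1.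
have r0 : (0 < r)%N by apply: leq_trans E1.
have le_rk : (r <= k)%N by rewrite -(prednK r0) ltnS leq_pmulr.
have [q le_q pq] : exists2 q : {poly K}, (size q <= r)%N &
    forall i, (i < r)%N -> (p * q)`_i = (i == 0%N)%:R.
  have : coprimep p 'X^r.
    by rewrite coprimep_expr // coprimepX rootE horner_coef0.
  case/Bezout_eq1_coprimepP=> -[u v] /= uv; exists (u %% 'X^r).
    by rewrite -ltnS -(size_polyXn K r) ltn_modp monic_neq0 ?monicXn.
  move=> i lt_i; have := congr1 (fun P : {poly K} => P`_i) uv.
  rewrite {1}(divp_eq u 'X^r) coef1 => <-.
  rewrite (_ : (_ + _) * _ + _ = p * (u %% 'X^r) + (u %/ 'X^r * p + v) * 'X^r).
    by rewrite [in RHS]coefD coefMXn lt_i addr0.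
  by ring.
have q0 : q`_0 != 0.
  by have := pq 0%N r0; rewrite coef0M => /eqP; apply: contraTneq => ->; rewrite mulr0 eq_sym oner_eq0.
have [a [zs uz [sz [nz_a def_P]]]] := separable_extension q0 (leq_trans le_q le_rk).
have [L Lagrange] := interpolation uz; rewrite sz in Lagrange.
have [x xP] := dual_form fE.
have xc z : evalv (x 1%N) (curve E z) = z.
  by rewrite -horner_along (along_dual (xP 1%N).1 E1 (xP 1%N).2) expr1 hornerX.
exists [seq curve E z | z <- zs]; split.
- by rewrite size_map sz.
- move=> _ /mapP[z _ ->]; apply/eqP => c0.
  have := horner_along E (x 0%N) z; rewrite c0 evalv_lin0; last by case: (xP 0%N).
  rewrite (along_dual (xP 0%N).1 r0 (xP 0%N).2).
  by rewrite expr0 hornerC => /eqP; rewrite oner_eq0.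
exists (fun v => (p * L (evalv (x 1%N) v))`_r.-1) => f hf.
rewrite def_phi // big_map.
set F := along E f; set P := q + a *: 'X^k in def_P.
have sP : size P = k.+1 by rewrite def_P size_scale // size_prod_XsubC sz.
have nzP : P != 0 by rewrite -size_poly_gt0 sP.
have pP i : (i < r)%N -> (p * P)`_i = (i == 0%N)%:R.
  move=> lt_i; rewrite /P mulrDr coefD pq // -scalerAr coefZ coefMXn.
  by rewrite (leq_trans lt_i) // mulr0 addr0.
have sF : (size F <= (r.-1 * d.+2).+1)%N.
  by rewrite mulnC; apply: size_along hf.
have sU : (size (F %/ P)%R <= r.-1)%N.
  rewrite size_divp // sP /= /k; move: sF; rewrite mulnS => le.
  by rewrite leq_subLR addSn [(_ * _ + _)%N]addnC.
have Pz z : z \in zs -> P.[z] = 0.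
  move=> zzs; rewrite def_P hornerZ; apply/eqP; rewrite mulf_eq0 orbC.
  by have := root_prod_XsubC zs z; rewrite zzs /root => ->.
have kill : (p * (F %/ P * P))`_r.-1 = 0.
  rewrite mulrC -mulrA [P * p]mulrC mulrC coefM big_ord_recl.
  rewrite subn0 [(F %/ P)`_ _]nth_default // mulr0 add0r big1 // => i _.
  rewrite pP /= ?mul0r //.
  by have := ltn_ord i; rewrite /bump /= add1n -ltnS prednK.
rewrite (divp_eq F P) mulrDr coefD kill add0r.
rewrite {1}(Lagrange (F %% P)); last by rewrite -ltnS -sP ltn_modp.
rewrite mulr_sumr coef_sum [LHS]big_seq [RHS]big_seq; apply: eq_bigr => z zzs.
rewrite xc -scalerAr coefZ mulrC -horner_along -/F; congr (_ * _).
by rewrite [in RHS](divp_eq F P) hornerD hornerM Pz // mulr0 add0r.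
Qed.

End UpperBound.

(** * The points of a minimal decomposition lie on the spans of the germs *)

Section Splitting.
Variables (K : closedFieldType) (E1 E2 : seq 'rV[K]_5) (d : nat).
Variables (phi : {mpoly K[5]} -> K) (s : seq 'rV[K]_5).
Hypotheses (E1_gt1 : (1 < size E1)%N) (E2_gt1 : (1 < size E2)%N).
Hypotheses (size_E : (size E1 + size E2 = 5)%N) (freeE : free (E1 ++ E2)).
Hypotheses (germ_phi : germ_functional (two_germs E1 E2) d.+3 phi).
Hypotheses (dec_phi : decomposes d.+3 phi s) (size_s : (size s <= 3 * d.+2 + 2)%N).

Let E := two_germs E1 E2.
Let e i := (E i)`_0.

Let E_gt1 i : (1 < size (E i))%N. Proof. by case: i. Qed.
Let E_gt0 i : (0 < size (E i))%N. Proof. exact: ltnW. Qed.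
Let E_dual : dual_forms E. Proof. exact: two_germs_dual. Qed.

Let spanE : (<<E1>> + <<E2>>)%VS = fullv.
Proof.
apply/eqP; rewrite eqEdim subvf -span_cat (eqP freeE) size_cat size_E.
by rewrite dimvf /dim /= mul1n.
Qed.

Let sum_predE : ((size E1).-1 + (size E2).-1)%N = 3%N.
Proof.
by move: (size_E) E1_gt1 E2_gt1; case: (size E1) (size E2) => [|[|a]] [|[|b]] //=; lia.
Qed.

(** Multiplication by h gives a functional on the same germs, in degree one less,
   decomposed by the points off h; the lower bound for their number leaves room for
   three zeros. *)
Let few_zeros h t : h \is 1.-homog -> (forall i, evalv h (e i) != 0) ->
  uniq t -> {subset t <= s} -> (forall v, v \in t -> evalv h v = 0) ->
  (size t <= 3)%N.
Proof.
move=> hh nzh ut st h0.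
have := @two_germs_ge K 5 E1 E2 d _ _ (E_gt0 true) (E_gt0 false) freeE.
move=> /(_ _ _ (@germ_functional_mul _ _ _ _ E_gt0 1 _ _ _ germ_phi hh nzh)
              (decomposes_mul hh dec_phi)).
have : (size t <= count (zeros h) s)%N.
  rewrite -size_filter; apply: uniq_leq_size => // v vt.
  by rewrite mem_filter st // /zeros h0 ?eqxx.
have := count_predC (zeros h) s.
rewrite -[count (predC _) _]size_filter -/(predC (zeros h)).
move: (size_s) (size_E) (E_gt1 true) (E_gt1 false) => /=.
rewrite sum_predE.
rewrite [size [seq _ <- _ | _]](_ : _ = size (filter (predC (zeros h)) s)) //.
lia.
Qed.

(** Points at a pole could be removed, without leaving the functionals on the germs;
   but s has no more points than the lower bound. *)
Lemma two_germs_off_pole i v : v \in s -> v \notin <[e i]>%VS.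
Proof.
have [psi gpsi dec] := decomposes_off_pole E_gt0 E_dual (E_gt1 i) germ_phi dec_phi.
have := two_germs_ge (E_gt0 true) (E_gt0 false) freeE gpsi dec.
rewrite sum_predE size_filter => le; have : all (fun v => v \notin <[e i]>%VS) s.
  by rewrite all_count eqn_leq count_size (leq_trans size_s).
by move/allP => h /h.
Qed.

(** As x y kills phi, it vanishes on the germs, and x is invertible on the i-th one. *)
Let kills_germ x y i : x \is 1.-homog -> y \is 1.-homog ->
  (forall v, v \in s -> evalv x v * evalv y v = 0) -> evalv x (e i) != 0 ->
  forall v, v \in <<E i>>%VS -> evalv y v = 0.
Proof.
move=> hx hy xy0 nzx.
have hxy : x * y \is (1 + 1).-homog by apply: dhomogM.
have phi0 f : f \is d.+1.-homog -> phi (x * y * f) = 0.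
  case: dec_phi => c def_phi hf; rewrite def_phi; last exact: (dhomogM hxy hf).
  by rewrite big_seq big1 // => v vs; rewrite !evalvM xy0 // mul0r mulr0.
have := @germ_functional_faithful _ _ _ _ E_gt0 E_dual 2 d phi _ germ_phi hxy phi0 i.
rewrite alongM => /low_coefs_cancel; rewrite along_coef0 // => /(_ nzx) y0.
apply: evalv_span0 => // _ /(nthP 0)[j lt_j <-].
by have := y0 j lt_j; rewrite along_lin // lt_j.
Qed.

(** In coordinates for a basis X of vectors of s, the poles have disjoint supports, as a
   coordinate which is nonzero at both would vanish at four points of X. Take i in the
   support of the first pole and j in that of the second. By [few_zeros], applied to the
   hyperplane through w and three vectors of X, x_i x_j vanishes at every w in s. For the
   same reason, given m, either all the products x_m x_j vanish on s, and then x_m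
   vanishes on the second span, or all the products x_m x_i do, and then x_m vanishes on
   the first span. For v on neither span, a coordinate of each kind is nonzero at v; with
   two coordinates from each support, these would be six among five. *)
Lemma two_germs_split v : v \in s -> v \in <<E1>>%VS \/ v \in <<E2>>%VS.
Proof.
have [X [sX fX eX]] := free_subseq s.
have fullX : <<X>>%VS = fullv.
  apply/eqP; rewrite eX eqEsubv subvf /= -spanE.
  apply: decomposition_spans dec_phi => h hh h0 w ww.
  apply: (germ_functional_concise E_gt0 E_dual germ_phi hh h0).
  by rewrite big_bool.
have sizeX : size X = 5%N.
  by rewrite -(eqP fX) fullX dimvf /dim /= mul1n.
have [x xP] := dual_form fX.
have hx i : x i \is 1.-homog by case: (xP i).
have xX i j : (j < 5)%N -> evalv (x i) X`_j = (i == j)%:R.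
  by move=> lt_j; case: (xP i) => _; apply; rewrite sizeX.
have uX := free_uniq fX.
have memX i : (i < 5)%N -> X`_i \in X by move=> lt_i; rewrite mem_nth ?sizeX.
have coordX w : (forall i, (i < 5)%N -> evalv (x i) w = 0) -> w = 0.
  move=> w0; have wX : w \in <<X>>%VS by rewrite fullX memvf.
  rewrite (dual_form_expand xP wX) big1 // => i _.
  by rewrite w0 ?scale0r // -[5%N in leqRHS]sizeX.
pose a i := evalv (x i) (e true); pose b i := evalv (x i) (e false).
have notX w i j : evalv (x i) w != 0 -> evalv (x j) w != 0 -> i != j -> w \notin X.
  move=> nzi nzj ij; apply/negP => /(nthP 0)[k]; rewrite sizeX => lt_k def_w.
  move: nzi nzj; rewrite -def_w !xX //; have [<-|_] := eqVneq i k; last by rewrite eqxx.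
  by rewrite [j == i]eq_sym (negPf ij) eqxx.
(* A combination h of the coordinates with index in l vanishes at the other vectors
   of X. *)
have few h (t : seq 'rV[K]_5) (l : seq nat) : h \is 1.-homog ->
    (forall i, evalv h (e i) != 0) -> uniq t ->
    (forall w, w \in t -> [/\ w \in s, w \notin X & evalv h w = 0]) ->
    (forall k, (k < 5)%N -> k \notin l -> evalv h X`_k = 0) -> (size t + 2 <= size l)%N.
  move=> hh nzh ut tP hl.
  have : (size (t ++ [seq w <- X | evalv h w == 0%R])%SEQ <= 3)%N.
    apply: few_zeros hh nzh _ _ _ => [|w|w].
    - rewrite cat_uniq ut filter_uniq // andbT; apply/hasPn => w.
      by rewrite mem_filter => /andP[_ wX]; apply/negP => /tP[_]; rewrite wX.
    - by rewrite mem_cat mem_filter => /orP[/tP[]//|/andP[_ /sX]].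
    by rewrite mem_cat mem_filter => /orP[/tP[]//|/andP[/eqP]].
  have : (size [seq w <- X | evalv h w != 0]%R <= size [seq X`_k | k <- l]%R)%N.
    apply: uniq_leq_size => [|w]; first exact: filter_uniq.
    rewrite mem_filter => /andP[nzw /(nthP 0)[k]]; rewrite sizeX => lt_k def_w.
    apply/mapP; exists k => //; apply: contraNT nzw => kl.
    by rewrite -def_w hl ?eqxx.
  have := count_predC (fun w => evalv h w == 0) X.
  have key (z nz n l' : nat) : (z + nz = 5 -> nz <= l' -> n + z <= 3 -> n + 2 <= l')%N by lia.
  by rewrite size_cat size_map !size_filter sizeX; apply: key.
have ab i : (i < 5)%N -> a i * b i = 0.
  move=> lt_i; apply: contrapT => /eqP; rewrite mulf_eq0 negb_or => /andP[nza nzb].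
  suff : (size (Nil 'rV[K]_5) + 2 <= size [:: i])%N by [].
  apply: few (hx i) _ _ _ _ => // [[]//|k lt_k]; rewrite inE xX // eq_sym.
  by move/negPf->.
have ab0 i j : (i < 5)%N -> (j < 5)%N -> a i != 0 -> b j != 0 ->
    [/\ b i = 0, a j = 0 & i != j].
  move=> lt_i lt_j nza nzb; have /eqP := ab i lt_i; have /eqP := ab j lt_j.
  rewrite !mulf_eq0 (negPf nza) (negPf nzb) orbF => /eqP aj /eqP bi.
  by split=> //; apply: contraNneq nza => ->; rewrite aj.
have exch w i j : w \in s -> (i < 5)%N -> (j < 5)%N -> a i != 0 -> b j != 0 ->
    evalv (x i) w * evalv (x j) w = 0.
  move=> ws lt_i lt_j nza nzb; have [bi aj ij] := ab0 i j lt_i lt_j nza nzb.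
  apply: contrapT => /eqP; rewrite mulf_eq0 negb_or => /andP[nzi nzj].
  (* The hyperplane through w and the vectors of X other than X_i and X_j. *)
  pose h := evalv (x j) w *: x i - evalv (x i) w *: x j.
  have hh : h \is 1.-homog by rewrite rpredB // dhomogZ.
  have evh u : evalv h u = evalv (x j) w * evalv (x i) u - evalv (x i) w * evalv (x j) u.
    by rewrite evalvB !evalvZ.
  suff : (size [:: w] + 2 <= size [:: i; j])%N by [].
  apply: few hh _ _ _ _ => //.
  - case; rewrite evh -/(a i) -/(a j) -/(b i) -/(b j) ?aj ?bi.
      by rewrite mulr0 subr0 mulf_neq0.
    by rewrite mulr0 sub0r oppr_eq0 mulf_neq0.
  - move=> u; rewrite inE => /eqP->; split=> //; first exact: notX nzi nzj ij.
    by rewrite evh mulrC subrr.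
  move=> k lt_k; rewrite !inE negb_or => /andP[/negPf ki /negPf kj].
  by rewrite evh !xX // ![_ == k]eq_sym ki kj !mulr0 subrr.
have side m : (m < 5)%N ->
    (forall w j, w \in s -> (j < 5)%N -> b j != 0 -> evalv (x m) w * evalv (x j) w = 0) \/
    (forall w i, w \in s -> (i < 5)%N -> a i != 0 -> evalv (x m) w * evalv (x i) w = 0).
  move=> lt_m.
  have [am0|nz_am] := eqVneq (a m) 0; last by left=> w j ws lt_j; apply: exch.
  have [bm0|nz_bm] := eqVneq (b m) 0; last first.
    by right=> w i ws lt_i nza; rewrite mulrC; apply: exch.
  apply: contrapT => /not_orP[nA nB].
  have [w [j [ws lt_j nzb nz_w]]] : exists w j,
      [/\ w \in s, (j < 5)%N, b j != 0 & evalv (x m) w * evalv (x j) w != 0].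
    apply: contrapT => nex; case: nA => w j ws lt_j nzb; apply: contrapT => /eqP nz.
    by case: nex; exists w, j.
  have [u [i [us lt_i nza nz_u]]] : exists u i,
      [/\ u \in s, (i < 5)%N, a i != 0 & evalv (x m) u * evalv (x i) u != 0].
    apply: contrapT => nex; case: nB => u i us lt_i nza; apply: contrapT => /eqP nz.
    by case: nex; exists u, i.
  move: nz_w nz_u; rewrite !mulf_eq0 !negb_or => /andP[wm wj] /andP[um ui].
  have [bi aj ij] := ab0 i j lt_i lt_j nza nzb.
  have wi : evalv (x i) w = 0.
    by have /eqP := exch w i j ws lt_i lt_j nza nzb; rewrite mulf_eq0 (negPf wj) orbF => /eqP.
  have uj : evalv (x j) u = 0.
    by have /eqP := exch u i j us lt_i lt_j nza nzb; rewrite mulf_eq0 (negPf ui) => /eqP.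
  have mi : m != i by apply: contraNneq nza => <-; rewrite am0.
  have mj : m != j by apply: contraNneq nzb => <-; rewrite bm0.
  (* The hyperplane through w, u and the vectors of X other than X_i, X_j and X_m. *)
  pose h := (evalv (x m) u / evalv (x i) u) *: x i +
            (evalv (x m) w / evalv (x j) w) *: x j - x m.
  have hh : h \is 1.-homog by rewrite rpredB // rpredD // dhomogZ.
  have evh y : evalv h y = evalv (x m) u / evalv (x i) u * evalv (x i) y +
            evalv (x m) w / evalv (x j) w * evalv (x j) y - evalv (x m) y.
    by rewrite evalvB evalvD !evalvZ.
  suff : (size [:: w; u] + 2 <= size [:: i; j; m])%N by [].
  apply: few hh _ _ _ _.
  - case; rewrite evh -/(a i) -/(a j) -/(a m) -/(b i) -/(b j) -/(b m).
      by rewrite aj am0 mulr0 addr0 subr0 !mulf_neq0 ?invr_eq0.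
    by rewrite bi bm0 mulr0 add0r subr0 !mulf_neq0 ?invr_eq0.
  - by rewrite /= inE andbT; apply: contraNneq ui => <-; rewrite wi.
  - move=> y; rewrite !inE => /orP[]/eqP->; split=> //.
    + exact: notX wm wj mj.
    + by rewrite evh wi mulr0 add0r divfK // subrr.
    + exact: notX um ui mi.
    by rewrite evh uj mulr0 addr0 divfK // subrr.
  move=> k lt_k; rewrite !inE !negb_or => /and3P[/negPf ki /negPf kj /negPf km].
  by rewrite evh !xX // ![_ == k]eq_sym ki kj km !mulr0 addr0 subr0.
have two i : exists k l, [/\ (k < 5)%N, (l < 5)%N, k != l,
    evalv (x k) (e i) != 0 & evalv (x l) (e i) != 0].
  have [k [lt_k nzk]] : exists k, (k < 5)%N /\ evalv (x k) (e i) != 0.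
    apply: contrapT => nex; case/eqP: (germ_pole_neq0 E_gt0 E_dual i); apply: coordX => k lt_k.
    by apply: contrapT => /eqP nz; case: nex; exists k.
  apply: contrapT => nex; case/negP: (two_germs_off_pole i (sX _ (memX k lt_k))).
  apply/vlineP; exists (evalv (x k) (e i))^-1.
  apply/eqP; rewrite -subr_eq0; apply/eqP/coordX => l lt_l.
  rewrite evalv_linB // evalv_linZ // xX //.
  have [->|lk] := eqVneq l k; first by rewrite mulVf // subrr.
  have [->|nzl] := eqVneq (evalv (x l) (e i)) 0; first by rewrite mulr0 subrr.
  by case: nex; exists k, l; rewrite eq_sym.
move=> vs; apply: contrapT => /not_orP[/negP v1 /negP v2].
have vanish m : (m < 5)%N ->
    ((forall w, w \in <<E2>>%VS -> evalv (x m) w = 0) /\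
     (evalv (x m) v != 0 -> forall j, (j < 5)%N -> b j != 0 -> evalv (x j) v = 0)) \/
    ((forall w, w \in <<E1>>%VS -> evalv (x m) w = 0) /\
     (evalv (x m) v != 0 -> forall i, (i < 5)%N -> a i != 0 -> evalv (x i) v = 0)).
  move=> lt_m; have [A|B] := side m lt_m; [left|right]; split.
  - have [j [_ [lt_j _ _ nzb _]]] := two false.
    apply: (@kills_germ _ _ false (hx j) (hx m) _ nzb) => w ws.
    by rewrite mulrC; apply: A.
  - move=> nz j lt_j nzb; have /eqP := A v j vs lt_j nzb.
    by rewrite mulf_eq0 (negPf nz) => /eqP.
  - have [j [_ [lt_j _ _ nza _]]] := two true.
    apply: (@kills_germ _ _ true (hx j) (hx m) _ nza) => w ws.
    by rewrite mulrC; apply: B.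
  move=> nz i lt_i nza; have /eqP := B v i vs lt_i nza.
  by rewrite mulf_eq0 (negPf nz) => /eqP.
have not_both m : (forall w, w \in <<E1>>%VS -> evalv (x m) w = 0) ->
   (forall w, w \in <<E2>>%VS -> evalv (x m) w = 0) -> evalv (x m) v = 0.
  move=> A B; have : v \in (<<E1>> + <<E2>>)%VS by rewrite spanE memvf.
  by case/memv_addP=> w1 /A w10 [w2 /B w20 ->]; rewrite evalv_linD // w10 w20 addr0.
have : v \in (<<E1>> + <<E2>>)%VS by rewrite spanE memvf.
case/memv_addP=> w1 w1E [w2 w2E def_v].
have [m [lt_m m1 nz_m m1a]] : exists m, [/\ (m < 5)%N,
    forall w, w \in <<E1>>%VS -> evalv (x m) w = 0, evalv (x m) v != 0
    & forall i, (i < 5)%N -> a i != 0 -> evalv (x i) v = 0].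
  apply: contrapT => nex; case/negP: v1; rewrite def_v (_ : w2 = 0) ?addr0 //.
  apply: coordX => m lt_m; have [[/(_ _ w2E)//]|[xm1 xmv]] := vanish m lt_m.
  have [xv0|nz] := eqVneq (evalv (x m) v) 0; last first.
    by case: nex; exists m; split=> //; apply: xmv.
  by move: xv0; rewrite def_v evalv_linD // xm1 // add0r.
have [m' [lt_m' m2 nz_m' m2b]] : exists m, [/\ (m < 5)%N,
    forall w, w \in <<E2>>%VS -> evalv (x m) w = 0, evalv (x m) v != 0
    & forall j, (j < 5)%N -> b j != 0 -> evalv (x j) v = 0].
  apply: contrapT => nex; case/negP: v2; rewrite def_v (_ : w1 = 0) ?add0r //.
  apply: coordX => m' lt_m'; have [[xm1 xmv]|[/(_ _ w1E)//]] := vanish m' lt_m'.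
  have [xv0|nz] := eqVneq (evalv (x m') v) 0; last first.
    by case: nex; exists m'; split=> //; apply: xmv.
  by move: xv0; rewrite def_v evalv_linD // [evalv _ w2]xm1 // addr0.
have mm' : m != m' by apply: contraNneq nz_m => mm; rewrite not_both // mm.
have [i1 [i2 [lt_i1 lt_i2 ne_i nz_i1 nz_i2]]] := two true.
have [j1 [j2 [lt_j1 lt_j2 ne_j nz_j1 nz_j2]]] := two false.
have ab_ne i j : (i < 5)%N -> a i != 0 -> b j != 0 -> i != j.
  move=> lt_i nza nzb; apply: contraNneq nzb => <-.
  by move/eqP: (ab i lt_i); rewrite mulf_eq0 (negPf nza).
have m_ne k i : evalv (x k) v != 0 -> evalv (x i) v = 0 -> k != i.
  by move=> nz v0; apply: contraNneq nz => ->; rewrite v0.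
have : (size [:: m; m'; i1; i2; j1; j2] <= size (iota 0 5))%N.
  apply: uniq_leq_size => [|k].
    rewrite /= !inE !negb_or mm' ne_i ne_j /=.
    rewrite !(ab_ne i1) // !(ab_ne i2) //.
    have vi1 := m1a _ lt_i1 nz_i1; have vi2 := m1a _ lt_i2 nz_i2.
    have vj1 := m2b _ lt_j1 nz_j1; have vj2 := m2b _ lt_j2 nz_j2.
    by rewrite !(m_ne m) // !(m_ne m').
  by rewrite mem_iota !inE => /or4P[/eqP->//|/eqP->//|/eqP->//|/or3P[]/eqP->].
by [].
Qed.
End Splitting.

(** * Separating the two spans by projections *)

Section Pullback.
Variables (K : fieldType) (n : nat).
Implicit Types (f g : {mpoly K[n]}) (v w : 'rV[K]_n) (M : 'M[K]_n).

Definition pullback M f : {mpoly K[n]} :=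
  f \mPo [tuple \sum_j M j i *: 'X_j | i < n].

Lemma evalv_pullback M f v : evalv (pullback M f) v = evalv f (v *m M).
Proof.
rewrite /evalv /pullback comp_mpoly_meval; apply: meval_eq => i.
rewrite tnth_mktuple -/(evalv _ v) evalv_sum mxE; apply: eq_bigr => j _.
by rewrite evalvZ /evalv mevalXU mulrC.
Qed.

Lemma pullback_homog k M f : f \is k.-homog -> pullback M f \is k.-homog.
Proof.
move: k f; apply: dhomog_ind => [k|k f g _ _ hf hg|a|k i f _ hf].
- by rewrite /pullback comp_mpoly0 dhomog0.
- by rewrite /pullback comp_mpolyD rpredD.
- by rewrite /pullback comp_mpolyC -alg_mpolyC dhomogZ // dhomog1.
rewrite /pullback rmorphM /= -add1n dhomogM // comp_mpolyXU -tnth_nth tnth_mktuple.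
by apply: rpred_sum => j _; rewrite dhomogZ // dhomogXU.
Qed.

End Pullback.

Lemma poly_ext (K : closedFieldType) (p q : {poly K}) :
  (forall z, p.[z] = q.[z]) -> p = q.
Proof.
move=> pq; apply/eqP; rewrite -subr_eq0; apply: contraT => nz.
have [rs def_pq] := closed_field_poly_normal (p - q).
have [z /negP[]] := exists_notin rs.
rewrite -root_prod_XsubC -(rootZ _ (a := lead_coef (p - q))) ?lead_coef_eq0 //.
by rewrite -def_pq /root hornerD hornerN pq subrr.
Qed.

Section Projection.
Variables (K : closedFieldType) (n : nat).
Implicit Types (f g : {mpoly K[n]}) (v w : 'rV[K]_n).

Lemma projection_matrix (U W : {vspace 'rV[K]_n}) : (U :&: W)%VS = 0%VS ->
  exists M : 'M[K]_n, (forall u, u \in U -> u *m M = u) /\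
    (forall w, w \in W -> w *m M = 0).
Proof.
move=> UW; exists (lin1_mx (daddv_pi U W)); split=> [u uU|w wW].
  by rewrite mul_rV_lin1 /= daddv_pi_id.
have WU : (W :&: U)%VS = 0%VS by rewrite capvC.
have := daddv_pi_add UW (subvP (addvSr U W) w wW).
rewrite mul_rV_lin1 /= [daddv_pi W U w]daddv_pi_id // => /eqP.
by rewrite -subr_eq0 addrK => /eqP.
Qed.

Lemma curve_mul E z (M : 'M[K]_n) :
  curve E z *m M = \sum_(j < size E) z ^+ j *: (E`_j *m M).
Proof. by rewrite mulmx_suml; apply: eq_bigr => j _; rewrite -scalemxAl. Qed.

(** Composition with the projection onto the first span keeps the values of a form
   there, and makes it vanish on the second span. *)
Lemma decomposition_component E1 E2 d (p1 p2 : {poly K}) s1 s2 (c : 'rV[K]_n -> K) :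
  (<<E1>> :&: <<E2>>)%VS = 0%VS ->
  (forall v, v \in s1 -> v \in <<E1>>%VS) ->
  (forall v, v \in s2 -> v \in <<E2>>%VS) ->
  (forall f, f \is d.+1.-homog ->
     (p1 * along E1 f)`_(size E1).-1 + (p2 * along E2 f)`_(size E2).-1 =
     \sum_(v <- s1) c v * evalv f v + \sum_(v <- s2) c v * evalv f v) ->
  forall f, f \is d.+1.-homog ->
    (p1 * along E1 f)`_(size E1).-1 = \sum_(v <- s1) c v * evalv f v.
Proof.
move=> E12 s1E s2E eq_dec f hf; have [M [M1 M2]] := projection_matrix E12.
have f0 : evalv f 0 = 0.
  by rewrite -(scale0r (0 : 'rV[K]_n)) (evalv_scale _ _ hf) exprS !mul0r.
have := eq_dec _ (pullback_homog M hf).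
have -> : along E1 (pullback M f) = along E1 f.
  apply: poly_ext => z; rewrite !horner_along evalv_pullback curve_mul.
  by congr evalv; apply: eq_bigr => j _; rewrite M1 // memv_span // mem_nth.
have -> : along E2 (pullback M f) = 0.
  apply: poly_ext => z; rewrite horner_along evalv_pullback curve_mul horner0.
  by rewrite big1 ?f0 // => j _; rewrite M2 ?scaler0 // memv_span // mem_nth.
rewrite mulr0 coef0 addr0 => ->.
rewrite [X in _ + X]big_seq [X in _ + X]big1 => [|v vs]; last first.
  by rewrite evalv_pullback M2 ?s2E // f0 mulr0.
rewrite addr0 big_seq [RHS]big_seq; apply: eq_bigr => v vs.
by rewrite evalv_pullback M1 ?s1E.
Qed.

End Projection.

(** * Graded ideals and their codimensions *)

Section PreimageDim.
Variables (K : fieldType) (V W : vectType K) (f : 'Hom(V, W)) (B : {vspace W}).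

Lemma dim_preimage :
  (\dim {: V} + \dim B = \dim (f @^-1: B) + \dim (limg f + B))%N.
Proof.
have kerA : (lker f <= f @^-1: B)%VS.
  by apply/subvP => v; rewrite memv_ker -memv_preim => /eqP ->; apply: mem0v.
have imA : (f @: (f @^-1: B))%VS = (limg f :&: B)%VS.
  apply/eqP; rewrite eqEsubv subv_cap limgS ?subvf //=; apply/andP; split.
    by apply/subvP => _ /memv_imgP[v vA ->]; rewrite memv_preim.
  apply/subvP => w; rewrite memv_cap => /andP[/memv_imgP[v _ ->] vB].
  by rewrite memv_img // -memv_preim.
have := limg_ker_dim f (f @^-1: B); rewrite imA (capv_idPr kerA).
have := limg_ker_dim f fullv; rewrite capfv.
have := dimv_add_leqif (limg f) B.
have := dimv_sum_cap (limg f) B; lia.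
Qed.

End PreimageDim.

Section GradedIdeals.
Variables (K : fieldType) (n : nat).
Implicit Types (f g p q : {mpoly K[n.+1]}) (J : nat -> {mpoly K[n.+1]} -> Prop).

Lemma dhomogS_split k f : f \is k.+1.-homog ->
  exists2 g : 'I_n.+1 -> {mpoly K[n.+1]}, forall i, g i \is k.-homog &
    f = \sum_i 'X_i * g i.
Proof.
suff H l (h : {mpoly K[n.+1]}) : h \is l.-homog -> forall k, l = k.+1 ->
    exists2 g : 'I_n.+1 -> {mpoly K[n.+1]}, forall i, g i \is k.-homog &
      h = \sum_i 'X_i * g i.
  by move=> hf; apply: H hf _ _.
move: l h; apply: dhomog_ind => [l k' _|l f1 f2 _ _ IH1 IH2 k' lk|//|l i h hh _ k' [<-]].
- exists (fun=> 0) => [i|]; first exact: dhomog0.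
  by rewrite big1 // => i _; rewrite mulr0.
- have [g1 hg1 ->] := IH1 _ lk; have [g2 hg2 ->] := IH2 _ lk.
  exists (fun i => g1 i + g2 i) => [i|]; first by rewrite rpredD.
  by rewrite -big_split; apply: eq_bigr => i _; rewrite mulrDr.
exists (fun j => if j == i then h else 0) => [j|].
  by case: ifP => // _; apply: dhomog0.
rewrite (bigD1 i) //= eqxx big1 ?addr0 // => j /negPf ->; exact: mulr0.
Qed.

Lemma linear_form_sum f : f \is 1.-homog ->
  f = \sum_i evalv f (delta_mx 0 i) *: 'X_i.
Proof.
move=> hf; apply: linear_form_ext => // [|v].
  by apply: rpred_sum => i _; rewrite dhomogZ // dhomogXU.
rewrite evalv_sum {1}(row_sum_delta v) evalv_lin_sum //; apply: eq_bigr => i _.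
by rewrite evalvZ /evalv mevalXU -/(evalv _ _) evalv_linZ // mulrC.
Qed.

(** Only the forms f of degree t are meant in J t f. *)
Definition graded_ideal J :=
  [/\ forall t, J t 0, forall t a f g, J t f -> J t g -> J t (a *: f + g)
    & forall t i f, J t f -> J t.+1 ('X_i * f)].

Definition component J t : {vspace dhomog n.+1 K t} :=
  vspace_of (fun f : dhomog n.+1 K t => J t (val f)).

Definition codim J t : nat :=
  (\dim {: dhomog n.+1 K t} - \dim (component J t))%N.

Section OneIdeal.
Variable J : nat -> {mpoly K[n.+1]} -> Prop.
Hypothesis idJ : graded_ideal J.

Lemma gideal0 t : J t 0. Proof. by case: idJ. Qed.

Lemma gidealD t f g : J t f -> J t g -> J t (f + g).
Proof. by case: idJ => _ JL _ Jf Jg; rewrite -[f]scale1r; apply: JL. Qed.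

Lemma gidealZ t a f : J t f -> J t (a *: f).
Proof. by case: idJ => J0 JL _ Jf; rewrite -[a *: f]addr0; apply: JL. Qed.

Lemma gidealB t f g : J t f -> J t g -> J t (f - g).
Proof. by move=> Jf Jg; rewrite -scaleN1r; apply: gidealD => //; apply: gidealZ. Qed.

Lemma gideal_sum t (I : Type) (r : seq I) (P : pred I) (F : I -> {mpoly K[n.+1]}) :
  (forall i, P i -> J t (F i)) -> J t (\sum_(i <- r | P i) F i).
Proof. by move=> JF; apply: (big_ind (J t)) => //; [apply: gideal0|apply: gidealD]. Qed.

Lemma gidealM k t g f : g \is k.-homog -> J t f -> J (k + t)%N (g * f).
Proof.
move=> hg; move: k g hg t f; apply: (@dhomog_ind _ _ (fun k g => forall t f, J t f -> J (k + t)%N (g * f))).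
- by move=> k t f _; rewrite mul0r; apply: gideal0.
- by move=> k f g _ _ IHf IHg t h Jh; rewrite mulrDl; apply: gidealD; [apply: IHf|apply: IHg].
- by move=> a t f Jf; rewrite mul_mpolyC; apply: gidealZ.
by move=> k i g _ IH t f Jf; rewrite -mulrA addSn; case: idJ => _ _; apply; apply: IH.
Qed.

Lemma mem_component t (f : dhomog n.+1 K t) : f \in component J t <-> J t (val f).
Proof.
apply: (mem_vspace_of (P := fun f : dhomog n.+1 K t => J t (val f))).
  exact: gideal0.
by move=> a g h Jg Jh; rewrite linearP /=; apply: gidealD => //; apply: gidealZ.
Qed.

Lemma mem_componentP t f (hf : f \is t.-homog) : DHomog hf \in component J t <-> J t f.
Proof. exact: mem_component. Qed.

Lemma gideal_fullS t : (forall f, f \is t.-homog -> J t f) ->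
  forall f, f \is t.+1.-homog -> J t.+1 f.
Proof.
move=> Jt f /dhomogS_split[g hg ->]; apply: gideal_sum => i _.
by case: idJ => _ _; apply; apply: Jt.
Qed.

Lemma gideal_full_le t u : (t <= u)%N -> (forall f, f \is t.-homog -> J t f) ->
  forall f, f \is u.-homog -> J u f.
Proof.
move=> le Jt; rewrite -(subnK le); elim: (u - t)%N => // k IH.
by rewrite addSn; apply: gideal_fullS.
Qed.

(** Evaluation at v spans the quotient in every degree as soon as J contains the
   linear forms which vanish at v. *)
Lemma reduce_to_power p v : p \is 1.-homog -> evalv p v = 1 ->
  (forall q, q \is 1.-homog -> evalv q v = 0 -> J 1%N q) ->
  forall t f, f \is t.-homog -> J t (f - evalv f v *: p ^+ t).
Proof.
move=> hp pv Jv; apply: dhomog_ind => [t|t f g _ _ Jf Jg|a|t i f hf Jf].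
- by rewrite evalv0 scale0r subrr; apply: gideal0.
- by rewrite evalvD scalerDl opprD addrACA; apply: gidealD.
- by rewrite evalvC expr0 alg_mpolyC subrr; apply: gideal0.
set z := evalv 'X_i v; have -> : 'X_i * f - evalv ('X_i * f) v *: p ^+ t.+1 =
    f * ('X_i - z *: p) + (z *: p) * (f - evalv f v *: p ^+ t).
  rewrite evalvM !mulrBr -!scalerAl -!scalerAr scalerA exprS.
  by rewrite [f * 'X_i]mulrC [f * p]mulrC addrA subrK.
apply: gidealD; last by rewrite -scalerAl; apply/gidealZ/(gidealM hp).
rewrite -addn1; apply/gidealM/Jv => //; first by rewrite rpredB ?dhomogZ ?dhomogXU.
by rewrite evalvB evalvZ pv mulr1 subrr.
Qed.

Lemma codim_dependent t k (g : 'I_k -> {mpoly K[n.+1]}) :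
  (forall i, g i \is t.-homog) -> (codim J t < k)%N ->
  exists2 a : 'rV[K]_k, a != 0 & J t (\sum_i a 0 i *: g i).
Proof.
move=> hg lt_k; pose comb (a : 'rV[K]_k) : dhomog n.+1 K t := \sum_i a 0 i *: DHomog (hg i).
have lin_comb : linear comb.
  move=> b u v; rewrite /comb scaler_sumr -big_split; apply: eq_bigr => i _.
  by rewrite !mxE scalerDl scalerA.
pose combL := GRing.isLinear.Build _ _ _ _ comb lin_comb.
pose F := linfun (HB.pack_for {linear 'rV[K]_k -> dhomog n.+1 K t} comb combL).
have [a aF nza] : exists2 a, a \in (F @^-1: component J t)%VS & a != 0.
  suff : (F @^-1: component J t)%VS != 0%VS.
    by move=> nz; exists (vpick (F @^-1: component J t)); [apply: memv_pick | rewrite vpick0].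
  have := dim_preimage F (component J t); rewrite -dimv_eq0.
  have := dimvS (subvf (limg F + component J t)).
  have -> : \dim {: 'rV[K]_k} = k by rewrite dimvf /dim /= mul1n.
  have := dimvS (subvf (component J t)); move: lt_k; rewrite /codim /reverse_coercion; lia.
exists a => //; move: aF; rewrite -memv_preim lfunE /= => /mem_component.
by rewrite /comb raddf_sum /=; congr (J t _); apply: eq_bigr => i _.
Qed.

Lemma mul_lin_subproof p t (f : dhomog n.+1 K t) : p \is 1.-homog ->
  p * val f \is t.+1.-homog.
Proof. by move=> hp; apply: (@dhomogM _ _ _ 1 _ t) => //; case: f. Qed.

Definition mul_lin p (hp : p \is 1.-homog) t (f : dhomog n.+1 K t) :
  dhomog n.+1 K t.+1 := DHomog (mul_lin_subproof f hp).

Lemma mul_lin_linear p (hp : p \is 1.-homog) t : linear (@mul_lin p hp t).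
Proof.
by move=> a f g; apply: val_inj; rewrite /= mulrDr scalerAr.
Qed.

HB.instance Definition _ p hp t := GRing.isLinear.Build K _ _ _ (@mul_lin p hp t)
  (@mul_lin_linear p hp t).

Definition inj_at p t := forall f, f \is t.-homog -> J t.+1 (p * f) -> J t f.
Definition surj_at p t := forall f, f \is t.+1.-homog ->
  exists2 g, g \is t.-homog & J t.+1 (f - p * g).

(** Multiplication by p is a linear map between the quotients by J in degrees t and
   t + 1, whose dimensions are compared. *)
Lemma codim_mul p t : p \is 1.-homog ->
  [/\ inj_at p t -> (codim J t <= codim J t.+1)%N,
      surj_at p t -> (codim J t.+1 <= codim J t)%N,
      codim J t = codim J t.+1 -> inj_at p t -> surj_at p t
    & codim J t = codim J t.+1 -> surj_at p t -> inj_at p t].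
Proof.
move=> hp; pose F := linfun (@mul_lin p hp t).
pose A := component J t; pose B := component J t.+1.
have FE (h : dhomog n.+1 K t) : F h = mul_lin hp h by rewrite lfunE.
have le_pre : (A <= F @^-1: B)%VS.
  apply/subvP => f /mem_component Jf; rewrite -memv_preim FE; apply/mem_component.
  exact: (gidealM hp Jf).
have injP : inj_at p t <-> (F @^-1: B <= A)%VS.
  split=> [inj|/subvP sub f hf Jpf].
    apply/subvP => f; rewrite -memv_preim FE => /mem_component Jf.
    by apply/mem_component; apply: inj Jf; case: (f).
  apply/(mem_componentP hf)/sub; rewrite -memv_preim FE.
  exact/mem_component.
have surjP : surj_at p t <-> (limg F + B)%VS = fullv.
  split=> [surj|full f hf].
    apply/eqP; rewrite eqEsubv subvf /=; apply/subvP => f _.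
    have [|g hg Jfg] := surj (val f); first by case: (f).
    rewrite -[f](subrK (F (DHomog hg))) addrC memv_add ?memv_img ?memvf //.
    by apply/mem_component; rewrite FE.
  have : DHomog hf \in (limg F + B)%VS by rewrite full memvf.
  case/memv_addP=> _ /memv_imgP[g _ ->] [h /mem_component Jh def_f].
  exists (val g); first by case: (g).
  by move/(congr1 val): def_f; rewrite FE /= => ->; rewrite addrC addrA addNr add0r.
have key (D D' a b u l : nat) : (a <= D -> b <= D' -> a <= u -> l <= D' ->
    D + b = u + l -> [/\ u <= a -> D - a <= D' - b, l = D' -> D' - b <= D - a,
      D - a = D' - b -> u <= a -> l = D' & D - a = D' - b -> l = D' -> u = a])%N.
  by move=> *; split; lia.
have [k1 k2 k3 k4] := key _ _ _ _ _ _ (dimvS (subvf A)) (dimvS (subvf B))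
  (dimvS le_pre) (dimvS (subvf (limg F + B))) (dim_preimage F B).
split.
- by move=> /injP/dimvS; apply: k1.
- by move=> /surjP dF; apply: k2; rewrite dF.
- by move=> eqc /injP/dimvS le; apply/surjP/eqP; rewrite eqEdim subvf /= (k3 eqc le).
move=> eqc /surjP dF; apply/injP.
have /eqP<- // : A == (F @^-1: B)%VS.
by rewrite eqEdim le_pre (k4 eqc) ?dF /=.
Qed.

End OneIdeal.
End GradedIdeals.

(** * A graded Nullstellensatz *)

Section BinaryForms.
Variables (K : closedFieldType) (n : nat).
Implicit Types (p q : {mpoly K[n]}) (A B : {poly K}).

(** The binary form of degree k in (p, q) with dehomogenization A. *)
Definition binary_form k A p q : {mpoly K[n]} :=
  \sum_(j < k.+1) A`_j *: (q ^+ (k - j) * p ^+ j).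

Lemma binary_formS k B z p q : (size B <= k.+1)%N ->
  binary_form k.+1 (B * ('X - z%:P)) p q = (p - z *: q) * binary_form k B p q.
Proof.
move=> sB; rewrite mulrBl; have -> : p * binary_form k B p q =
    \sum_(j < k.+2) (B * 'X)`_j *: (q ^+ (k.+1 - j) * p ^+ j).
  rewrite big_ord_recl coefMX eqxx scale0r add0r mulr_sumr.
  apply: eq_bigr => j _; rewrite coefMX /= -scalerAr subSS exprS.
  by rewrite mulrCA mulrA.
have -> : z *: q * binary_form k B p q =
    \sum_(j < k.+2) (z *: B)`_j *: (q ^+ (k.+1 - j) * p ^+ j).
  rewrite big_ord_recr /= coefZ nth_default // mulr0 scale0r addr0 mulr_sumr.
  apply: eq_bigr => j _; rewrite coefZ subSn ?leq_ord // exprS -scalerA.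
  by rewrite -!scalerAl -scalerAr -mulrA.
rewrite -sumrB; apply: eq_bigr => j _; rewrite -scalerBl -coefB.
by rewrite mulrBr [B * z%:P]mulrC mul_polyC.
Qed.

Lemma binary_form_factor k A p q : A != 0 -> (size A <= k.+1)%N ->
  exists a, exists2 zs : seq K, (size zs <= k)%N & a != 0 /\
    binary_form k A p q =
      a *: (q ^+ (k - size zs) * \prod_(z <- zs) (p - z *: q)).
Proof.
move=> nzA sA; have [zs def_A] := closed_field_poly_normal A.
have szA : size A = (size zs).+1.
  by rewrite def_A size_scale ?lead_coef_eq0 // size_prod_XsubC.
exists (lead_coef A), zs; first by rewrite -ltnS -szA.
split; first by rewrite lead_coef_eq0.
move: sA; rewrite szA ltnS => le_zs.
have -> : binary_form k A p q = lead_coef A *: binary_form k (\prod_(z <- zs) ('X - z%:P)) p q.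
  rewrite /binary_form scaler_sumr; apply: eq_bigr => j _.
  by rewrite {1}def_A coefZ scalerA.
congr (_ *: _); elim: zs k le_zs {def_A szA} => [|z zs IH] k le_zs.
  rewrite !big_nil subn0 mulr1 /binary_form big_ord_recl coef1 /= scale1r subn0.
  rewrite expr0 mulr1 big1 ?addr0 // => j _.
  by rewrite coef1 /= scale0r.
case: k le_zs => // k le_zs; rewrite !big_cons mulrC binary_formS.
  by rewrite IH // subSS mulrCA.
by rewrite size_prod_XsubC ltnS.
Qed.

End BinaryForms.

(** The products q^(k-j) p^j m are k + 1 forms, more than the codimension. *)
Lemma binary_form_dependent (K : closedFieldType) n J t k (p q m : {mpoly K[n.+1]}) :
  graded_ideal J -> p \is 1.-homog -> q \is 1.-homog -> m \is t.-homog ->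
  (codim J (k + t) <= k)%N ->
  exists A : {poly K}, [/\ A != 0, (size A <= k.+1)%N & J (k + t)%N (binary_form k A p q * m)].
Proof.
move=> idJ hp hq hm le_k; pose g (j : 'I_k.+1) := q ^+ (k - j) * p ^+ j * m.
have hg j : g j \is (k + t).-homog.
  apply: dhomogM => //.
  by have := dhomogM (dhomog_lin_exp (k - j) hq) (dhomog_lin_exp j hp); rewrite subnK ?leq_ord.
have [a /rV0Pn[j nzj] Ja] := codim_dependent idJ hg le_k.
pose A := \poly_(j < k.+1) a 0 (inord j); exists A; split; last 2 first.
- exact: size_poly.
- congr (J _ _): Ja; rewrite /binary_form mulr_suml; apply: eq_bigr => i _.
  by rewrite coef_poly ltn_ord inord_val -scalerAl.
apply: contraNneq nzj => A0; have := congr1 (fun P : {poly K} => P`_j) A0.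
by rewrite coef_poly ltn_ord coef0 inord_val => ->.
Qed.

Lemma nonincreasing_stationary (h : nat -> nat) T :
  (forall t, (T <= t)%N -> (h t.+1 <= h t)%N) ->
  exists2 T', (T <= T')%N & forall t, (T' <= t)%N -> h t = h T'.
Proof.
have [k le_k] := ubnP (h T); elim: k T le_k => // k IH T le_k hT.
have [[t [le_t lt_h]]|nex] := pselect (exists t, (T <= t)%N /\ (h t < h T)%N).
  have [|t' le_t'|T' le_T' T'P] := IH t; first exact: leq_trans lt_h _.
    by apply: hT; apply: leq_trans le_t'.
  by exists T' => //; apply: leq_trans le_T'.
exists T => // t le_t; apply/eqP; rewrite eqn_leq; apply/andP; split; last first.
  by rewrite leqNgt; apply/negP => lt_h; apply: nex; exists t.
rewrite -(subnK le_t); elim: (t - T)%N => // j IHj.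
by rewrite addSn (leq_trans (hT _ _)) // leq_addl.
Qed.

Section Nullstellensatz.
Variables (K : closedFieldType) (n : nat).
Implicit Types (f g p q : {mpoly K[n.+1]}) (J : nat -> {mpoly K[n.+1]} -> Prop).

(** Functionals on the space of linear forms are evaluations at vectors. *)
Lemma dual_vector (L : {vspace dhomog n.+1 K 1}) p (hp : p \is 1.-homog) :
  DHomog hp \notin L ->
  exists2 v, forall l, l \in L -> evalv (val l) v = 0 & evalv p v = 1.
Proof.
move=> pL; pose X := [tuple of DHomog hp :: vbasis L].
have freeX : free X.
  by rewrite free_cons (basis_free (vbasisP L)) (span_basis (vbasisP L)) pL.
pose v := \row_i coord X 0 (DHomog (dhomogXU K i)).
have vE (l : dhomog n.+1 K 1) : evalv (val l) v = coord X 0 l.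
  have hl : val l \is 1.-homog by case: l.
  have -> : l = \sum_i evalv (val l) (delta_mx 0 i) *: DHomog (dhomogXU K i).
    by apply: val_inj; rewrite raddf_sum /= {1}(linear_form_sum hl).
  rewrite linear_sum raddf_sum /= evalv_sum; apply: eq_bigr => i _.
  by rewrite linearZ /= evalvZ {2}/evalv mevalXU mxE.
exists v => [l lL|].
  rewrite vE (coord_vbasis lL) linear_sum big1 // => i _ /=.
  rewrite linearZ /= -[(vbasis L)`_i]/(X`_(lift 0 i)) coord_free //.
  by rewrite eq_sym (negPf (neq_lift _ _)) mulr0.
by have := vE (DHomog hp); rewrite /= => ->; exact: (coord_free 0 0 freeX).
Qed.

Lemma gideal_dual_vector J p : graded_ideal J -> p \is 1.-homog -> ~ J 1%N p ->
  exists2 v, forall l, l \is 1.-homog -> J 1%N l -> evalv l v = 0 & evalv p v = 1.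
Proof.
move=> idJ hp nJp; have [|v v0 v1] := @dual_vector (component J 1) p hp.
  by apply/negP => /(mem_component idJ).
by exists v => // l hl Jl; apply: (v0 (DHomog hl)); apply/(mem_component idJ).
Qed.

(** The graded ideal generated by J and the linear form p. *)
Definition add_linear J p t f :=
  exists2 g, (if t is t'.+1 then g \is t'.-homog else g == 0) & J t (f - p * g).

Lemma add_linear_ideal J p : graded_ideal J -> graded_ideal (add_linear J p).
Proof.
move=> [J0 JL JX]; split=> [t|t a f g|t i f].
- by exists 0; [case: t => // t; apply: dhomog0 | rewrite mulr0 subrr].
- move=> [f' hf Jf] [g' hg Jg]; exists (a *: f' + g').
    case: t hf hg {Jf Jg} => [/eqP-> /eqP->|t hf hg]; first by rewrite scaler0 addr0.
    by rewrite rpredD // dhomogZ.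
  have -> : a *: f + g - p * (a *: f' + g') = a *: (f - p * f') + (g - p * g').
    by rewrite mulrDr scalerBr -scalerAr opprD addrACA.
  exact: JL.
move=> [g hg Jg]; exists ('X_i * g).
  case: t hg {Jg} => [/eqP->|t hg]; first by rewrite mulr0 dhomog0.
  by apply: (@dhomogM _ _ _ 1 _ t) => //; apply: dhomogXU.
by rewrite mulrCA -mulrBr; apply: JX.
Qed.

Lemma add_linear_sub J p t f : J t f -> add_linear J p t f.
Proof.
by move=> Jf; exists 0; [case: t Jf => // t _; apply: dhomog0 | rewrite mulr0 subr0].
Qed.

Lemma surj_add_linear J p t : surj_at J p t <->
  forall f, f \is t.+1.-homog -> add_linear J p t.+1 f.
Proof. by []. Qed.

Lemma gideal_prod J p q (zs : seq K) t f :
  p \is 1.-homog -> q \is 1.-homog -> f \is t.-homog ->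
  (forall z u, z \in zs -> (t <= u)%N -> inj_at J (p - z *: q) u) ->
  J (size zs + t)%N (\prod_(z <- zs) (p - z *: q) * f) -> J t f.
Proof.
move=> hp hq hf; elim: zs => [|z zs IH] inj; first by rewrite big_nil mul1r.
rewrite big_cons -mulrA /= addSn => /(inj z _ (mem_head _ _) (leq_addl _ _)) Jf.
apply: IH => [y u yzs|]; first by apply: inj; rewrite inE yzs orbT.
by apply: Jf; apply: dhomogM => //; apply: dhomog_prod_pencil.
Qed.

Lemma inj_at_exp J q t k f : q \is 1.-homog -> f \is t.-homog ->
  (forall u, (t <= u)%N -> inj_at J q u) -> J (k + t)%N (q ^+ k * f) -> J t f.
Proof.
move=> hq hf inj; elim: k => [|k IH]; first by rewrite expr0 mul1r.
rewrite exprS -mulrA addSn => /(inj _ (leq_addl _ _)) Jf.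
apply: IH; apply: Jf; apply: dhomogM => //.
by rewrite -[k in k.-homog]mul1n dhomogMn.
Qed.

(** Otherwise, every linear form outside J acts surjectively in large degree on the
   quotient by J, and then injectively, since the codimensions are eventually constant.
   But a binary form in p and q, which is a product of members of the pencil, maps some
   form outside J into J, because the codimension is finite. *)
Lemma pencil_singular J p q : graded_ideal J ->
  (forall t, ~ forall f, f \is t.-homog -> J t f) ->
  p \is 1.-homog -> q \is 1.-homog -> ~ J 1%N q ->
  (forall z, ~ J 1%N (p - z *: q)) ->
  exists l, [/\ l \is 1.-homog, ~ J 1%N l &
    forall t, ~ forall f, f \is t.-homog -> add_linear J l t f].
Proof.
move=> idJ properJ hp hq nJq nJpq; apply: contrapT => nex.
have surj l : l \is 1.-homog -> ~ J 1%N l ->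
    exists T, forall t, (T <= t)%N -> surj_at J l t.
  move=> hl nJl; have [T full] : exists t, forall f, f \is t.-homog -> add_linear J l t f.
    apply: contrapT => nex'; case: nex; exists l; split=> // t full.
    by case: nex'; exists t.
  exists T => t le_t; apply/surj_add_linear.
  apply: (gideal_full_le (add_linear_ideal _ idJ)) full; exact: leqW.
have [Tq surjq] := surj q hq nJq.
have [t t1|T le_T stat] := @nonincreasing_stationary (codim J) Tq.
  by have [_ + _ _] := codim_mul idJ t hq; apply; apply: surjq.
have cst t : (T <= t)%N -> codim J t = codim J t.+1.
  by move=> le; rewrite !stat // leqW.
have inj l : l \is 1.-homog -> ~ J 1%N l -> exists2 T', (T <= T')%N &
    forall t, (T' <= t)%N -> inj_at J l t.
  move=> hl nJl; have [T1 surjl] := surj l hl nJl.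
  exists (maxn T T1) => [|t]; first exact: leq_maxl.
  rewrite geq_max => /andP[le1 le2].
  by have [_ _ _] := codim_mul idJ t hl; apply; [apply: cst|apply: surjl].
have injq t : (T <= t)%N -> inj_at J q t.
  move=> le; have [_ _ _] := codim_mul idJ t hq; apply; first exact: cst.
  by apply: surjq; apply: leq_trans le.
have hpq z : p - z *: q \is 1.-homog by rewrite rpredB // dhomogZ.
have injpq z t : (T <= t)%N -> inj_at J (p - z *: q) t.
  move=> le f hf Jf; have [T' _ injT'] := inj _ (hpq z) (nJpq z).
  apply: (@inj_at_exp J q t T') => // [u le_u|].
    by apply: injq; apply: leq_trans le_u.
  apply: (injT' _ (leq_addr _ _)).
    by apply: dhomogM => //; apply: dhomog_lin_exp.
  rewrite mulrCA -addnS; apply: (gidealM idJ) => //.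
  exact: dhomog_lin_exp.
have [m hm nJm] : exists2 m, m \is T.-homog & ~ J T m.
  apply: contrapT => nex'; case: (properJ T) => f hf.
  by apply: contrapT => nJf; case: nex'; exists f.
pose N := codim J T.
have [|A [nzA szA Ja]] := binary_form_dependent idJ hp hq hm (t := T) (k := N).
  by rewrite stat ?leq_addl.
have [b [zs le_zs [nzb def_b]]] := binary_form_factor p q nzA szA.
apply: nJm; move: Ja.
rewrite def_b -scalerAl => /(gidealZ idJ b^-1); rewrite scalerA mulVf // scale1r.
have -> : (N + T = (N - size zs) + (size zs + T))%N by rewrite addnA subnK.
have hprod : \prod_(z <- zs) (p - z *: q) * m \is (size zs + T).-homog.
  by apply: dhomogM => //; apply: dhomog_prod_pencil.
rewrite -mulrA => /(inj_at_exp hq hprod) Jm.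
apply: (gideal_prod hp hq hm) (Jm _) => [z u _|u le_u]; first exact: injpq.
by apply: injq; apply: leq_trans le_u; apply: leq_addl.
Qed.

(** By induction on the codimension in degree one: while there are two independent
   linear forms modulo J, a linear form can be added to J. In the end the quotient is
   spanned by the powers of one linear form. *)
Theorem graded_nullstellensatz J : graded_ideal J ->
  (forall t, ~ forall f, f \is t.-homog -> J t f) ->
  exists2 v, v != 0 & forall t f, f \is t.-homog -> J t f -> evalv f v = 0.
Proof.
have [k le_k] := ubnP (codim J 1); elim: k J le_k => // k IH J le_k idJ properJ.
have step l : l \is 1.-homog -> ~ J 1%N l ->
    (forall t, ~ forall f, f \is t.-homog -> add_linear J l t f) ->
    exists2 v, v != 0 & forall t f, f \is t.-homog -> J t f -> evalv f v = 0.
  move=> hl nJl properJl; have idJl := add_linear_ideal l idJ.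
  have [|v nzv vP] := IH (add_linear J l) _ idJl properJl.
    rewrite -ltnS; apply: leq_trans le_k; rewrite ltnS /codim.
    have sub : (component J 1 <= component (add_linear J l) 1)%VS.
      apply/subvP => f /(mem_component idJ) Jf.
      by apply/(mem_component idJl); apply: add_linear_sub.
    have lt : (\dim (component J 1) < \dim (component (add_linear J l) 1))%N.
      rewrite ltn_neqAle dimvS // andbT; apply/negP => eqd.
      have /eqP eqJ : component J 1 == component (add_linear J l) 1.
        by rewrite eqEdim sub (eqP eqd) leqnn.
      case: nJl; apply/(mem_componentP idJ hl); rewrite eqJ.
      apply/(mem_componentP idJl hl); exists 1; first exact: dhomog1.
      by rewrite mulr1 subrr; apply: gideal0.
    exact: (ltn_sub2l (leq_trans lt (dimvS (subvf _))) lt).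
  exists v => // t f hf Jf; apply: vP hf _; exact: add_linear_sub.
have [p hp nJp] : exists2 p, p \is 1.-homog & ~ J 1%N p.
  apply: contrapT => nex'; case: (properJ 1%N) => f hf.
  by apply: contrapT => nJf; case: nex'; exists f.
have [[q [hq nJq]]|nex] := pselect (exists q, q \is 1.-homog /\ forall z, ~ J 1%N (q - z *: p)).
  have [l [hl nJl properJl]] := pencil_singular idJ properJ hq hp nJp nJq.
  exact: step properJl.
have [v v0 v1] := gideal_dual_vector idJ hp nJp.
have reduce := reduce_to_power idJ hp v1.
have {}reduce : forall t f, f \is t.-homog -> J t (f - evalv f v *: p ^+ t).
  apply: reduce => q hq q0; have [z Jz] : exists z, J 1%N (q - z *: p).
    apply: contrapT => nz; apply: nex; exists q; split=> // z Jz.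
    by apply: nz; exists z.
  have hz : q - z *: p \is 1.-homog by rewrite rpredB ?dhomogZ.
  have /eqP := v0 _ hz Jz; rewrite evalvB evalvZ v1 mulr1 q0 sub0r oppr_eq0 => /eqP z0.
  by rewrite z0 scale0r subr0 in Jz.
exists v; first by apply: contra_eq_neq v1 => ->; rewrite evalv_lin0 // eq_sym oner_eq0.
move=> t f hf Jf; apply: contrapT => /eqP nz; case: (properJ t) => g hg.
have Jp : J t (p ^+ t).
  have := gidealB idJ Jf (reduce t f hf); rewrite opprB addrC subrK.
  by move/(gidealZ idJ (evalv f v)^-1); rewrite scalerA mulVf // scale1r.
rewrite -[g](subrK (evalv g v *: p ^+ t)); apply: gidealD => //; first exact: reduce.
exact: gidealZ.
Qed.

End Nullstellensatz.

(** * The support of a zero-dimensional scheme *)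

Section Support.
Variables (K : closedFieldType) (m : nat).
Implicit Types (Z : subscheme K m) (f : {mpoly K[m.+1]}) (Q R : point K m).

Lemma subscheme_graded Z : graded_ideal (fun _ f => Z f).
Proof.
split=> [t|t a f g Zf Zg|t i f Zf]; first exact: ideal0.
  by apply: idealD => //; rewrite -mul_mpolyC; apply: idealM.
exact: idealM.
Qed.

Lemma mem_point Q v : v \in (Q : {vspace _}) -> exists a, v = a *: vpick Q.
Proof. by have [_ eQ] := point_vpick Q; rewrite {1}eQ => /vlineP. Qed.

Lemma point_eq Q R : vpick Q \in (R : {vspace _}) -> Q = R.
Proof.
move=> QR; apply: val_inj => /=; apply/eqP; rewrite eqEdim !dim_point leqnn andbT.
by have [_ {1}->] := point_vpick Q; rewrite -memvE.
Qed.

Lemma vanishes_homog k f Q : f \is k.-homog ->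
  vanishes f Q <-> evalv f (vpick Q) = 0.
Proof.
move=> hf; have [nz _] := point_vpick Q; split=> [|f0 v /mem_point[a ->] _].
  by move=> fQ; apply: fQ nz; apply: memv_pick.
by rewrite (evalv_scale _ _ hf) f0 mulr0.
Qed.

Lemma sum_pihomog f : exists k, f = \sum_(i < k) pihomog mdeg i f.
Proof. by exists (mmeasure mdeg f); apply: pihomog_partitionE. Qed.

Lemma separate_points (s : seq (point K m)) Q : Q \notin s ->
  exists2 f, f \is (size s).-homog &
    (forall R, R \in s -> evalv f (vpick R) = 0) /\ evalv f (vpick Q) != 0.
Proof.
elim: s => [_|R s IH]; first by exists 1; [apply: dhomog1 | rewrite /evalv meval1 oner_eq0].
rewrite inE negb_or => /andP[QR /IH[f hf [fs fQ]]].
have [|l [hl l0 l1]] := @separating_form K m.+1 (R : {vspace _}) (vpick Q).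
  by apply: contraNN QR => /point_eq ->.
exists (l * f); first by apply: (@dhomogM _ _ _ 1).
split=> [P|]; last by rewrite evalvM l1 mul1r.
rewrite inE evalvM => /orP[/eqP->|/fs ->]; last by rewrite mulr0.
by rewrite l0 ?mul0r ?memv_pick.
Qed.

(** Distinct points impose independent conditions on forms of large degree. *)
Lemma support_bounded Z r (s : seq (point K m)) : zerodim_of_degree Z r ->
  uniq s -> (forall Q, Q \in s -> supp Z Q) -> (size s <= r)%N.
Proof.
move=> [t0 hilbZ] us sZ; rewrite leqNgt; apply/negP => lt_r.
pose t := (t0 + size s)%N.
have /choice[g gP] (i : 'I_(size s)) : exists g : {mpoly K[m.+1]}, g \is t.-homog /\
    forall j : 'I_(size s), (evalv g (vpick (tnth (in_tuple s) j)) != 0) = (i == j).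
  pose Q := tnth (in_tuple s) i.
  have [|f hf [fs fQ]] := @separate_points (rem Q s) Q.
    by rewrite mem_rem_uniq // !inE eqxx.
  have [nzQ _] := point_vpick Q.
  have [|l [hl _ l1]] := @separating_form K m.+1 0%VS (vpick Q); first by rewrite memv0.
  have Qs : Q \in s by apply: mem_tnth.
  exists (l ^+ (t - size (rem Q s)) * f); split.
    have := dhomogM (dhomog_lin_exp (t - size (rem Q s)) hl) hf.
    by rewrite subnK // size_rem // /t (leq_trans (leq_pred _)) ?leq_addl.
  move=> j; have [<-|ij] := eqVneq i j.
    by rewrite evalvM evalvX l1 expr1n mul1r.
  rewrite evalvM fs ?mulr0 ?eqxx // mem_rem_uniq // inE mem_tnth andbT.
  have /tuple_uniqP inj : uniq (in_tuple s) by [].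
  by apply: contraNneq ij => /inj ->.
have hg i : g i \is t.-homog by case: (gP i).
have := codim_dependent (subscheme_graded Z) hg.
rewrite -[codim _ _]/(hilbert Z t) hilbZ ?leq_addr // => /(_ lt_r)[a nza Za].
case/rV0Pn: nza => i; apply/negP; rewrite negbK.
have [nzQ _] := point_vpick (tnth (in_tuple s) i).
have := sZ _ (mem_tnth i (in_tuple s)) _ Za _ (memv_pick _) nzQ.
rewrite evalv_sum (bigD1 i) //= big1 ?addr0 => [|j ji]; last first.
  by rewrite evalvZ; have /negbFE/eqP -> := etrans ((gP j).2 i) (negPf ji); rewrite mulr0.
by rewrite evalvZ => /eqP; rewrite mulf_eq0 (negPf (etrans ((gP i).2 i) (eqxx i))) orbF.
Qed.

Lemma bounded_finite (T : eqType) (P : T -> Prop) r :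
  (forall s : seq T, uniq s -> (forall x, x \in s -> P x) -> (size s <= r)%N) ->
  exists s : seq T, forall x, P x <-> x \in s.
Proof.
move=> bnd.
suff H k : (k <= r.+1)%N -> (exists s : seq T, forall x, P x <-> x \in s) \/
    exists s : seq T, [/\ uniq s, forall x, x \in s -> P x & size s = k].
  have [//|[s [us sP sz]]] := H r.+1 (leqnn _).
  by have := bnd s us sP; rewrite sz ltnn.
elim: k => [_|k IH lt_k]; first by right; exists [::].
have [|[s [us sP sz]]] := IH (ltnW lt_k); first by left.
have [all|] := pselect (forall x, P x -> x \in s).
  by left; exists s => x; split; [apply: all | apply: sP].
case/existsNP => x /not_implyP[Px /negP xs]; right; exists (x :: s).
split=> /=; [by rewrite xs | | by rewrite sz].
by move=> y; rewrite inE => /orP[/eqP->|/sP].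
Qed.

Lemma supp_reduced_set (B : {fset point K m}) Q :
  supp (reduced_set B) Q <-> Q \in B.
Proof.
split=> [sQ|QB f Bf v vQ nzv].
  apply: contraT => QB; have [f hf [fB fQ]] := separate_points QB.
  have Bf : reduced_set B f.
    move=> k; have [<-|ne] := eqVneq (size B) k.
      by rewrite pihomog_dE // => R RB; apply/(vanishes_homog R hf)/fB.
    by rewrite (pihomog_ne0 ne hf); apply: vanishes_on0.
  by have /(vanishes_homog Q hf)/eqP := sQ f Bf; rewrite (negPf fQ).
have [k def_f] := sum_pihomog f.
rewrite def_f evalv_sum big1 // => i _; exact: (Bf i Q QB v vQ nzv).
Qed.

(** The support is finite, so that each of its points is open and closed in it. *)
Lemma connected_support Z r : zerodim_of_degree Z r -> connected_scheme Z ->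
  exists Q, forall R, supp Z R <-> R = Q.
Proof.
move=> Zr [[Q ZQ] conn].
have [s sP] : exists s : seq (point K m), forall R, supp Z R <-> R \in s.
  by apply: (@bounded_finite _ _ r) => s us sZ; apply: support_bounded Zr us sZ.
exists Q => R; split=> [ZR|->] //; apply: contrapT => RQ.
pose G := [fset P in s | P != Q]%fset.
have FE P : supp (reduced_set [fset Q]%fset) P <-> P = Q.
  split=> [/supp_reduced_set|->]; first by rewrite in_fset1 => /eqP.
  by apply/supp_reduced_set; rewrite in_fset1.
have GE P : supp (reduced_set G) P <-> (P \in s) && (P != Q).
  split=> [/supp_reduced_set|PG]; first by rewrite !inE.
  by apply/supp_reduced_set; rewrite !inE.
case: (conn (reduced_set [fset Q]%fset) (reduced_set G)) => [P|P|F0|G0].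
- split=> [/sP Ps|[/FE->//|/GE/andP[Ps _]]]; last exact/sP.
  by have [->|PQ] := eqVneq P Q; [left; apply/FE | right; apply/GE; rewrite Ps].
- by move=> [/FE-> /GE/andP[_]]; rewrite eqxx.
- by apply: (F0 Q); apply/FE.
by apply: (G0 R); apply/GE/andP; split; [apply/sP | apply/eqP].
Qed.

End Support.

(** * Zero-dimensional schemes supported at one point *)

Section Reduction.
Variables (K : fieldType) (n : nat).
Implicit Types (f p q l : {mpoly K[n]}).

(** For the intersection C of two ideals modulo which l is regular, this reduces the
   comparison of the two ideals to linear forms. *)
Lemma reduce_to_linear (C : {mpoly K[n]} -> Prop) l :
  C 0 -> (forall f g, C f -> C g -> C (f + g)) -> (forall g f, C f -> C (g * f)) ->
  l \is 1.-homog ->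
  (forall p q, p \is 1.-homog -> q \is 1.-homog ->
     exists2 p', p' \is 1.-homog & C (p * q - l * p')) ->
  forall k f, f \is k.+1.-homog -> exists2 p, p \is 1.-homog & C (f - l ^+ k * p).
Proof.
move=> C0 CD CM hl Cl k f hf.
suff H t (g : {mpoly K[n]}) : g \is t.-homog -> forall j, t = j.+1 ->
    exists2 p, p \is 1.-homog & C (g - l ^+ j * p) by apply: H hf _ _.
move: t g; apply: dhomog_ind => [t j _|t f1 f2 _ _ IH1 IH2 j tj|//|t i g hg IH j [tj]].
- by exists 0; [apply: dhomog0 | rewrite mulr0 subrr].
- have [p1 hp1 C1] := IH1 j tj; have [p2 hp2 C2] := IH2 j tj.
  exists (p1 + p2); first by rewrite rpredD.
  by rewrite mulrDr opprD addrACA; apply: CD.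
rewrite -{j}tj; case: t hg IH => [hg _|t _ /(_ t erefl)[p hp Cp]].
  exists ('X_i * g); last by rewrite expr0 mul1r subrr.
  by apply: (@dhomogM _ _ _ 1 _ 0) => //; apply: dhomogXU.
have [p' hp' Cp'] := Cl 'X_i p (dhomogXU K i) hp; exists p' => //.
have -> : 'X_i * g - l ^+ t.+1 * p' =
    'X_i * (g - l ^+ t * p) + l ^+ t * ('X_i * p - l * p').
  by rewrite !mulrBr exprSr mulrCA addrA subrK mulrA.
by apply: CD; apply: CM.
Qed.

End Reduction.

Section LocalScheme.
Variables (K : closedFieldType) (m : nat) (Z : subscheme K m) (r : nat) (Q : point K m).
Implicit Types (f p q l : {mpoly K[m.+1]}).
Hypotheses (Z_deg : zerodim_of_degree Z r) (supp_Q : forall R, supp Z R <-> R = Q).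

Let J (t : nat) f := Z f.
Let idJ : graded_ideal J. Proof. exact: subscheme_graded. Qed.
Let e := vpick Q.
Let U := scheme_span Z.

Lemma subscheme_e f : Z f -> evalv f e = 0.
Proof.
move=> Zf; have [nz _] := point_vpick Q.
by have /(_ _ Zf _ _ nz) := (supp_Q Q).2 erefl; apply; apply: memv_pick.
Qed.

Lemma span_form p : p \is 1.-homog -> (forall v, v \in U -> evalv p v = 0) -> Z p.
Proof.
move=> hp p0; apply: contrapT => nZp.
have [v v0 v1] := gideal_dual_vector idJ hp nZp.
have vU : v \in U by apply/mem_scheme_span => l Zl hl; apply: v0.
by have := p0 v vU; rewrite v1 => /eqP; rewrite oner_eq0.
Qed.

Lemma form_span p : p \is 1.-homog -> Z p -> forall v, v \in U -> evalv p v = 0.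
Proof. by move=> hp Zp v /mem_scheme_span; apply. Qed.

Lemma e_span : e \in U.
Proof. by apply/mem_scheme_span => l Zl _; apply: subscheme_e. Qed.

(** A linear form which is nonzero at the support generates with Z an ideal
   without zeros; by the Nullstellensatz it acts surjectively, and so bijectively,
   in large degree. *)
Lemma nonzero_divisor l f k : l \is 1.-homog -> evalv l e != 0 ->
  f \is k.-homog -> Z (l * f) -> Z f.
Proof.
move=> hl nzl hf Zlf.
have [T full] : exists t, forall f, f \is t.-homog -> add_linear J l t f.
  apply: contrapT => nex.
  have [t full|v nzv vP] := graded_nullstellensatz (add_linear_ideal l idJ).
    by case: nex; exists t.
  have Zv g : Z g -> vanishes g (point_of nzv).
    move=> Zg w /vlineP[a ->] _; have [j def_g] := sum_pihomog g.
    rewrite def_g evalv_sum big1 // => i _.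
    rewrite (evalv_scale _ _ (pihomogP _ _ _)) (vP i) ?mulr0 ?pihomogP //.
    by apply: add_linear_sub; apply: ideal_homog.
  have /(congr1 (@line K m)) eQ := (supp_Q _).1 Zv.
  have [a ev] : exists a, e = a *: v by apply/vlineP; rewrite -[<[v]>%VS]/(line (point_of nzv)) eQ memv_pick.
  case/eqP: nzl; rewrite ev evalv_linZ // (vP 1%N) ?mulr0 //.
  by exists 1; [apply: dhomog1 | rewrite mulr1 subrr; apply: gideal0].
have [t0 hilb] := Z_deg.
have inj t : (maxn T t0 <= t)%N -> inj_at J l t.
  rewrite geq_max => /andP[le_T le_t0].
  have [_ _ _] := codim_mul idJ t hl; apply.
    by rewrite -[LHS]/(hilbert Z t) -[RHS]/(hilbert Z t.+1) !hilb // leqW.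
  apply/surj_add_linear; apply: (gideal_full_le (add_linear_ideal l idJ)) full.
  exact: leqW.
apply: (@ideal_sat _ _ Z (maxn T t0)) => u du.
have hXf : 'X_[u] * f \is (mdeg u + k).-homog by rewrite dhomogM // dhomogX.
apply: (inj _ _ _ hXf); first by rewrite du leq_addr.
by rewrite mulrCA; apply: idealM.
Qed.

Lemma nonzero_divisor_exp l f k j : l \is 1.-homog -> evalv l e != 0 ->
  f \is k.-homog -> Z (l ^+ j * f) -> Z f.
Proof.
move=> hl nzl hf; elim: j => [|j IH]; first by rewrite expr0 mul1r.
rewrite exprS -mulrA => /(nonzero_divisor hl nzl (k := (j + k)%N)) Zf.
by apply/IH/Zf; apply: dhomogM => //; apply: dhomog_lin_exp.
Qed.

Lemma exists_form : exists2 l, l \is 1.-homog & evalv l e = 1.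
Proof.
have [nz _] := point_vpick Q.
have [|l [hl _ l1]] := @separating_form K m.+1 0%VS e; first by rewrite memv0.
by exists l.
Qed.

Section Normalized.
Variable l : {mpoly K[m.+1]}.
Hypotheses (hl : l \is 1.-homog) (l1 : evalv l e = 1).
Let nzl : evalv l e != 0. Proof. by rewrite l1 oner_eq0. Qed.

Lemma hilbert_le t u : (t <= u)%N -> (hilbert Z t <= hilbert Z u)%N.
Proof.
move=> le_tu; rewrite -(subnK le_tu); elim: (u - t)%N => // k IH.
apply: leq_trans IH _; rewrite addSn.
have [+ _ _ _] := codim_mul idJ (k + t) hl; apply.
by move=> f hf; apply: nonzero_divisor hf.
Qed.

Lemma hilbert_le_deg t : (hilbert Z t <= r)%N.
Proof.
have [t0 hilb] := Z_deg; rewrite -(hilb (maxn t t0)) ?leq_maxr //.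
by apply: hilbert_le; apply: leq_maxl.
Qed.

Lemma dim_span_le_hilbert : (\dim U <= hilbert Z 1)%N.
Proof.
rewrite leqNgt; apply/negP => lt.
have [x xP] := dual_form (basis_free (vbasisP U)).
have hg (i : 'I_(\dim U)) : x i \is 1.-homog by case: (xP i).
have [a /rV0Pn[j nza] Za] := codim_dependent idJ hg lt.
case/eqP: nza; have := form_span _ Za (vbasis_mem (mem_nth 0 _)).
rewrite size_tuple => /(_ _ j (ltn_ord j)) <-.
  rewrite evalv_sum (bigD1 j) //= big1 ?addr0 => [|i ij]; rewrite evalvZ (xP _).2 ?size_tuple //.
    by rewrite eqxx mulr1.
  by rewrite (_ : (i == j :> nat) = false) ?mulr0 //; apply: negPf.
by apply: rpred_sum => i _; rewrite dhomogZ.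
Qed.

Hypothesis dimU : \dim U = r.

(** The Hilbert function does not decrease, so it stays between the dimension of the
   span and the degree. *)
Lemma hilbert_deg t : (0 < t)%N -> hilbert Z t = r.
Proof.
move=> t0; apply/eqP; rewrite eqn_leq hilbert_le_deg -dimU.
by rewrite (leq_trans dim_span_le_hilbert) // hilbert_le.
Qed.

(** Multiplication by l is an injective map between spaces of equal dimension. *)
Lemma divide_l t f : f \is t.+2.-homog ->
  exists2 g, g \is t.+1.-homog & Z (f - l * g).
Proof.
move=> hf; have [_ _ + _] := codim_mul idJ t.+1 hl; apply => //.
  by rewrite -[LHS]/(hilbert Z t.+1) -[RHS]/(hilbert Z t.+2) !hilbert_deg.
by move=> g hg; apply: nonzero_divisor hg.
Qed.

Lemma divide_l_exp t f : f \is t.+1.-homog ->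
  exists2 g, g \is 1.-homog & Z (f - l ^+ t * g).
Proof.
elim: t f => [|t IH] f hf.
  by exists f => //; rewrite expr0 mul1r subrr; apply: ideal0.
have [g hg Zg] := divide_l hf; have [h hh Zh] := IH g hg; exists h => //.
have -> : f - l ^+ t.+1 * h = (f - l * g) + l * (g - l ^+ t * h).
  by rewrite mulrBr exprS mulrA addrA subrK.
by apply: idealD => //; apply: idealM.
Qed.

(** Among the factors l and p - z l of a binary form, only p vanishes at the support,
   and the other ones are regular. *)
Lemma binary_form_mem p k (A : {poly K}) : p \is 1.-homog -> evalv p e = 0 ->
  A != 0 -> (size A <= k.+1)%N -> Z (binary_form k A p l) -> Z (p ^+ k).
Proof.
move=> hp p0 nzA sA; have [a [zs le_zs [nza ->]]] := binary_form_factor p l nzA sA.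
move/(gidealZ idJ (t := 0) a^-1); rewrite /J scalerA mulVf // scale1r.
have hpz z : p - z *: l \is 1.-homog by rewrite rpredB // dhomogZ.
have hprod s := dhomog_prod_pencil s hp hl.
move/(nonzero_divisor_exp hl nzl (hprod zs)) => Zp.
suff H (s : seq K) j : Z (p ^+ j * \prod_(z <- s) (p - z *: l)) -> Z (p ^+ (j + size s)).
  rewrite -(subnK le_zs) exprD; apply: idealM.
  by apply: (H zs 0%N); rewrite expr0 mul1r.
elim: s j => [|z s IH] j; first by rewrite big_nil mulr1 addn0.
rewrite big_cons addnS; have [->|nzz] := eqVneq z 0.
  by rewrite scale0r subr0 mulrA -exprSr -addSn; apply: IH.
rewrite mulrCA => /(nonzero_divisor (hpz z) (k := (j + size s)%N)) Zs.
rewrite exprS; apply/idealM/IH/Zs.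
  by rewrite evalvB evalvZ p0 l1 mulr1 sub0r oppr_eq0.
by apply: dhomogM => //; apply: dhomog_lin_exp.
Qed.

(** The r + 1 forms l^(r-j) p^j are dependent modulo Z. *)
Lemma nilpotent p : p \is 1.-homog -> evalv p e = 0 -> (0 < r)%N -> Z (p ^+ r).
Proof.
move=> hp p0 r0.
have [|A [nzA szA Za]] := binary_form_dependent idJ hp hl (dhomog1 K _) (k := r).
  by rewrite addn0 -[codim _ _]/(hilbert Z r) hilbert_deg.
by apply: (binary_form_mem hp p0 nzA szA); rewrite -[binary_form _ _ _ _]mulr1.
Qed.

End Normalized.
End LocalScheme.

(** * Local schemes as germs of rational normal curves *)

Lemma free_of_dual (K : fieldType) (n : nat) (E : seq 'rV[K]_n) (x : nat -> {mpoly K[n]}) :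
  (forall i, x i \is 1.-homog) ->
  (forall i j, (i < size E)%N -> (j < size E)%N -> evalv (x i) E`_j = (i == j)%:R) ->
  free E.
Proof.
move=> hx xE; rewrite -[E]/(tval (in_tuple E)); apply/freeP => k k0 i.
have := congr1 (evalv (x i)) k0; rewrite evalv_lin0 // evalv_lin_sum //.
rewrite (bigD1 i) //= big1 ?addr0 => [|j ji]; rewrite evalv_linZ // xE //.
  by rewrite eqxx mulr1.
by rewrite eq_sym (_ : (j == i :> nat) = false) ?mulr0 //; apply: negPf.
Qed.

(** The scheme Z is the infinitesimal piece of length [size E] of the curve along E. *)
Definition has_germ (K : fieldType) m (Z : subscheme K m) (E : seq 'rV[K]_m.+1) : Prop :=
  forall k f, f \is k.-homog -> Z f <-> forall j, (j < size E)%N -> (along E f)`_j = 0.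

Section GermOfScheme.
Variables (K : closedFieldType) (m : nat) (Z : subscheme K m) (r' : nat) (Q : point K m).
Let r := r'.+2.
Implicit Types (f p q : {mpoly K[m.+1]}).
Hypotheses (Z_deg : zerodim_of_degree Z r) (supp_Q : forall R, supp Z R <-> R = Q).
Hypothesis dimU : \dim (scheme_span Z) = r.
Variables (l y : {mpoly K[m.+1]}).
Hypotheses (hl : l \is 1.-homog) (l1 : evalv l (vpick Q) = 1).
Hypotheses (hy : y \is 1.-homog) (y0 : evalv y (vpick Q) = 0).
Hypothesis nZy : ~ Z (y ^+ r'.+1).

Let U := scheme_span Z.
Let nzl : evalv l (vpick Q) != 0. Proof. by rewrite l1 oner_eq0. Qed.
Let idJ : graded_ideal (fun _ f => Z f). Proof. exact: subscheme_graded. Qed.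
Let ZB f g : Z f -> Z g -> Z (f - g). Proof. exact: (gidealB idJ (t := 0)). Qed.

(** Modulo Z, the powers of the function y / l are linear: they are the coordinates
   w_j / l of a rational normal curve t |-> (1 : t : t^2 : ...). *)
Lemma power_coordinates : exists w : nat -> {mpoly K[m.+1]},
  [/\ w 0%N = l, forall j, w j \is 1.-homog, forall j, (r <= j)%N -> w j = 0
    & forall i, Z (y ^+ i.+1 - l ^+ i * w i.+1)].
Proof.
have Zy i : (r <= i)%N -> Z (y ^+ i).
  move=> le; rewrite -(subnK le) exprD; apply: idealM.
  exact: (nilpotent Z_deg supp_Q hl l1 dimU).
have /choice[w wP] j : exists p, [/\ p \is 1.-homog, j = 0%N -> p = l,
    (r <= j)%N -> p = 0 & forall i, j = i.+1 -> Z (y ^+ j - l ^+ i * p)].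
  case: j => [|j]; first by exists l.
  have [le|lt] := leqP r j.+1.
    exists 0; split=> //; first exact: dhomog0.
    by move=> i [<-]; rewrite mulr0 subr0; apply: Zy.
  have [p hp Zp] := divide_l_exp Z_deg supp_Q hl l1 dimU (dhomog_lin_exp j.+1 hy).
  by exists p; split=> // i [<-].
exists w; split=> [|j|j le|i].
- by case: (wP 0%N) => _ ->.
- by case: (wP j).
- by case: (wP j) => _ _ ->.
by case: (wP i.+1) => _ _ _; apply.
Qed.

Section Coordinates.
Variable w : nat -> {mpoly K[m.+1]}.
Hypotheses (w0 : w 0%N = l) (hw : forall j, w j \is 1.-homog).
Hypotheses (w_big : forall j, (r <= j)%N -> w j = 0).
Hypothesis wy : forall i, Z (y ^+ i.+1 - l ^+ i * w i.+1).

Lemma power_coordinates_mul i j : Z (w i * w j - l * w (i + j)%N).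
Proof.
case: i => [|i]; first by rewrite w0 add0n subrr; apply: ideal0.
case: j => [|j]; first by rewrite w0 addn0 mulrC subrr; apply: ideal0.
apply: (nonzero_divisor_exp (j := (i + j)%N) Z_deg supp_Q hl nzl (k := 2)).
  by apply: rpredB; apply: (@dhomogM _ _ _ 1 _ 1).
have -> : l ^+ (i + j) * (w i.+1 * w j.+1 - l * w (i.+1 + j.+1)%N) =
   (y ^+ (i + j).+2 - l ^+ (i + j).+1 * w (i + j).+2) -
   y ^+ i.+1 * (y ^+ j.+1 - l ^+ j * w j.+1) -
   (l ^+ j * w j.+1) * (y ^+ i.+1 - l ^+ i * w i.+1).
  by rewrite addSn addnS -addSn -addnS !exprD !exprS; ring.
by apply: ZB; [apply: ZB | ]; rewrite ?addSn ?addnS //; apply: idealM.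
Qed.

(** A relation gives a binary form of degree r - 1 in y and l which lies in Z, and this
   puts y^(r-1) in Z. *)
Lemma power_coordinates_free (a : nat -> K) :
  Z (\sum_(j < r) a j *: w j) -> forall j, (j < r)%N -> a j = 0.
Proof.
move=> Zw j lt_j; pose A := \poly_(i < r) a i.
have [A0|nzA] := eqVneq A 0.
  by have := congr1 (fun P : {poly K} => P`_j) A0; rewrite coef_poly lt_j coef0.
case: nZy; apply: (binary_form_mem Z_deg supp_Q hl l1 hy y0 nzA (size_poly _ _)).
have -> : binary_form r'.+1 A y l = l ^+ r' * (\sum_(i < r) a i *: w i) +
    \sum_(i < r) a i *: (l ^+ (r'.+1 - i) * y ^+ i - l ^+ r' * w i).
  rewrite mulr_sumr -big_split /=; apply: eq_bigr => i _.
  by rewrite coef_poly ltn_ord -scalerAr -scalerDr addrC subrK.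
apply: idealD; first exact: idealM.
apply: (gideal_sum idJ (t := 0)) => -[[|i] lt_i] _ /=; apply: (gidealZ idJ (t := 0)).
  by rewrite w0 subn0 expr0 mulr1 -exprSr subrr; apply: ideal0.
rewrite subSS; have -> : l ^+ (r' - i) * y ^+ i.+1 - l ^+ r' * w i.+1 =
    l ^+ (r' - i) * (y ^+ i.+1 - l ^+ i * w i.+1).
  by rewrite mulrBr mulrA -exprD subnK.
exact: idealM.
Qed.

Lemma dual_germ : exists E : seq 'rV[K]_m.+1, [/\ size E = r,
  forall v, v \in E -> v \in U &
  forall i j, (i < r)%N -> (j < r)%N -> evalv (w i) E`_j = (i == j)%:R].
Proof.
have /choice[e eP] j : exists v, (j < r)%N -> v \in U /\
    forall i, (i < r)%N -> evalv (w i) v = (i == j)%:R.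
  have [lt_j|] := ltnP j r; last by exists 0.
  pose W i := DHomog (hw i).
  pose L := (component (fun _ f => Z f) 1 + \sum_(i < r | i != j :> nat) <[W i]>)%VS.
  have [|v v0 v1] := @dual_vector _ _ L (w j) (hw j).
    apply/negP => /memv_addP[z /(mem_component idJ) Zz [_ /memv_sumP[u uW ->]]].
    move/(congr1 val); rewrite /= raddf_sum /= => def_w.
    have /choice[b bP] i : exists b, (i < r)%N -> i != j -> 
       forall lt : (i < r)%N, val (u (Ordinal lt)) = b *: w i.
      have [lt_i|nlt] := pselect (i < r)%N; last by exists 0 => /nlt.
      have [//|ij] := eqVneq i j; first by exists 0.
      have /vlineP[b ub] := uW (Ordinal lt_i) ij; exists b => _ _ lt.
      by rewrite (bool_irrelevance lt lt_i) ub.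
    pose a i := if i == j then 1 else - b i.
    suff Za : Z (\sum_(i < r) a i *: w i).
      by have /eqP := power_coordinates_free Za lt_j; rewrite /a eqxx oner_eq0.
    rewrite /a (bigD1 (Ordinal lt_j)) //= eqxx scale1r.
    have -> : \sum_(i < r | i != Ordinal lt_j) (if i == j :> nat then 1 else - b i) *: w i =
       - \sum_(i < r | i != j :> nat) val (u i).
      rewrite -sumrN; apply: eq_big => [i //|i /negPf ij].
      rewrite (_ : (i == j :> nat) = false) // scaleNr; congr (- _).
      case: i ij => i lt_i ij; symmetry; apply: bP => //; exact: negbT.
    by rewrite {1}def_w addrK.
  exists v => _; split=> [|i lt_i].
    apply/mem_scheme_span => p Zp hp; apply: (v0 (DHomog hp)).
    rewrite -[DHomog hp]addr0 memv_add ?mem0v //; exact/(mem_component idJ).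
  have [->|ij] := eqVneq i j; first exact: v1.
  apply: (v0 (W i)); rewrite -[W i]add0r memv_add ?mem0v //.
  by apply: (subvP (sumv_sup (Ordinal lt_i) ij (subvv _))); apply: memv_line.
exists [seq e j | j <- iota 0 r]; split=> [|_ /mapP[j + ->]|i j lt_i lt_j].
- by rewrite size_map size_iota.
- by rewrite mem_iota => /andP[_ lt_j]; case: (eP j lt_j).
rewrite (nth_map 0%N) ?size_iota // nth_iota // add0n.
by case: (eP j lt_j) => _; apply.
Qed.

End Coordinates.

(** By the hypothesis on y, the scheme is curvilinear with parameter y / l. Its ideal and
   that of the germ contain the same linear forms and the same relations
   w_i w_j - l w_(i+j), and l is regular modulo both; this determines the ideal. *)
Lemma germ_of_scheme : exists E : seq 'rV[K]_m.+1, [/\ size E = r, free E,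
  <<E>>%VS = scheme_span Z & has_germ Z E].
Proof.
have [w [w0 hw w_big wy]] := power_coordinates.
have [E [sE EU wE]] := dual_germ w0 hw wy.
have fE : free E by apply: (free_of_dual hw); rewrite sE.
have spanE : <<E>>%VS = U.
  apply/eqP; rewrite eqEdim dimU -sE -(eqP fE) leqnn andbT.
  by apply/span_subvP.
have Ew j : (j < r)%N -> along E (w j) = 'X^j.
  by move=> lt_j; apply: along_dual; rewrite ?sE // => i lt_i; apply: wE.
pose G f := forall j, (j < r)%N -> (along E f)`_j = 0.
pose C f := Z f /\ G f.
have CD f g : C f -> C g -> C (f + g).
  move=> [Zf Gf] [Zg Gg]; split; first exact: idealD.
  by move=> j lt_j; rewrite alongD coefD Gf // Gg // addr0.
have CM g f : C f -> C (g * f).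
  move=> [Zf Gf]; split; first exact: idealM.
  by move=> j lt_j; rewrite alongM (low_coefs_mul _ Gf).
have C0 : C 0 by split=> [|j _]; [apply: ideal0 | rewrite along0 coef0].
have Csum (I : Type) (s : seq I) (F : I -> {mpoly K[m.+1]}) :
    (forall i, C (F i)) -> C (\sum_(i <- s) F i).
  by move=> CF; apply: (big_ind C).
have lin p : p \is 1.-homog -> C (p - \sum_(j < r) evalv p E`_j *: w j).
  move=> hp; have hp' : p - \sum_(j < r) evalv p E`_j *: w j \is 1.-homog.
    by rewrite rpredB // rpred_sum // => j _; rewrite dhomogZ.
  have p0 i : (i < r)%N -> evalv (p - \sum_(j < r) evalv p E`_j *: w j) E`_i = 0.
    move=> lt_i; rewrite evalvB evalv_sum (bigD1 (Ordinal lt_i)) //= evalvZ wE // eqxx mulr1.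
    rewrite big1 ?addr0 ?subrr // => j ji.
    by rewrite evalvZ wE // (_ : (j == i :> nat) = false) ?mulr0 //; apply: negPf.
  split=> [|j lt_j]; last by rewrite along_lin // sE lt_j p0.
  apply: (span_form hp') => v; rewrite -/U -spanE; apply: evalv_span0 => // u /(nthP 0)[i].
  by rewrite sE => lt_i <-; apply: p0.
have ww i j : C (w i * w j - l * w (i + j)%N) \/ (r <= i)%N \/ (r <= j)%N.
  have [le_i|lt_i] := leqP r i; first by right; left.
  have [le_j|lt_j] := leqP r j; first by right; right.
  left; split; first exact: power_coordinates_mul.
  move=> k lt_k; rewrite alongB !alongM -{1}w0 (Ew i) // (Ew j) // (Ew 0%N) // -exprD expr0 mul1r coefB coefXn.
  have [le|lt] := leqP r (i + j); last by rewrite Ew // coefXn subrr.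
  by rewrite w_big // along0 coef0 subr0 ltn_eqF // (leq_trans lt_k).
have Cl p q : p \is 1.-homog -> q \is 1.-homog ->
    exists2 p', p' \is 1.-homog & C (p * q - l * p').
  move=> hp hq; pose a (j : 'I_r) := evalv p E`_j; pose b (j : 'I_r) := evalv q E`_j.
  exists (\sum_(i < r) \sum_(j < r) (a i * b j) *: w (i + j)%N).
    by apply: rpred_sum => i _; apply: rpred_sum => j _; rewrite dhomogZ.
  have -> : p * q - l * (\sum_(i < r) \sum_(j < r) (a i * b j) *: w (i + j)%N) =
     q * (p - \sum_(i < r) a i *: w i) +
     (\sum_(i < r) a i *: w i) * (q - \sum_(j < r) b j *: w j) +
     \sum_(i < r) \sum_(j < r) (a i * b j) *: (w i * w j - l * w (i + j)%N).
    have -> : \sum_(i < r) \sum_(j < r) (a i * b j) *: (w i * w j - l * w (i + j)%N) =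
       (\sum_(i < r) a i *: w i) * (\sum_(j < r) b j *: w j) -
       l * (\sum_(i < r) \sum_(j < r) (a i * b j) *: w (i + j)%N).
      rewrite mulr_suml mulr_sumr -sumrB; apply: eq_bigr => i _.
      rewrite !mulr_sumr -sumrB; apply: eq_bigr => j _.
      by rewrite scalerBr -scalerAl -!scalerAr scalerA mulrC.
    by ring.
  apply: (CD); first by apply: (CD); apply: CM; apply: lin.
  apply: (Csum) => i; apply: (Csum) => j; rewrite -mul_mpolyC; apply: CM.
  by have [//|[]] := ww i j; rewrite leqNgt ltn_ord.
exists E; split=> // -[|k] f hf; rewrite sE.
  have [a ->] := dhomog0_const hf; split=> [Za|/(_ 0%N isT)].
    have := subscheme_e supp_Q Za; rewrite evalvC => -> j _.
    by rewrite along0 coef0.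
  by rewrite alongC coefC /= => ->; apply: ideal0.
have [p hp Cp] := reduce_to_linear C0 CD CM hl Cl hf.
have [Zfp Gfp] := Cp.
have al : along E l = 1 by rewrite -w0 Ew // expr0.
have aE j : (along E f)`_j = (along E (f - l ^+ k * p))`_j + (along E p)`_j.
  by rewrite alongB alongM alongXn al expr1n mul1r coefB subrK.
split=> [Zf j lt_j|Gf].
  rewrite aE Gfp // add0r along_lin // sE lt_j.
  have Zp : Z p.
    apply: (nonzero_divisor_exp (j := k) Z_deg supp_Q hl nzl hp).
    by have := ZB Zf Zfp; rewrite opprB addrC subrK.
  by apply: (form_span hp Zp); apply: EU; rewrite mem_nth ?sE.
rewrite -[f](subrK (l ^+ k * p)); apply: idealD => //; apply: idealM.
apply: (span_form hp) => v; rewrite -/U -spanE; apply: evalv_span0 => // u /(nthP 0)[i].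
rewrite sE => lt_i <-; have := Gf i lt_i; rewrite aE Gfp // add0r along_lin // sE lt_i.
by [].
Qed.

End GermOfScheme.

(** * Local schemes of degree two and three *)

Section LowDegree.
Variables (K : closedFieldType) (m : nat) (Z : subscheme K m).
Implicit Types (f p q : {mpoly K[m.+1]}) (Q : point K m).

Let idJ : graded_ideal (fun _ f => Z f). Proof. exact: subscheme_graded. Qed.

(** If every linear form vanishing at the support lies in the ideal, the scheme
   is a reduced point. *)
Lemma exists_tangent_form r Q : zerodim_of_degree Z r -> (1 < r)%N ->
  exists p, [/\ p \is 1.-homog, evalv p (vpick Q) = 0 & ~ Z p].
Proof.
move=> [t0 hilb] r1; apply: contrapT => nex.
have Zp p : p \is 1.-homog -> evalv p (vpick Q) = 0 -> Z p.
  by move=> hp p0; apply: contrapT => nZ; apply: nex; exists p.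
have [l hl l1] := exists_form Q.
have red := reduce_to_power idJ hl l1 Zp.
have := hilb t0 (leqnn _); rewrite /hilbert.
have hlt := dhomog_lin_exp t0 hl.
set A := vspace_of _; have : ((A + <[DHomog hlt]>)%VS = fullv).
  apply/eqP; rewrite eqEsubv subvf /=; apply/subvP => f _.
  rewrite -[f](subrK (evalv (val f) (vpick Q) *: DHomog hlt)) memv_add ?rpredZ ?memv_line //.
  by apply/mem_degree_part; apply: red; case: (f).
move=> full hr; have := (dimv_add_leqif A <[DHomog hlt]>%VS).1; rewrite full => le.
have key (D a b : nat) : (D <= a + b -> b <= 1 -> D - a = r -> False)%N by lia.
by apply: (key _ _ _ le _ hr); rewrite dim_vline leq_b1.
Qed.

(** The span is larger than the support, as a tangent form does not vanish on it. *)
Lemma double_germ : zerodim_of_degree Z 2 -> connected_scheme Z ->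
  (\dim (scheme_span Z) <= 2)%N ->
  exists E : seq 'rV[K]_m.+1, [/\ size E = 2%N, free E, <<E>>%VS = scheme_span Z &
    has_germ Z E].
Proof.
move=> Zr conn dimU; have [Q QP] := connected_support Zr conn.
have [l hl l1] := exists_form Q.
have [y [hy y0 nZy]] := exists_tangent_form Q Zr isT.
have eU := e_span QP; have [nze _] := point_vpick Q.
have {}dimU : \dim (scheme_span Z) = 2%N.
  apply/eqP; rewrite eqn_leq dimU ltnNge; apply/negP => le1.
  have eqU : (<[vpick Q]> == scheme_span Z)%VS.
    by rewrite eqEdim -memvE eU dim_vline nze.
  case: nZy; apply: (span_form hy) => v; rewrite -(eqP eqU) => /vlineP[a ->].
  by rewrite evalv_linZ // y0 mulr0.
by apply: (germ_of_scheme (r' := 0) Zr QP dimU hl l1 hy y0); rewrite expr1.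
Qed.

Definition differential f (v w : 'rV[K]_m.+1) : K := \sum_(i < m.+1) evalv (mderiv i f) v * w ord0 i.

Lemma differentialD f g v w : differential (f + g) v w = differential f v w + differential g v w.
Proof.
by rewrite /differential -big_split; apply: eq_bigr => i _; rewrite mderivD evalvD mulrDl.
Qed.

Lemma differentialM f g v w :
  differential (f * g) v w = differential f v w * evalv g v + evalv f v * differential g v w.
Proof.
rewrite /differential mulr_suml mulr_sumr -big_split; apply: eq_bigr => i _.
by rewrite mderivM evalvD !evalvM mulrDl mulrAC mulrA.
Qed.

Lemma differential0 v w : differential 0 v w = 0.
Proof. by rewrite /differential big1 // => i _; rewrite mderiv0 /evalv meval0 mul0r. Qed.

Lemma differential_lin p v w : p \is 1.-homog -> differential p v w = evalv p w.
Proof.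
move=> hp; have C (q : {mpoly K[m.+1]}) a : differential a%:MP v w = 0.
  by rewrite /differential big1 // => i _; rewrite mderivC /evalv meval0 mul0r.
have X i : differential 'X_i v w = evalv 'X_i w.
  rewrite /differential (bigD1 i) //= big1 ?addr0 => [|j ji].
    rewrite mderivX mnm1E eqxx scale1r (_ : (U_(i) - U_(i))%MM = 0%MM) ?mpolyX0 ?/evalv ?meval1 ?mul1r ?mevalXU //.
    by apply/mnmP => j; rewrite mnmBE subnn mnm0E.
  by rewrite mderivX mnm1E eq_sym (negPf ji) scale0r /evalv meval0 mul0r.
rewrite {1}(linear_form_sum hp) {2}(linear_form_sum hp) evalv_sum.
elim/big_rec2: _ => [|i a f _ IH]; first exact: differential0.
rewrite differentialD IH evalvZ -mul_mpolyC differentialM C // evalvC X.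
by rewrite mul0r add0r.
Qed.

(** If the square of every linear form vanishing at the support lies in the ideal,
   then so do the products of two such forms, and the tangent space is the whole
   span. *)
Lemma curvilinear_triple_germ : 2 != 0 :> K ->
  zerodim_of_degree Z 3 -> connected_scheme Z -> curvilinear Z ->
  \dim (scheme_span Z) = 3%N ->
  exists E : seq 'rV[K]_m.+1, [/\ size E = 3%N, free E, <<E>>%VS = scheme_span Z &
    has_germ Z E].
Proof.
move=> nz2 Zr conn curv dimU; have [Q QP] := connected_support Zr conn.
have [l hl l1] := exists_form Q.
suff [y [hy y0 nZy]] : exists y, [/\ y \is 1.-homog, evalv y (vpick Q) = 0 & ~ Z (y ^+ 2)].
  exact: (germ_of_scheme (r' := 1) Zr QP dimU hl l1 hy y0 nZy).
apply: contrapT => nex.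
have Zsq p : p \is 1.-homog -> evalv p (vpick Q) = 0 -> Z (p ^+ 2).
  by move=> hp p0; apply: contrapT => nZ; apply: nex; exists p.
have Zpq p q : p \is 1.-homog -> q \is 1.-homog -> evalv p (vpick Q) = 0 ->
    evalv q (vpick Q) = 0 -> Z (p * q).
  move=> hp hq p0 q0.
  have -> : p * q = (2%:R^-1)%:MP * ((p + q) ^+ 2 - p ^+ 2 - q ^+ 2).
    have -> : (p + q) ^+ 2 - p ^+ 2 - q ^+ 2 = 2%:R *: (p * q).
      by rewrite scaler_nat; ring.
    by rewrite mul_mpolyC scalerA mulVf // scale1r.
  apply: idealM; apply: (gidealB idJ (t := 0)); last exact: Zsq.
  apply: (gidealB idJ (t := 0)); last exact: Zsq.
  by apply: Zsq; [rewrite rpredD | rewrite evalvD p0 q0 addr0].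
have [nze _] := point_vpick Q.
suff : (scheme_span Z <= tangent_cone Z Q)%VS.
  move=> /dimvS; rewrite dimU; have := curv Q ((QP Q).2 erefl).
  by rewrite /tangent_dim dim_point; lia.
apply/subvP => w wU; apply/mem_tangent_cone => f v Zf vQ nzv.
have [a def_v] := mem_point vQ.
have v0 p : p \is 1.-homog -> evalv p (vpick Q) = 0 -> evalv p v = 0.
  by move=> hp p0; rewrite def_v evalv_linZ // p0 mulr0.
have homog_v k p : p \is k.-homog -> Z p -> evalv p v = 0.
  by move=> hp Zp; rewrite def_v (evalv_scale _ _ hp) (subscheme_e QP Zp) mulr0.
pose C g := [/\ Z g, evalv g v = 0 & differential g v w = 0].
have C0 : C 0 by split; [apply: ideal0 | rewrite /evalv meval0 | apply: differential0].
have CD g h : C g -> C h -> C (g + h).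
  move=> [Zg g0 dg] [Zh h0 dh]; split; first exact: idealD.
    by rewrite evalvD g0 h0 addr0.
  by rewrite differentialD dg dh addr0.
have CM g h : C h -> C (g * h).
  move=> [Zh h0 dh]; split; first exact: idealM.
    by rewrite evalvM h0 mulr0.
  by rewrite differentialM h0 dh !mulr0 addr0.
have Cl p q : p \is 1.-homog -> q \is 1.-homog ->
    exists2 p', p' \is 1.-homog & C (p * q - l * p').
  move=> hp hq; pose b := evalv p (vpick Q); pose c := evalv q (vpick Q).
  exists (b *: q + c *: p - (b * c) *: l).
    by rewrite rpredB ?rpredD ?dhomogZ.
  have -> : p * q - l * (b *: q + c *: p - (b * c) *: l) = (p - b *: l) * (q - c *: l).
    by rewrite -!mul_mpolyC mpolyCM; ring.
  have hpb : p - b *: l \is 1.-homog by rewrite rpredB ?dhomogZ.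
  have hqc : q - c *: l \is 1.-homog by rewrite rpredB ?dhomogZ.
  have pb0 : evalv (p - b *: l) (vpick Q) = 0 by rewrite evalvB evalvZ l1 mulr1 subrr.
  have qc0 : evalv (q - c *: l) (vpick Q) = 0 by rewrite evalvB evalvZ l1 mulr1 subrr.
  split; first exact: Zpq.
    by rewrite evalvM (v0 _ hpb pb0) mul0r.
  by rewrite differentialM (v0 _ hpb pb0) (v0 _ hqc qc0) mulr0 mul0r addr0.
have dZ k g : g \is k.-homog -> Z g -> differential g v w = 0.
  case: k => [|k] hg Zg.
    have [b def_g] := dhomog0_const hg.
    have := subscheme_e QP Zg; rewrite def_g evalvC => ->; exact: differential0.
  have [p hp Cp] := reduce_to_linear C0 CD CM hl Cl hg.
  have Zp : Z p.
    have nzl : evalv l (vpick Q) != 0 by rewrite l1 oner_eq0.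
    apply: (nonzero_divisor_exp (j := k) Zr QP hl nzl hp).
    by case: Cp => Zgp _ _; have := gidealB idJ (t := 0) Zg Zgp; rewrite opprB addrC subrK.
  have [_ _] : C (g - l ^+ k * p + l ^+ k * p).
    apply: CD Cp (CM _ _ _); split=> //; first exact: homog_v hp Zp.
    by rewrite differential_lin //; apply: form_span hp Zp w wU.
  by rewrite subrK.
have [k def_f] := sum_pihomog f.
rewrite -/(differential f v w) def_f.
elim/big_rec: _ => [|i g _ IH]; first exact: differential0.
by rewrite differentialD IH addr0 (dZ i) ?pihomogP //; apply: ideal_homog.
Qed.

End LowDegree.

(** * Cones and quadrics *)

Section Cones.
Variables (K : closedFieldType) (m : nat).
Implicit Types (f g q : {mpoly K[m.+1]}) (v z : 'rV[K]_m.+1).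

Lemma poly_ext_off0 (p : {poly K}) : (forall s, s != 0 -> p.[s] = 0) -> p = 0.
Proof.
move=> p0; have : p * 'X = 0.
  apply: poly_ext => s; rewrite hornerMX horner0.
  by have [->|/p0->] := eqVneq s 0; rewrite ?mulr0 ?mul0r.
by move/eqP; rewrite mulf_eq0 polyX_eq0 orbF => /eqP.
Qed.

(** The scheme of zeros, with reduced structure, of a nontrivial cone. *)
Section ConeScheme.
Variables (cone : 'rV[K]_m.+1 -> Prop) (v0 : 'rV[K]_m.+1).
Hypothesis coneZ : forall a v, cone v -> cone (a *: v).
Hypotheses (nz_v0 : v0 != 0) (cone_v0 : cone v0).

Definition vanish_cone f := forall v, cone v -> evalv f v = 0.

Lemma vanish_cone0 : vanish_cone 0.
Proof. by move=> v _; rewrite /evalv meval0. Qed.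

Lemma vanish_coneD f g : vanish_cone f -> vanish_cone g -> vanish_cone (f + g).
Proof. by move=> f0 g0 v cv; rewrite evalvD f0 // g0 // addr0. Qed.

Lemma vanish_coneM g f : vanish_cone f -> vanish_cone (g * f).
Proof. by move=> f0 v cv; rewrite evalvM f0 // mulr0. Qed.

(** The homogeneous components of f have as values at v the coefficients of the
   polynomial f(s v) in s. *)
Lemma vanish_cone_homog k f : vanish_cone f -> vanish_cone (pihomog mdeg k f).
Proof.
move=> f0 v cv; pose N := maxn (mmeasure mdeg f) k.+1.
have def_f := @pihomog_partitionE _ _ mdeg N f (leq_maxl _ _).
pose P := \poly_(i < N) evalv (pihomog mdeg i f) v.
suff P0 : P = 0.
  have := congr1 (fun p : {poly K} => p`_k) P0.
  by rewrite coef_poly coef0 leq_maxr.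
apply: poly_ext => s; rewrite horner0 -(f0 _ (coneZ s cv)) [in RHS]def_f evalv_sum horner_poly.
by apply: eq_bigr => i _; rewrite (evalv_scale _ _ (pihomogP _ _ _)) mulrC.
Qed.

Lemma vanish_cone_sat k f :
  (forall u : 'X_{1..m.+1}, mdeg u = k -> vanish_cone ('X_[u] * f)) ->
  vanish_cone f.
Proof.
move=> sat; have f0 v : v != 0 -> cone v -> evalv f v = 0.
  move=> /rV0Pn[i nzi] cv; have du : mdeg (U_(i) *+ k)%MM = k by rewrite mdegMn mdeg1 mul1n.
  have := sat _ du v cv; rewrite evalvM -mpolyXn evalvX {1}/evalv mevalXU => /eqP.
  by rewrite mulf_eq0 expf_eq0 (negPf nzi) andbF => /eqP.
(* The vertex is a limit of other points of the cone. *)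
move=> v cv; have [v00|] := eqVneq v 0; last by move=> nz; apply: f0.
have P0 : along [:: 0; v0] f = 0.
  apply: poly_ext_off0 => s nzs; rewrite horner_along /curve /= big_ord_recl big_ord1 /=.
  rewrite scaler0 add0r expr1 f0 ?scaler_eq0 ?negb_or ?nzs //; exact: coneZ.
by have := @along_coef0 _ _ [:: 0; v0] f isT; rewrite P0 coef0 v00.
Qed.

Definition cone_scheme : subscheme K m :=
  Subscheme vanish_cone0 vanish_coneD vanish_coneM vanish_cone_homog vanish_cone_sat.

Lemma cone_scheme_reduced : reduced_scheme cone_scheme.
Proof.
move=> f k fk v cv; have := fk v cv; rewrite evalvX => /eqP.
by rewrite expf_eq0 => /andP[_ /eqP].
Qed.

End ConeScheme.

Lemma quadratic_polar q a b u v : q \is 2.-homog ->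
  evalv q (a *: u + b *: v) = a ^+ 2 * evalv q u + b ^+ 2 * evalv q v +
    a * b * (evalv q (u + v) - evalv q u - evalv q v).
Proof.
move=> /dhomogS_split[h hh ->]; rewrite !evalv_sum !mulr_sumr -!sumrB mulr_sumr -!big_split.
apply: eq_bigr => i _ /=; rewrite !evalvM !evalv_linD ?dhomogXU // !evalv_linZ ?dhomogXU //.
by ring.
Qed.

Lemma exists_sqrt (a : K) : exists b, b ^+ 2 = a.
Proof.
have /closed_rootP[x /rootP/eqP] : size ('X^2 - a%:P : {poly K}) != 1%N.
  by rewrite size_XnsubC.
by rewrite hornerD hornerN hornerXn hornerC subr_eq0 => /eqP; exists x.
Qed.

(** Completing the square writes q as kappa t^2 - D, with D independent of the
   coordinate t. Dividing by this polynomial, monic in t, leaves r0 + t r1, with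
   r0 and r1 independent of t, and both square roots of D / kappa are
   admissible values of t. *)
Lemma quadric_radical (U : {vspace 'rV[K]_m.+1}) q t (f0 z0 : 'rV[K]_m.+1) kappa :
  2 != 0 :> K -> q \is 2.-homog -> t \is 1.-homog ->
  f0 \in U -> evalv t f0 = 1 -> kappa != 0 ->
  (forall v, v \in U ->
     evalv q v = kappa * evalv t v ^+ 2 + evalv q (v - evalv t v *: f0)) ->
  z0 \in U -> evalv t z0 = 0 -> evalv q z0 != 0 ->
  forall f, (forall v, v \in U -> evalv q v = 0 -> evalv f v = 0) ->
  exists g, forall v, v \in U -> evalv f v = evalv g v * evalv q v.
Proof.
move=> nz2 hq ht f0U tf0 nzk qE z0U tz0 qz0 f fq.
pose M : 'M[K]_m.+1 := 1%:M - (\col_i evalv t (delta_mx 0 i)) *m f0.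
have ME v : v *m M = v - evalv t v *: f0.
  rewrite mulmxBr mulmx1 mulmxA; congr (_ - _).
  have -> : v *m (\col_i evalv t (delta_mx 0 i)) = (evalv t v)%:M.
    apply/rowP => j; rewrite !ord1 !mxE eqxx mulr1n {2}(row_sum_delta v) evalv_lin_sum //.
    by apply: eq_bigr => i _; rewrite evalv_linZ // !mxE.
  by rewrite mul_scalar_mx.
have division k h : h \is k.-homog -> exists g r0 r1 : {mpoly K[m.+1]}, forall v, v \in U ->
    evalv h v = evalv g v * evalv q v + evalv r0 (v *m M) + evalv t v * evalv r1 (v *m M).
  move: k h; apply: dhomog_ind => [k|k h1 h2 _ _ [g [r0 [r1 h1E]]] [g' [r0' [r1' h2E]]]|a|k i h _].
  - by exists 0, 0, 0 => v _; rewrite !evalv0; ring.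
  - exists (g + g'), (r0 + r0'), (r1 + r1') => v vU.
    by rewrite !evalvD h1E // h2E //; ring.
  - by exists 0, a%:MP, 0 => v _; rewrite !evalv0 !evalvC; ring.
  move=> [g [r0 [r1 hE]]]; pose a := evalv 'X_i f0.
  exists ('X_i * g + (a / kappa) *: pullback M r1),
    ('X_i * r0 - (a / kappa) *: (q * r1)), (a *: r0 + 'X_i * r1) => v vU.
  rewrite evalvM hE // !(evalvB, evalvD, evalvZ, evalvM, evalv_pullback).
  have -> : evalv 'X_i (v *m M) = evalv 'X_i v - evalv t v * a.
    by rewrite ME evalv_linB ?dhomogXU // evalv_linZ ?dhomogXU.
  have := qE v vU; rewrite -ME => ->.
  by field.
have {}division : exists g r0 r1 : {mpoly K[m.+1]}, forall v, v \in U ->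
    evalv f v = evalv g v * evalv q v + evalv r0 (v *m M) + evalv t v * evalv r1 (v *m M).
  have [k ->] := sum_pihomog f; elim/big_ind: _ => [|h1 h2|i _].
  - by exists 0, 0, 0 => v _; rewrite !evalv0; ring.
  - move=> [g [r0 [r1 h1E]]] [g' [r0' [r1' h2E]]].
    exists (g + g'), (r0 + r0'), (r1 + r1') => v vU.
    by rewrite !evalvD h1E // h2E //; ring.
  exact: division (pihomogP _ _ _).
have [g [r0 [r1 fE]]] := division; exists g => v vU.
have MU z : z \in U -> z *m M \in U by move=> zU; rewrite ME rpredB ?rpredZ.
have tM z : evalv t (z *m M) = 0 by rewrite ME evalv_linB // evalv_linZ // tf0 mulr1 subrr.
have Mid z : evalv t z = 0 -> z *m M = z by move=> tz; rewrite ME tz scale0r subr0.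
(* The zeros of q above z, with t-coordinates b and - b. *)
have rest z : z \in U -> evalv t z = 0 -> evalv q z != 0 ->
    evalv r0 z = 0 /\ evalv r1 z = 0.
  move=> zU tz qz; have [b b2] := exists_sqrt (- evalv q z / kappa).
  have nzb : b != 0.
    by apply: contraNneq qz => b0; move/eqP: b2; rewrite b0 expr0n eq_sym mulf_eq0 invr_eq0 (negPf nzk) orbF oppr_eq0.
  have root c : c ^+ 2 = b ^+ 2 -> evalv r0 z + c * evalv r1 z = 0.
    move=> c2; pose u := c *: f0 + z; have uU : u \in U by rewrite rpredD ?rpredZ.
    have tu : evalv t u = c by rewrite evalv_linD // evalv_linZ // tf0 tz mulr1 addr0.
    have uM : u *m M = z by rewrite ME tu addrC addKr.
    have qu : evalv q u = 0.
      by rewrite qE // -ME uM tu c2 b2 mulrC divfK // addNr.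
    by have := fE u uU; rewrite fq // qu mulr0 add0r uM tu => <-.
  have r0b := root b erefl; have := root (- b); rewrite sqrrN => /(_ erefl) r0Nb.
  have r00 : evalv r0 z = 0.
    apply: (mulfI nz2); rewrite mulr0 -[RHS](addr0 0) -{1}r0b -r0Nb; ring.
  by split=> //; move/eqP: r0b; rewrite r00 add0r mulf_eq0 (negPf nzb) => /eqP.
(* On the line through z and z0, the form q is not identically zero. *)
have rest0 (h : {mpoly K[m.+1]}) z : z \in U -> evalv t z = 0 ->
    (forall z, z \in U -> evalv t z = 0 -> evalv q z != 0 -> evalv h z = 0) ->
    evalv h z = 0.
  move=> zU tz h0; have prod0 : along [:: z; z0] h * along [:: z; z0] q = 0.
    apply: poly_ext => s; rewrite hornerM !horner_along horner0.
    have cE : curve [:: z; z0] s = z + s *: z0.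
      by rewrite /curve /= big_ord_recl big_ord1 /= scale1r expr1.
    have [->|nzq] := eqVneq (evalv q (curve [:: z; z0] s)) 0; first by rewrite mulr0.
    rewrite h0 ?mul0r // cE ?rpredD ?rpredZ //.
    by rewrite evalv_linD // evalv_linZ // tz tz0 mulr0 addr0.
  have nzq : along [:: z; z0] q != 0.
    apply: contraNneq qz0 => q0; have : along [:: z0; z] q = 0.
      apply: poly_ext_off0 => s nzs; rewrite horner_along.
      have -> : curve [:: z0; z] s = s *: curve [:: z; z0] s^-1.
        rewrite /curve /= !big_ord_recl !big_ord0 /= !addr0 !scale1r !expr1.
        by rewrite scalerDr scalerA mulfV // scale1r addrC.
      by rewrite (evalv_scale _ _ hq) -horner_along q0 horner0 mulr0.
    by move=> q0'; have := @along_coef0 _ _ [:: z0; z] q isT; rewrite q0' coef0 => <-.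
  move/eqP: prod0; rewrite mulf_eq0 (negPf nzq) orbF => /eqP h00.
  by have := @along_coef0 _ _ [:: z; z0] h isT; rewrite h00 coef0.
rewrite fE // (rest0 r0) ?MU // => [|z zU tz qz]; last by case: (rest z).
by rewrite (rest0 r1) ?MU // ?mulr0 ?addr0 // => z zU tz qz; case: (rest z).
Qed.

End Cones.

(** * Conics through a triple germ and a minimal decomposition *)

Section ConicNet.
Variables (K : closedFieldType) (m : nat) (E : seq 'rV[K]_m.+1) (x : nat -> {mpoly K[m.+1]}).
Hypotheses (size_E : size E = 3%N) (hx : forall i, x i \is 1.-homog).
Hypothesis xE : forall i j, (j < 3)%N -> evalv (x i) E`_j = (i == j)%:R.
Implicit Types (a : 'rV[K]_3) (v : 'rV[K]_m.+1).

(** The quadratic forms on the plane of the curve (1 : t : t^2) which vanish to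
   order three at t = 0. *)
Definition conic_net a : {mpoly K[m.+1]} :=
  a 0 0 *: (x 1%N ^+ 2 - x 0%N * x 2%N) + a 0 1 *: (x 1%N * x 2%N) +
  a 0 2 *: (x 2%N ^+ 2).

Definition net_point v : 'rV[K]_3 :=
  \row_i [:: evalv (x 1%N) v ^+ 2 - evalv (x 0%N) v * evalv (x 2%N) v;
             evalv (x 1%N) v * evalv (x 2%N) v; evalv (x 2%N) v ^+ 2]`_i.

Lemma conic_net_homog a : conic_net a \is 2.-homog.
Proof.
have h2 i j : x i * x j \is 2.-homog by apply: (@dhomogM _ _ _ 1 _ 1).
by rewrite !rpredD // dhomogZ // ?rpredB ?expr2.
Qed.

Lemma evalv_conic_net a v :
  evalv (conic_net a) v = \sum_i a 0 i * net_point v 0 i.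
Proof.
rewrite /conic_net !evalvD !evalvZ evalvB !evalvX !evalvM.
rewrite !big_ord_recl big_ord0 addr0 !mxE /= !addrA.
by congr (_ * _ + _ * _ + _ * _); congr (a _ _); apply: val_inj.
Qed.

Lemma along_conic_net a j : (j < 3)%N -> (along E (conic_net a))`_j = 0.
Proof.
have Ex i : (i < 3)%N -> along E (x i) = 'X^i.
  by move=> lt_i; apply: along_dual; rewrite ?size_E // => k lt_k; apply: xE.
move=> lt_j; rewrite !alongD !alongZ alongB !alongXn !alongM !Ex //.
rewrite expr0 mul1r expr1 subrr scaler0 add0r coefD !coefZ -exprS coefXn -exprM coefXn.
by case: j lt_j => [|[|[|j]]] //; rewrite !mulr0 addr0.
Qed.

Lemma evalv_conic_net_e0 a : evalv (conic_net a) E`_0 = 0.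
Proof. by rewrite -along_coef0 ?size_E // along_conic_net. Qed.

Section Conic.
Variables (d : nat) (phi : {mpoly K[m.+1]} -> K) (s : seq 'rV[K]_m.+1).
Hypothesis germ_phi : germ_functional (one_germ E) d.+3 phi.
Hypotheses (dec_phi : decomposes d.+3 phi s) (us : uniq s).
Hypothesis size_s : (size s <= 2 * d.+2 + 1)%N.
Implicit Types w : 'rV[K]_m.+1.

Let freeE : free E.
Proof. by apply: (free_of_dual hx) => i j _; rewrite size_E; apply: xE. Qed.
Let E_gt1 (i : unit) : (1 < size (one_germ E i))%N. Proof. by rewrite /one_germ size_E. Qed.
Let E_gt0 (i : unit) : (0 < size (one_germ E i))%N. Proof. by rewrite /one_germ size_E. Qed.
Let E_dual : dual_forms (one_germ E). Proof. exact: one_germ_dual. Qed.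
Let e := E`_0.

Let nz_e : e != 0. Proof. exact: (germ_pole_neq0 E_gt0 E_dual tt). Qed.

(** Multiplication by h gives a functional on the same germ, in degree one less,
   decomposed by the points off h; the lower bound for their number leaves room for
   two zeros. *)
Let few_zeros h t : h \is 1.-homog -> evalv h e != 0 ->
  uniq t -> {subset t <= s} -> (forall v, v \in t -> evalv h v = 0) ->
  (size t <= 2)%N.
Proof.
move=> hh nzh ut st h0.
have := @one_germ_ge K m.+1 E d _ _ (E_gt0 tt) freeE.
move=> /(_ _ _ (@germ_functional_mul _ _ _ _ E_gt0 1 _ _ _ germ_phi hh (fun=> nzh))
              (decomposes_mul hh dec_phi)).
have := count_uniq_sub (zeros h) ut st.
have : all (zeros h) t by apply/allP => v /h0; rewrite /zeros => ->; rewrite eqxx.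
rewrite all_count => /eqP -> le_t; rewrite size_E size_filter => le_h.
have key (a b t' : nat) : (t' <= a -> 2 * d.+1 < b -> a + b <= 2 * d.+2 + 1 -> t' <= 2)%N.
  by lia.
apply: key le_t le_h _; apply: leq_trans size_s.
by rewrite -(count_predC (zeros h) s).
Qed.

Let off_e v : v \in s -> v \notin <[e]>%VS.
Proof.
have [psi gpsi dec] := decomposes_off_pole E_gt0 E_dual (E_gt1 tt) germ_phi dec_phi.
have := one_germ_ge (E_gt0 tt) freeE gpsi dec.
rewrite size_filter size_E /= => le; have : all (fun v => v \notin <[e]>%VS) s.
  by rewrite all_count eqn_leq count_size (leq_trans size_s) // addn1.
by move/allP => h /h.
Qed.

(** A point with coefficient zero could be removed from s, which has no more points than
   the lower bound. *)
Let decomposition : exists2 c, forall v, v \in s -> c v != 0 &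
  forall f, f \is d.+3.-homog -> phi f = \sum_(v <- s) c v * evalv f v.
Proof.
case: dec_phi => c def_phi; exists c => // v vs; apply/eqP => cv0.
have := @one_germ_ge K m.+1 E d.+1 phi (rem v s) (E_gt0 tt) freeE germ_phi.
rewrite size_rem // size_E /= => H.
have : (2 * d.+2 < (size s).-1)%N.
  apply: H; exists c => f hf; rewrite def_phi // (perm_big _ (perm_to_rem vs)).
  by rewrite big_cons cv0 mul0r; apply: add0r.
by move: size_s; lia.
Qed.

Let line v := <<[:: e; v]>>%VS.

(** By [few_zeros], a hyperplane through three points contains the pole. *)
Let trisecant u v w : u \in s -> v \in s -> w \in s -> uniq [:: u; v; w] ->
  w \in <<[:: u; v]>>%VS -> u \in line w /\ v \in line w.
Proof.
move=> us' vs ws uniq3 wuv.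
have euv : e \in <<[:: u; v]>>%VS.
  apply: contraT => /separating_form[h [hh h0 h1]].
  suff : (size [:: u; v; w] <= 2)%N by [].
  apply: few_zeros hh _ uniq3 _ _; first by rewrite h1 oner_eq0.
    by move=> z; rewrite !inE => /or3P[]/eqP->.
  by move=> z; rewrite !inE => /or3P[]/eqP->; apply: h0 => //; apply: memv_span; rewrite !inE eqxx ?orbT.
have fr : free [:: w; e].
  by rewrite free_cons span_seq1 off_e // seq1_free.
have /eqP eqL : line w == <<[:: u; v]>>%VS.
  rewrite eqEdim; apply/andP; split.
    by apply/span_subvP => z; rewrite !inE => /orP[]/eqP->.
  apply: leq_trans (dim_span _) _; rewrite /line (eq_span (Y := [:: w; e])); last first.
    by move=> z; rewrite !inE orbC.
  by rewrite (eqP fr).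
by split; rewrite eqL; apply: memv_span; rewrite !inE eqxx ?orbT.
Qed.

(** Each point of A is paired with a point b of B. By [trisecant], the line through them
   does not contain q, as b is not on the line from the pole to q. *)
Let cover_pairs q (A B : seq 'rV[K]_m.+1) : q \in s -> size A = size B ->
  (forall v, v \in A -> v \in s /\ v != q) ->
  (forall v, v \in B -> [/\ v \in s, v != q & v \notin line q]) ->
  (forall v, v \in A -> v \notin B) ->
  exists f, [/\ f \is (size A).-homog, evalv f q != 0 &
    forall v, v \in A ++ B -> evalv f v = 0].
Proof.
move=> qs; elim: A B => [|a A IH] [|b B] //=.
  by exists 1; split=> //; [apply: dhomog1 | rewrite /evalv meval1 oner_eq0].
move=> [szAB] As Bs AB; have [v vA|v vB|v vA|f [hf fq fAB]] := IH B szAB.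
- by apply: As; rewrite inE vA orbT.
- by apply: Bs; rewrite inE vB orbT.
- by have := AB v; rewrite !inE vA orbT negb_or => /(_ isT)/andP[].
have [as' aq] := As a (mem_head _ _); have [bs bq bl] := Bs b (mem_head _ _).
have ab : a != b by have := AB a (mem_head _ _); rewrite inE negb_or => /andP[].
have [|h [hh h0 h1]] := @separating_form K m.+1 <<[:: a; b]>>%VS q.
  apply/negP => qab; case/negP: bl.
  by have [|_] := trisecant as' bs qs _ qab; rewrite //= !inE negb_or ab aq bq.
exists (h * f); split; first by apply: (@dhomogM _ _ _ 1).
  by rewrite evalvM h1 mul1r.
move=> v; rewrite inE mem_cat inE => vAB; rewrite evalvM.
have [vab|nv] := boolP (v \in [:: a; b]).
  by rewrite h0 ?mul0r // memv_span.
rewrite fAB ?mulr0 // mem_cat; move: vAB nv; rewrite !inE negb_or.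
by case: (v == a); case: (v == b).
Qed.

(** The product of the conic by d + 1 linear forms, covering the points of R in pairs,
   vanishes on the germ and at all the points of s other than q, so that its value at q
   vanishes too. The pairs can be chosen by [cover_pairs], if at most half of R is on
   the line from the pole to q. *)
Let net_vanish a q R : q \in s -> uniq R -> size R = d.+1.*2 ->
  (forall v, v \in R -> v \in s /\ v != q) ->
  (count (fun v => v \in line q) R <= d.+1)%N ->
  (forall v, v \in s -> v \notin R -> v != q -> evalv (conic_net a) v = 0) ->
  evalv (conic_net a) q = 0.
Proof.
move=> qs uR szR Rs cnt net0.
pose F := [seq v <- R | v \in line q] ++ [seq v <- R | v \notin line q].
have FR v : (v \in F) = (v \in R).
  by rewrite mem_cat !mem_filter -andb_orl orbN.
have uF : uniq F.
  rewrite cat_uniq !filter_uniq // andbT; apply/hasPn => v.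
  by rewrite !mem_filter => /andP[/negPf ->].
have szF : size F = d.+1.*2.
  rewrite -szR; apply/eqP; rewrite eqn_leq !uniq_leq_size // => v; by rewrite FR.
have [|v vA|v|v vA|f [hf fq f0]] := @cover_pairs q (take d.+1 F) (drop d.+1 F) qs.
- by rewrite size_takel ?size_drop szF -addnn ?addnK ?leq_addr.
- by apply: Rs; rewrite -FR; apply: mem_take vA.
- rewrite /F drop_cat size_filter ltnNge cnt /= => /mem_drop.
  by rewrite mem_filter => /andP[vl /Rs[vs vq]].
- apply/negP => vB; move: uF; rewrite -(cat_take_drop d.+1 F) cat_uniq.
  by case/and3P => _ /hasPn/(_ v vB)/negP.
have [c nzc def_phi] := decomposition.
have szT : size (take d.+1 F) = d.+1.
  by rewrite size_takel // szF -addnn leq_addr.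
rewrite szT in hf.
have hg := conic_net_homog a.
have := def_phi _ (dhomogM hg hf).
have [p _ phiE] := germ_phi; rewrite phiE; last exact: (dhomogM hg hf).
rewrite big1 => [|i _]; last first.
  rewrite /one_germ size_E alongM mulrCA mulrC.
  apply: low_coefs_mul (isT : (2 < 3)%N) => j lt_j.
  by rewrite (along_conic_net).
rewrite (bigD1_seq q) //= big_seq_cond big1 => [|v /andP[vs vq]].
  rewrite addr0 evalvM => /esym/eqP; rewrite !mulf_eq0 (negPf (nzc q qs)) (negPf fq) orbF.
  by move/eqP.
rewrite evalvM; have [vR|vR] := boolP (v \in R); last by rewrite net0 // mul0r mulr0.
by rewrite f0 ?mulr0 // cat_take_drop FR.
Qed.

Let span2 u v w : w \in <<[:: u; v]>>%VS -> exists b c, w = b *: u + c *: v.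
Proof.
rewrite span_cons span_seq1 => /memv_addP[_ /vlineP[b ->] [_ /vlineP[c ->] ->]].
by exists b, c.
Qed.

Let dim_line v : v \in s -> \dim (line v) = 2%N.
Proof.
move=> vs; have fr : free [:: v; e] by rewrite free_cons span_seq1 off_e // seq1_free.
rewrite /line (eq_span (Y := [:: v; e])); last by move=> z; rewrite !inE orbC.
by rewrite (eqP fr).
Qed.

Let line_eq v w : v \in s -> w \in s -> v \in line w -> line v = line w.
Proof.
move=> vs ws vw; apply/eqP; rewrite eqEdim !dim_line // leqnn andbT.
apply/span_subvP => z; rewrite !inE => /orP[]/eqP-> //.
by apply: memv_span; rewrite !inE eqxx.
Qed.

(** Otherwise the net has a basis dual to three points q_0, q_1, q_2 of s. By
   [net_vanish], each of the lines from the pole to q_i contains more than half of the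
   other points, so that the three lines coincide; but a conic of the net through q_1
   and q_2 also passes through the pole, and contains this line. The conic is not the
   double line x_2^2 = 0, as phi involves all three coordinates. *)
Lemma exists_conic : exists2 a : 'rV[K]_3, (a 0 0 != 0) || (a 0 1 != 0) &
  forall v, v \in s -> evalv (conic_net a) v = 0.
Proof.
suff [a nza net0] : exists2 a : 'rV[K]_3, a != 0 &
    forall v, v \in s -> evalv (conic_net a) v = 0.
  exists a => //; apply: contraT; rewrite negb_or !negbK => /andP[/eqP a0 /eqP a1].
  have a2 : a 0 2 != 0.
    apply: contraNneq nza => a2; apply/eqP/rowP => i; rewrite !mxE.
    by case: i => -[|[|[|i]]] //= lt_i; [rewrite -a0 | rewrite -a1 | rewrite -a2]; congr (a _ _); apply: val_inj.
  have x2 v : v \in s -> evalv (x 2%N) v = 0.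
    move/net0; rewrite /conic_net a0 a1 !scale0r !add0r evalvZ evalvX => /eqP.
    by rewrite mulf_eq0 (negPf a2) expf_eq0 => /eqP.
  have [c def_phi] := dec_phi.
  have := @germ_functional_concise _ _ _ _ E_gt0 E_dual d.+1 phi (x 2%N) germ_phi (hx 2).
  move=> /(_ _ E`_2) H; have := xE 2 (isT : (2 < 3)%N); rewrite H.
  - by move/eqP; rewrite eq_sym oner_eq0.
  - move=> f hf; rewrite def_phi; last by apply: (@dhomogM _ _ _ 1).
    by rewrite big_seq big1 // => v vs; rewrite evalvM x2 // mul0r mulr0.
  by rewrite (bigD1 tt) //= big1 ?addv0 => [|[]//]; rewrite memv_span // mem_nth ?size_E.
apply: contrapT => nex.
pose row_of (l : {mpoly K[3]}) : 'rV[K]_3 := \row_i evalv l (delta_mx 0 i).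
have rowE l v : l \is 1.-homog -> evalv (conic_net (row_of l)) v = evalv l (net_point v).
  move=> hl; rewrite evalv_conic_net {2}(linear_form_sum hl) evalv_sum.
  by apply: eq_bigr => i _; rewrite mxE evalvZ evalvXU.
have full : <<[seq net_point v | v <- s]>>%VS = fullv.
  apply/eqP; rewrite eqEsubv subvf /=; apply/subvP => u _; apply: contraT.
  move=> /separating_form[l [hl l0 l1]]; case: nex; exists (row_of l).
    apply/eqP => r0; have := l1; rewrite (linear_form_sum hl) evalv_sum big1 => [/eqP|i _].
      by rewrite eq_sym oner_eq0.
    by have := congr1 (fun M : 'rV[K]_3 => M 0 i) r0; rewrite !mxE => ->; rewrite scale0r evalv0.
  by move=> v vs; rewrite rowE // l0 // memv_span // map_f.
have [X [sX fX eX]] := free_subseq [seq net_point v | v <- s].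
have szX : size X = 3%N by rewrite -(eqP fX) eX full dimvf /dim /= mul1n.
have [y yP] := dual_form fX.
have /choice[q qP] (i : 'I_3) : exists v, v \in s /\ net_point v = X`_i.
  by have /sX/mapP[v vs def_v] := mem_nth 0 (leq_trans (ltn_ord i) (eq_leq (esym szX))); exists v.
have qs i : q i \in s by case: (qP i).
pose g (i : 'I_3) := conic_net (row_of (y i)).
have gq (i j : 'I_3) : evalv (g i) (q j) = (i == j)%:R.
  rewrite rowE; last by case: (yP i).
  by have [_ ->] := qP j; rewrite (yP i).2 // szX.
have hg i : g i \is 2.-homog by apply: conic_net_homog.
have q_inj : injective q.
  move=> i j qij; have := gq i j; rewrite -qij gq eqxx.
  by have [//|_ /eqP] := eqVneq i j; rewrite oner_eq0.
pose T := codom q; have uT : uniq T by rewrite /T codomE map_inj_uniq ?enum_uniq.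
pose R := [seq v <- s | v \notin T].
have szR : size R = d.+1.*2.
  have := one_germ_ge (E_gt0 tt) freeE germ_phi dec_phi; rewrite size_E /= => gt.
  have szT : size [seq v <- s | v \in T] = 3%N.
    have -> : size [seq v <- s | v \in T] = size T.
      apply/perm_size/uniq_perm => //; first exact: filter_uniq.
      move=> v; rewrite mem_filter; case: (boolP (v \in T)) => //= /codomP[i ->].
      exact: qs.
    by rewrite size_codom card_ord.
  have e1 : (3 + size R = size s)%N by rewrite -szT !size_filter; apply: count_predC.
  have key (a b : nat) : (2 * d.+2 < b -> b <= 2 * d.+2 + 1 -> 3 + a = b -> a = d.+1.*2)%N.
    by rewrite -addnn; lia.
  exact: key gt size_s e1.
have many i : (d.+1 < count (fun v => v \in line (q i)) R)%N.
  rewrite ltnNge; apply/negP => cnt.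
  have := @net_vanish (row_of (y i)) (q i) R (qs i) (filter_uniq _ us) szR _ cnt.
  rewrite -/(g i) gq eqxx => H; case/eqP: (oner_neq0 K); apply: H.
    move=> v; rewrite mem_filter => /andP[vT vs]; split=> //.
    by apply: contraNneq vT => ->; apply: codom_f.
  move=> v vs; rewrite mem_filter vs andbT negbK => /codomP[j ->] qij.
  by rewrite -/(g i) gq; have [ij|//] := eqVneq i j; case/eqP: qij; rewrite ij.
have same i j : line (q i) = line (q j).
  apply: contrapT => ne.
  have := count_predUI (fun v => v \in line (q i)) (fun v => v \in line (q j)) R.
  have -> : count (predI (fun v => v \in line (q i)) (fun v => v \in line (q j))) R = 0%N.
    apply/eqP; rewrite -leqn0 leqNgt -has_count; apply/hasP => -[v].
    rewrite mem_filter => /andP[_ vs] /andP[/= vi vj]; apply: ne.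
    by rewrite -(line_eq vs (qs i) vi) (line_eq vs (qs j) vj).
  have := count_size (predU (fun v => v \in line (q i)) (fun v => v \in line (q j))) R.
  by rewrite szR addn0 => le1 eq1; move: (many i) (many j) le1; rewrite eq1 -addnn; lia.
have q_line i j : q i \in line (q j).
  by rewrite -(same i j); apply: memv_span; rewrite !inE eqxx orbT.
have fr : free [:: q 2; q 1].
  rewrite free_cons span_seq1 seq1_free; apply/andP; split.
    apply/vlineP => -[b qb]; have := gq 1 2; rewrite qb (evalv_scale _ _ (hg _)) gq eqxx mulr1.
    move/eqP; rewrite expf_eq0 => /eqP b0; have := gq 2 2.
    by rewrite qb b0 scale0r -(scale0r (q 1)) (evalv_scale _ _ (hg _)) expr0n mul0r eqxx => /eqP; rewrite eq_sym oner_eq0.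
  apply: contraNneq (off_e (qs 1)) => ->; exact: mem0v.
have eqL : <<[:: q 2; q 1]>>%VS = line (q 0).
  apply/eqP; rewrite eqEdim dim_line // (eqP fr) leqnn andbT.
  by apply/span_subvP => z; rewrite !inE => /orP[]/eqP->; apply: q_line.
have [b [c def_e]] : exists b c, e = b *: q 2 + c *: q 1.
  by apply: span2; rewrite eqL; apply: memv_span; rewrite !inE eqxx.
have [b' [c' def_q]] : exists b c, q 0 = b *: q 2 + c *: q 1.
  by apply: span2; rewrite eqL; apply: q_line.
have nzb : b != 0.
  apply/eqP => b0; case/negP: (off_e (qs 1)); apply/vlineP; exists c^-1.
  have nzc : c != 0 by apply: contraNneq nz_e => c0; rewrite def_e b0 c0 !scale0r addr0.
  by rewrite def_e b0 scale0r add0r scalerA mulVf // scale1r.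
have nzc : c != 0.
  apply/eqP => c0; case/negP: (off_e (qs 2)); apply/vlineP; exists b^-1.
  by rewrite def_e c0 scale0r addr0 scalerA mulVf // scale1r.
have := evalv_conic_net_e0 (row_of (y (0 : 'I_3))).
rewrite -/(g 0) -/e def_e (quadratic_polar _ _ _ _ (hg 0)) !gq /= !mulr0 !add0r => /eqP.
rewrite !mulf_eq0 (negPf nzb) (negPf nzc) /= => /eqP polar0.
have := gq 0 0; rewrite def_q (quadratic_polar _ _ _ _ (hg 0)) !gq /= polar0 !mulr0 !addr0.
by move/eqP; rewrite eq_sym oner_eq0.
Qed.

End Conic.

Section ConicScheme.
Hypothesis nz2 : 2 != 0 :> K.

(** Such a conic is not a double line: after splitting off a square kappa t^2, a nonzero
   form remains, and [quadric_radical] applies. *)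
Lemma conic_scheme_exists (a : 'rV[K]_3) : (a 0 0 != 0) || (a 0 1 != 0) ->
  exists C : subscheme K m, [/\ conic_in <<E>>%VS C, reduced_scheme C &
    forall f, C f <-> exists g, forall v, v \in <<E>>%VS ->
      evalv f v = evalv g v * evalv (conic_net a) v].
Proof.
move=> nza; have freeE : free E by apply: (free_of_dual hx) => i j _; rewrite size_E; apply: xE.
pose U := <<E>>%VS; pose q := conic_net a.
have hq : q \is 2.-homog by apply: conic_net_homog.
have EU i : (i < 3)%N -> E`_i \in U by move=> lt_i; rewrite memv_span // mem_nth ?size_E.
have nzE0 : E`_0 != 0 by apply: (free_not0 freeE); rewrite mem_nth ?size_E.
have qE v : evalv q v = a 0 0 * (evalv (x 1%N) v ^+ 2 - evalv (x 0%N) v * evalv (x 2%N) v) +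
    a 0 1 * (evalv (x 1%N) v * evalv (x 2%N) v) + a 0 2 * evalv (x 2%N) v ^+ 2.
  by rewrite /q /conic_net !evalvD !evalvZ evalvB !evalvX !evalvM.
have xD i u v : evalv (x i) (u + v) = evalv (x i) u + evalv (x i) v by apply: evalv_linD.
have xZ i c v : evalv (x i) (c *: v) = c * evalv (x i) v by apply: evalv_linZ.
have xB i u v : evalv (x i) (u - v) = evalv (x i) u - evalv (x i) v by apply: evalv_linB.
have [t [f0 [z0 [kappa [ht tf0 f0U nzk [sq [z0U tz0 qz0]]]]]]] : exists t f0 z0 kappa,
    [/\ t \is 1.-homog, evalv t f0 = 1, f0 \in U, kappa != 0 &
        (forall v, evalv q v = kappa * evalv t v ^+ 2 + evalv q (v - evalv t v *: f0)) /\
        [/\ z0 \in U, evalv t z0 = 0 & evalv q z0 != 0]].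
  have [a0|nz0] := eqVneq (a 0 0) 0.
    (* The conic a_1 x_2 (x_1 + b x_2) = 0; t is half of the sum of the factors. *)
    rewrite a0 eqxx /= in nza; pose b := a 0 2 / a 0 1.
    pose t := 2^-1 *: (x 1%N + (b + 1) *: x 2%N).
    have tE v : evalv t v = 2^-1 * (evalv (x 1%N) v + (b + 1) * evalv (x 2%N) v).
      by rewrite evalvZ evalvD evalvZ.
    exists t, (E`_2 + (1 - b) *: E`_1), ((1 + b) *: E`_1 - E`_2), (a 0 1); split=> //.
    - by rewrite dhomogZ // rpredD // dhomogZ.
    - by rewrite tE !xD !xZ !xE //=; field.
    - by rewrite rpredD ?rpredZ ?EU.
    split; first by move=> v; rewrite !qE !tE !xB !xZ !xD !xZ !xE //= a0 /b; field; rewrite nza nz2.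
    split; first by rewrite rpredB ?rpredZ ?EU.
      by rewrite tE !xB !xZ !xE //=; field.
    have -> : evalv q ((1 + b) *: E`_1 - E`_2) = - a 0 1.
      by rewrite qE !xB !xZ !xE //= a0 /b; field.
    by rewrite oppr_eq0.
  (* Completing the square in x_1. *)
  pose b := a 0 1 / (2 * a 0 0); pose t := x 1%N + b *: x 2%N.
  have tE v : evalv t v = evalv (x 1%N) v + b * evalv (x 2%N) v by rewrite evalvD evalvZ.
  pose c := b ^+ 2 - 1 + (a 0 2 - a 0 1 * b) / a 0 0.
  exists t, E`_1, (E`_2 + c *: E`_0 - b *: E`_1), (a 0 0); split=> //.
  - by rewrite rpredD // dhomogZ.
  - by rewrite tE !xE //=; ring.
  - exact: EU.
  split; first by move=> v; rewrite !qE !tE !xB !xZ !xE //= /b; field; rewrite nz2 nz0.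
  split; first by rewrite rpredB ?rpredD ?rpredZ ?EU.
    by rewrite tE !xB !xD !xZ !xE //=; ring.
  have -> // : evalv q (E`_2 + c *: E`_0 - b *: E`_1) = a 0 0.
  by rewrite qE !xB !xD !xZ !xE //= /c /b; field; rewrite nz2 nz0.
pose cone v := v \in U /\ evalv q v = 0.
have coneZ b v : cone v -> cone (b *: v).
  by move=> [vU qv]; split; [rewrite rpredZ | rewrite (evalv_scale _ _ hq) qv mulr0].
have coneE0 : cone E`_0 by split; [apply: EU | apply: evalv_conic_net_e0].
pose C := cone_scheme coneZ nzE0 coneE0.
have CE f : C f <-> forall v, v \in U -> evalv q v = 0 -> evalv f v = 0.
  by split=> [Cf v vU qv|fq v [vU qv]]; [apply: Cf | apply: fq].
have CqE f : C f <-> exists g, forall v, v \in U -> evalv f v = evalv g v * evalv q v.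
  rewrite CE; split=> [|[g fE] v vU qv]; last by rewrite fE // qv mulr0.
  by apply: (quadric_radical nz2 hq ht f0U tf0 nzk _ z0U tz0 qz0) => v _; apply: sq.
exists C; split; [|exact: cone_scheme_reduced|exact: CqE].
by split; [rewrite (eqP freeE) | exists q; split=> //; exists z0].
Qed.

End ConicScheme.

End ConicNet.

(** * Points of the Veronese space as functionals *)

Section Functionals.
Variables (K : closedFieldType) (m d : nat).
Implicit Types (f g : {mpoly K[m.+1]}) (P : point K (vdim m d)) (Z : subscheme K m).

(** A vector of the Veronese ambient space as a linear functional on forms of
   degree d. *)
Definition vfun (p : 'rV[K]_(vdim m d).+1) f : K :=
  \sum_i p 0 i * f@_(vmono i).

Lemma vmono_inj : injective (@vmono m d).
Proof.
move=> i j; rewrite /vmono => /eqP.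
rewrite nth_uniq ?size_monomials ?ltn_ord //; last exact: uniq_basis.
by move/eqP/val_inj.
Qed.

Lemma mdeg_vmono (i : 'I_(vdim m d).+1) : mdeg (vmono i) = d.
Proof. by apply/eqP; rewrite -mem_monomials mem_nth // size_monomials. Qed.

Lemma dhomog_vmono (i : 'I_(vdim m d).+1) : 'X_[vmono i] \is [in K[m.+1], d.-homog].
Proof. by rewrite dhomogX; apply/eqP/mdeg_vmono. Qed.

Lemma vmono_expand f : f \is d.-homog -> f = \sum_(i < (vdim m d).+1) f@_(vmono i) *: 'X_[vmono i].
Proof.
move=> hf; apply/mpolyP => u; rewrite raddf_sum /=.
have [du|ne] := eqVneq (mdeg u) d; last first.
  rewrite (dhomog_nemf_coeff hf ne) big1 // => i _; rewrite mcoeffZ mcoeffX.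
  case: eqP => [eq_u|_]; last exact: mulr0.
  by case/eqP: ne; rewrite -eq_u mdeg_vmono.
have [i <-] := vmono_onto du; rewrite (bigD1 i) //= mcoeffZ mcoeffX eqxx mulr1.
rewrite big1 ?addr0 // => j ji; rewrite mcoeffZ mcoeffX.
by rewrite (inj_eq vmono_inj) (negPf ji) mulr0.
Qed.

Lemma vfun_lin p a f g : vfun p (a *: f + g) = a * vfun p f + vfun p g.
Proof.
rewrite /vfun mulr_sumr -big_split; apply: eq_bigr => i _.
by rewrite mcoeffD mcoeffZ /=; ring.
Qed.

Lemma vfunZ a p f : vfun (a *: p) f = a * vfun p f.
Proof. by rewrite /vfun mulr_sumr; apply: eq_bigr => i _; rewrite mxE mulrA. Qed.

Lemma vfunD p q f : vfun (p + q) f = vfun p f + vfun q f.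
Proof. by rewrite /vfun -big_split; apply: eq_bigr => i _; rewrite mxE mulrDl. Qed.

Lemma vfun0 f : vfun 0 f = 0.
Proof. by rewrite /vfun big1 // => i _; rewrite mxE mul0r. Qed.

Lemma vfunX p i : vfun p 'X_[vmono i] = p 0 i.
Proof.
rewrite /vfun (bigD1 i) //= mcoeffX eqxx mulr1 big1 ?addr0 // => j ji.
by rewrite mcoeffX (inj_eq vmono_inj) eq_sym (negPf ji) mulr0.
Qed.

Lemma vfun_inj p q : (forall f, f \is d.-homog -> vfun p f = vfun q f) -> p = q.
Proof. by move=> pq; apply/rowP => i; rewrite -!vfunX pq ?dhomog_vmono. Qed.

Lemma vfun_veronese v f : f \is d.-homog -> vfun (veronese_vec d v) f = evalv f v.
Proof.
move=> hf; rewrite [in RHS](vmono_expand hf) evalv_sum; apply: eq_bigr => i _.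
by rewrite mxE evalvZ mulrC.
Qed.

Lemma exists_vfun (phi : {mpoly K[m.+1]} -> K) :
  (forall a f g, f \is d.-homog -> g \is d.-homog -> phi (a *: f + g) = a * phi f + phi g) ->
  exists p, forall f, f \is d.-homog -> vfun p f = phi f.
Proof.
move=> lin; exists (\row_i phi 'X_[vmono i]) => f hf.
have phi0 : phi 0 = 0.
  have := lin (-1) 0 0 (dhomog0 _ _ _) (dhomog0 _ _ _).
  by rewrite scaler0 addr0 mulN1r addNr.
rewrite [in RHS](vmono_expand hf) /vfun.
suff [] : phi (\sum_(i < (vdim m d).+1) f@_(vmono i) *: 'X_[vmono i]) =
    \sum_i (\row_(i < (vdim m d).+1) phi 'X_[vmono i]) 0 i * f@_(vmono i) /\
    \sum_(i < (vdim m d).+1) f@_(vmono i) *: 'X_[vmono i] \is d.-homog by [].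
elim/big_rec2: _ => [|i a g _ [IH hg]]; first by split; [| apply: dhomog0].
split; last by rewrite rpredD ?dhomogZ ?dhomog_vmono.
by rewrite lin ?dhomog_vmono // IH mxE mulrC.
Qed.

Lemma point_le (k : nat) (R : point K k) (U : {vspace 'rV[K]_k.+1}) :
  (R <= U)%VS = (vpick R \in U).
Proof. by have [_ {1}->] := point_vpick R; rewrite -memvE. Qed.

(** Linear forms on the Veronese space pull back to forms of degree d. *)
Lemma mem_veronese_span Z P : (P <= scheme_span (veronese_scheme d Z))%VS <->
  forall f, f \is d.-homog -> Z f -> vfun (vpick P) f = 0.
Proof.
rewrite point_le; set p := vpick P.
have pull (c : 'I_(vdim m d).+1 -> K) :
    veronese_pull (\sum_i c i *: 'X_i) = \sum_i c i *: 'X_[vmono i].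
  rewrite /veronese_pull raddf_sum /=; apply: eq_bigr => i _.
  by rewrite comp_mpolyZ comp_mpolyXU -tnth_nth tnth_mktuple.
split=> [/mem_scheme_span pZ f hf Zf|pZ].
  pose l : {mpoly K[(vdim m d).+1]} := \sum_i f@_(vmono i) *: 'X_i.
  have hl : l \is 1.-homog by apply: rpred_sum => i _; rewrite dhomogZ ?dhomogXU.
  have := pZ l _ hl; rewrite /l evalv_sum => <-.
    by apply: eq_bigr => i _; rewrite evalvZ evalvXU mulrC.
  move=> k; have [->|ne] := eqVneq k 1%N.
    by rewrite pihomog_dE // /pull_in pull -(vmono_expand hf).
  by rewrite (pihomog_ne0 _ hl) 1?eq_sym //; apply: pull_in0.
apply/mem_scheme_span => l Zl hl.
have := Zl 1%N; rewrite pihomog_dE // /pull_in {1}(linear_form_sum hl) pull => Zf.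
have hf : \sum_i evalv l (delta_mx 0 i) *: 'X_[vmono i] \is d.-homog.
  by apply: rpred_sum => i _; rewrite dhomogZ ?dhomog_vmono.
rewrite -(pZ _ hf Zf) /vfun {1}(linear_form_sum hl) evalv_sum; apply: eq_bigr => i _.
rewrite evalvZ evalvXU mulrC raddf_sum (bigD1 i) //= mcoeffZ mcoeffX eqxx mulr1.
rewrite big1 ?addr0 // => j ji.
by rewrite mcoeffZ mcoeffX (inj_eq vmono_inj) (negPf ji) mulr0.
Qed.

Lemma span_map_coef (T : eqType) (V : vectType K) (s : seq T) (w : T -> V) v :
  uniq s -> v \in <<[seq w t | t <- s]>>%VS -> exists c, v = \sum_(t <- s) c t *: w t.
Proof.
elim: s v => [|t s IH] v /=.
  by rewrite span_nil memv0 => _ /eqP->; exists (fun=> 0); rewrite big_nil.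
case/andP=> ts us; rewrite span_cons => /memv_addP[_ /vlineP[a ->] [u /(IH _ us)[c ->] ->]].
exists (fun z => if z == t then a else c z); rewrite big_cons eqxx; congr (_ + _).
rewrite [LHS]big_seq [RHS]big_seq; apply: eq_bigr => z zs.
by case: eqP ts => // <-; rewrite zs.
Qed.

Lemma vpick_inj k : injective (fun R : point K k => vpick R).
Proof. by move=> R R' eqR; apply: point_eq; rewrite eqR memv_pick. Qed.

Lemma set_span_image (B : {fset point K m}) :
  set_span [fset veronese d Q | Q in B]%fset =
    <<[seq veronese_vec d (vpick Q) | Q : point K m <- B]>>%VS.
Proof.
apply/eqP; rewrite eqEsubv; apply/andP; split.
  rewrite /set_span big_seq; elim/big_ind: _ => [|U W sU sW|R]; first exact: sub0v.
    by rewrite subv_add sU.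
  case/imfsetP => Q /= QB ->; rewrite -memvE memv_span //.
  by apply/mapP; exists Q.
apply/span_subvP => _ /mapP[Q QB ->]; rewrite memvE /set_span.
have QI : veronese d Q \in [fset veronese d Q | Q in B]%fset by apply: in_imfset.
by rewrite (big_rem _ QI) /=; apply: addvSl.
Qed.

Lemma spanned_byP B P : spanned_by B P <->
  decomposes d (vfun (vpick P)) [seq vpick Q | Q : point K m <- B].
Proof.
rewrite /spanned_by point_le set_span_image; split=> [PB|[c def_P]].
  have [c ->] : exists c, vpick P = \sum_(v <- [seq vpick Q | Q : point K m <- B]) c v *: veronese_vec d v.
    apply: span_map_coef; last by rewrite -map_comp.
    by rewrite map_inj_uniq ?fset_uniq //; apply: vpick_inj.
  exists c => f hf.
  rewrite (big_morph (fun p => vfun p f) (fun p q => vfunD p q f) (vfun0 f)).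
  by apply: eq_bigr => v _; rewrite vfunZ vfun_veronese.
have -> : vpick P = \sum_(v <- [seq vpick Q | Q : point K m <- B]) c v *: veronese_vec d v.
  apply/rowP => i; rewrite -vfunX def_P ?dhomog_vmono // summxE.
  by apply: eq_bigr => v _; rewrite !mxE.
rewrite big_map big_seq; apply: rpred_sum => Q QB.
by apply/rpredZ/memv_span/mapP; exists Q.
Qed.

Lemma spanned_by_seq P s : (forall v, v \in s -> v != 0) ->
  decomposes d (vfun (vpick P)) s ->
  exists2 B, spanned_by B P & (#|` B|%fset <= size s)%N.
Proof.
move=> nzs [c def_P].
have /choice[pt ptP] (v : 'rV[K]_m.+1) : exists Q : point K m, v \in (Q : {vspace _}).
  have [->|nz] := eqVneq v 0; last by exists (point_of nz); apply: memv_line.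
  have nz : delta_mx 0 0 != 0 :> 'rV[K]_m.+1.
    by apply/rV0Pn; exists 0; rewrite mxE !eqxx oner_eq0.
  by exists (point_of nz); apply: mem0v.
exists [fset pt v | v in s]%fset; last first.
  rewrite -(size_map pt s); apply: uniq_leq_size; first exact: fset_uniq.
  by move=> Q /imfsetP[v /= vs ->]; apply: map_f.
rewrite /spanned_by point_le.
have -> : vpick P = \sum_(v <- s) c v *: veronese_vec d v.
  apply/rowP => i; rewrite -vfunX def_P ?dhomog_vmono // summxE.
  by apply: eq_bigr => v _; rewrite !mxE.
rewrite big_seq; apply: rpred_sum => v vs; apply: rpredZ.
have ptB : pt v \in [fset pt v | v in s]%fset by apply: in_imfset.
have [a def_v] := mem_point (ptP v).
rewrite set_span_image def_v veronese_vecZ rpredZ // memv_span //.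
by apply/mapP; exists (pt v).
Qed.

Lemma spanned_by_union B1 B2 (P1 P2 P : point K (vdim m d)) :
  spanned_by B1 P1 -> spanned_by B2 P2 -> (P <= P1 + P2)%VS ->
  spanned_by (B1 `|` B2)%fset P.
Proof.
rewrite /spanned_by => s1 s2 /subv_trans; apply; apply: subv_trans (addvS s1 s2) _.
rewrite !set_span_image subv_add; apply/andP; split; apply: sub_span => v /mapP[Q QB ->].
  by apply/mapP; exists Q; rewrite // inE QB.
by apply/mapP; exists Q; rewrite // inE QB orbT.
Qed.

End Functionals.

(** * Points spanned minimally by germs *)

Section GermSchemes.
Variables (K : closedFieldType) (m : nat) (I : finType) (E : I -> seq 'rV[K]_m.+1).
Hypotheses (E_gt0 : forall i, (0 < size (E i))%N) (E_dual : dual_forms E).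
Implicit Types (f g : {mpoly K[m.+1]}).

Section GermScheme.
Variable r : I -> nat.

Definition vanish_to_order f := forall i j, (j < r i)%N -> (along (E i) f)`_j = 0.

Lemma vanish_to_order0 : vanish_to_order 0.
Proof. by move=> i j _; rewrite along0 coef0. Qed.

Lemma vanish_to_orderD f g : vanish_to_order f -> vanish_to_order g -> vanish_to_order (f + g).
Proof. by move=> f0 g0 i j lt; rewrite alongD coefD f0 // g0 // addr0. Qed.

Lemma vanish_to_orderM g f : vanish_to_order f -> vanish_to_order (g * f).
Proof. by move=> f0 i j lt; rewrite alongM (low_coefs_mul _ (f0 i)). Qed.

Lemma vanish_to_order_sat k f :
  (forall u : 'X_{1..m.+1}, mdeg u = k -> vanish_to_order ('X_[u] * f)) ->
  vanish_to_order f.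
Proof.
move=> sat i; have /rV0Pn[l nzl] := germ_pole_neq0 E_gt0 E_dual i.
have du : mdeg (U_(l) *+ k)%MM = k by rewrite mdegMn mdeg1 mul1n.
have := sat _ du i; rewrite alongM; apply: low_coefs_cancel.
by rewrite along_coef0 // -mpolyXn evalvX evalvXU expf_neq0.
Qed.

(** The union of the germs, the i-th one being truncated at order r i. *)
Definition germ_scheme : subscheme K m :=
  @Subscheme K m (hcore vanish_to_order)
    (hcore0 vanish_to_order0) (hcoreD vanish_to_orderD)
    (hcoreM vanish_to_order0 vanish_to_orderD vanish_to_orderM)
    (hcore_homog vanish_to_order0) (hcore_sat vanish_to_order_sat).

Lemma germ_scheme_homog k f : f \is k.-homog -> germ_scheme f <-> vanish_to_order f.
Proof.
move=> hf; split=> [/(_ k)|f0 l]; first by rewrite pihomog_dE.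
have [->|ne] := eqVneq l k; first by rewrite pihomog_dE.
by rewrite (pihomog_ne0 _ hf) 1?eq_sym //; apply: vanish_to_order0.
Qed.

End GermScheme.

Let full i := size (E i).

(** The monomials along the germs are dual to the coefficients along the germs, and phi
   is determined by its values at these monomials. *)
Lemma functional_of_germs d (phi : {mpoly K[m.+1]} -> K) :
  (forall a f g, f \is d.+1.-homog -> g \is d.+1.-homog ->
     phi (a *: f + g) = a * phi f + phi g) ->
  (forall f, f \is d.+1.-homog -> vanish_to_order full f -> phi f = 0) ->
  exists p : I -> {poly K}, forall f, f \is d.+1.-homog ->
    phi f = \sum_i (p i * along (E i) f)`_(size (E i)).-1.
Proof.
move=> lin phi0.
have [t tP] := germ_monomials E_gt0 E_dual d.
have ht i j : t i j \is d.+1.-homog by case: (tP i j).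
have tE i i' j : (j < size (E i))%N ->
    along (E i') (t i j) = if i == i' then 'X^j else 0.
  by move=> lt_j; case: (tP i j) => _; apply.
pose p i := \poly_(l < size (E i)) phi (t i ((size (E i)).-1 - l)%N).
exists p => f hf.
pose F := \sum_i \sum_(j < size (E i)) (along (E i) f)`_j *: t i j.
have phi_lin (J : Type) (s : seq J) (c : J -> K) (g : J -> {mpoly K[m.+1]}) :
    (forall j, g j \is d.+1.-homog) ->
    phi (\sum_(j <- s) c j *: g j) = \sum_(j <- s) c j * phi (g j).
  move=> hg; have phi00 : phi 0 = 0 by apply: phi0; [apply: dhomog0 | apply: vanish_to_order0].
  elim: s => [|j s IH]; first by rewrite !big_nil.
  by rewrite !big_cons lin ?IH // rpred_sum // => l _; rewrite dhomogZ.
have hF : F \is d.+1.-homog.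
  by apply: rpred_sum => i _; apply: rpred_sum => j _; rewrite dhomogZ.
have phiF : phi F = \sum_i \sum_(j < size (E i)) (along (E i) f)`_j * phi (t i j).
  have -> : F = \sum_i 1 *: (\sum_(j < size (E i)) (along (E i) f)`_j *: t i j).
    by apply: eq_bigr => i _; rewrite scale1r.
  rewrite phi_lin => [|i]; last by apply: rpred_sum => j _; rewrite dhomogZ.
  by apply: eq_bigr => i _; rewrite mul1r phi_lin.
have fF : phi f = phi F.
  have := lin 1 (f - F) F; rewrite scale1r subrK mul1r => -> //; last by rewrite rpredB.
  rewrite phi0 ?add0r ?rpredB // => i j lt_j; rewrite alongB coefB.
  have -> : along (E i) F = \sum_(j < size (E i)) (along (E i) f)`_j *: 'X^j.
    rewrite /F [LHS](big_morph (along (E i)) (alongD _) (along0 _)) (bigD1 i) //=.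
    rewrite [X in _ + X]big1 ?addr0 => [|i' ne].
      rewrite (big_morph (along (E i)) (alongD _) (along0 _)).
      by apply: eq_bigr => l _; rewrite alongZ tE // eqxx.
    rewrite (big_morph (along (E i)) (alongD _) (along0 _)) big1 // => l _.
    by rewrite alongZ tE // (negPf ne) scaler0.
  rewrite [X in _ - X]coef_sum (bigD1 (Ordinal lt_j)) //= coefZ coefXn eqxx mulr1 big1 ?addr0 ?subrr // => l.
  rewrite -val_eqE /= => ne; rewrite coefZ coefXn.
  by rewrite eq_sym (negPf ne) mulr0.
rewrite fF phiF; apply: eq_bigr => i _; rewrite coefMr prednK //.
apply: eq_bigr => j _; rewrite coef_poly mulrC.
rewrite (leq_ltn_trans (leq_subr _ _)) ?prednK // subKn //.
by rewrite -ltnS prednK.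
Qed.

(** If the constant coefficient of p i were zero, P would be spanned by the scheme in which
   the i-th germ is shortened by one. *)
Lemma minimal_germ_functional (Z : subscheme K m) d (P : point K (vdim m d.+1)) :
  (forall k f, f \is k.-homog -> Z f <-> vanish_to_order full f) ->
  spanned_minimally_by Z P -> germ_functional E d.+1 (vfun (vpick P)).
Proof.
move=> ZE [/mem_veronese_span PZ minZ].
have [|f hf /(ZE _ _ hf) Zf|p phiE] := @functional_of_germs d (vfun (vpick P)).
- by move=> a f g _ _; apply: vfun_lin.
- exact: PZ.
exists p => // i; apply/eqP => pi0.
pose r i' := if i' == i then (size (E i')).-1 else size (E i').
case: (minZ (germ_scheme r)).
  split=> [f Zf k|].
    have /(ZE _ _ (pihomogP _ _ _)) fk := ideal_homog k Zf.
    move=> i' j lt_j; apply: fk; move: lt_j; rewrite /r; case: ifP => // _.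
    by move=> lt_j; rewrite (leq_trans lt_j) // leq_pred.
  have lt_i : ((size (E i)).-1 < size (E i))%N by rewrite prednK.
  have [x hx xE] := E_dual lt_i; move=> /(_ x) Zx.
  have /(ZE _ _ hx)/(_ i _ lt_i) : Z x.
    apply: Zx; apply/(germ_scheme_homog r hx) => i' j lt_j; rewrite along_lin //.
    case: ifP => // lt_j'; rewrite xE //; move: lt_j; rewrite /r eq_sym.
    by have [<-|//] := eqVneq i i'; move=> /gtn_eqF ->.
  by rewrite along_lin // lt_i xE // !eqxx => /eqP; rewrite oner_eq0.
apply/mem_veronese_span => f hf /(germ_scheme_homog r hf) f0.
rewrite phiE // big1 // => i' _; rewrite coefM big1 // => -[l lt_l] _ /=.
have [eq_i|ne] := eqVneq i' i; last first.
  rewrite f0 ?mulr0 // /r (negPf ne) (leq_ltn_trans (leq_subr _ _)) //.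
  by rewrite prednK.
case: l lt_l => [|l] lt_l; first by rewrite eq_i pi0 mul0r.
rewrite f0 ?mulr0 // /r eq_i eqxx ltn_subrL /=; rewrite eq_i in lt_l.
exact: leq_ltn_trans (leq0n l) lt_l.
Qed.

Lemma germ_functional_linear d phi a f g : germ_functional E d phi ->
  f \is d.-homog -> g \is d.-homog -> phi (a *: f + g) = a * phi f + phi g.
Proof.
move=> [p _ phiE] hf hg; rewrite !phiE ?rpredD ?dhomogZ // mulr_sumr -big_split.
apply: eq_bigr => i _; rewrite alongD alongZ mulrDr coefD -scalerAr coefZ.
by [].
Qed.

End GermSchemes.

Lemma one_germP (K : closedFieldType) n d (E : seq 'rV[K]_n) (phi : {mpoly K[n]} -> K) :
  germ_functional (one_germ E) d phi <->
  exists2 p : {poly K}, p`_0 != 0 & forall f, f \is d.-homog ->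
    phi f = (p * along E f)`_(size E).-1.
Proof.
split=> [[p p0 phiE]|[p p0 phiE]].
  by exists (p tt) => // f hf; rewrite phiE // (bigD1 tt) //= big1 ?addr0 // => -[].
by exists (fun=> p) => // f hf; rewrite phiE // (bigD1 tt) //= big1 ?addr0 // => -[].
Qed.

Section OneGerm.
Variables (K : closedFieldType) (m d : nat) (E : seq 'rV[K]_m.+1).
Hypotheses (E_gt1 : (1 < size E)%N) (freeE : free E).
Let E_gt0 (i : unit) : (0 < size (one_germ E i))%N. Proof. exact: ltnW. Qed.
Let E_dual := one_germ_dual freeE.
Implicit Types (P : point K (vdim m d.+2)).

(** By the lower bound, the empty set does not decompose phi, which is thus nonzero. *)
Lemma exists_germ_point phi : germ_functional (one_germ E) d.+2 phi ->
  exists P, exists2 a, a != 0 & forall f, f \is d.+2.-homog ->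
    vfun (vpick P) f = a * phi f.
Proof.
move=> gphi; have [p pE] := exists_vfun (fun a f g => germ_functional_linear a gphi).
have nzp : p != 0.
  apply/eqP => p0; have := @one_germ_ge _ _ E d phi [::] (ltnW E_gt1) freeE gphi.
  rewrite ltn0; case/(_ _)/negP => //; exists (fun=> 0) => f hf.
  by rewrite -pE // p0 vfun0 big_nil.
exists (point_of nzp); have [nz _] := point_vpick (point_of nzp).
have /vlineP[a def_p] : vpick (point_of nzp) \in <[p]>%VS by apply: memv_pick.
exists a; first by apply: contraNneq nz => a0; rewrite def_p a0 scale0r.
by move=> f hf; rewrite def_p vfunZ pE.
Qed.

Hypothesis charK0 : [pchar K] =i pred0.

Lemma one_germ_spanned P : germ_functional (one_germ E) d.+2 (vfun (vpick P)) ->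
  exists2 B, spanned_by B P & (#|` B|%fset <= ((size E).-1 * d.+1).+1)%N.
Proof.
move=> gP; have [s [<- nzs dec]] := germ_decomposition_exists charK0 E_gt1 freeE gP.
exact: spanned_by_seq nzs dec.
Qed.

Lemma one_germ_card P B : germ_functional (one_germ E) d.+2 (vfun (vpick P)) ->
  spanned_by B P -> ((size E).-1 * d.+1 < #|` B|%fset)%N.
Proof.
move=> gP /spanned_byP dec.
by have := one_germ_ge (ltnW E_gt1) freeE gP dec; rewrite size_map.
Qed.

Lemma one_germ_rank P : germ_functional (one_germ E) d.+2 (vfun (vpick P)) ->
  rank P = ((size E).-1 * d.+1).+1.
Proof.
move=> gP; have [B PB leB] := one_germ_spanned gP.
apply/eqP; rewrite eqn_leq (leq_trans (rank_le PB) leB).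
by have [B' <- /(one_germ_card gP)] := rank_attained PB.
Qed.

(** Otherwise a combination of the two functionals, still spanned minimally by the germ,
   is decomposed by B with one point removed. *)
Lemma germ_point_unique (Z : subscheme K m) P P' (B : {fset point K m}) :
  has_germ Z E ->
  germ_functional (one_germ E) d.+2 (vfun (vpick P)) ->
  #|` B|%fset = ((size E).-1 * d.+1).+1 ->
  spanned_by B P -> spanned_by B P' -> (P' <= scheme_span (veronese_scheme d.+2 Z))%VS ->
  P' = P.
Proof.
move=> ZE gP cardB /spanned_byP[c PE] /spanned_byP[c' P'E] /mem_veronese_span P'Z.
set s := [seq vpick Q | Q : point K m <- B] in PE P'E.
have us : uniq s by rewrite map_inj_uniq ?fset_uniq //; apply: vpick_inj.
have szs : size s = ((size E).-1 * d.+1).+1 by rewrite size_map.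
have [p p0 phiE] := (one_germP d.+2 E _).1 gP.
have [|f hf f0|p' phi'E] := @functional_of_germs K m _ _ E_gt0 E_dual d.+1 (vfun (vpick P')).
- by move=> a f g _ _; apply: vfun_lin.
- by apply: P'Z => //; apply/(ZE _ _ hf) => j lt_j; apply: (f0 tt).
have {}phi'E f : f \is d.+2.-homog -> vfun (vpick P') f = (p' tt * along E f)`_(size E).-1.
  by move=> hf; rewrite phi'E // (bigD1 tt) //= big1 ?addr0 // => -[].
pose a := (p' tt)`_0 / p`_0.
have cc v : v \in s -> c' v = a * c v.
  move=> vs; apply: contrapT => /eqP; rewrite -subr_eq0 => nzv.
  (* The coefficient of v in P + k (P' - a P) is zero, for the ratio a of the constant
     coefficients of the two polynomials, and the constant coefficient is that of P. *)
  pose k := - c v / (c' v - a * c v).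
  pose phi f := vfun (vpick P) f + k * (vfun (vpick P') f - a * vfun (vpick P) f).
  have gphi : germ_functional (one_germ E) d.+2 phi.
    apply/one_germP; exists (p + k *: (p' tt - a *: p)).
      by rewrite coefD coefZ coefB coefZ divfK // subrr mulr0 addr0.
    move=> f hf; rewrite /phi phiE // phi'E // mulrDl coefD -scalerAl coefZ.
    by rewrite mulrBl coefB -scalerAl coefZ.
  have := @one_germ_ge _ _ E d phi (rem v s) (ltnW E_gt1) freeE gphi.
  rewrite size_rem // szs ltnn => /(_ _)/negP; case=> //.
  exists (fun u => c u + k * (c' u - a * c u)) => f hf.
  rewrite /phi PE // P'E // mulr_sumr -sumrB mulr_sumr -big_split /=.
  rewrite (perm_big _ (perm_to_rem vs)) big_cons /=.
  rewrite [X in X + _](_ : _ = 0); last by rewrite /k; field.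
  by rewrite add0r; apply: eq_bigr => u _; ring.
have def_P' : vpick P' = a *: vpick P.
  apply: (@vfun_inj K m d.+2) => f hf; rewrite vfunZ PE // P'E // mulr_sumr.
  rewrite big_seq [RHS]big_seq; apply: eq_bigr => v vs.
  by rewrite cc // mulrA.
by apply: point_eq; rewrite def_P' rpredZ // memv_pick.
Qed.

End OneGerm.

(** * The union of a triple and a double germ *)

Section Supports.
Variables (K : closedFieldType) (m : nat).
Implicit Types (Z W : subscheme K m) (f : {mpoly K[m.+1]}) (Q : point K m).

Lemma supp_homog Z Q : supp Z Q <->
  forall k f, f \is k.-homog -> Z f -> evalv f (vpick Q) = 0.
Proof.
split=> [ZQ k f hf Zf|ZQ f Zf]; first exact/(vanishes_homog Q hf)/ZQ.
have [k def_f] := sum_pihomog f => v vQ nzv; rewrite def_f evalv_sum big1 // => i _.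
have hi : pihomog mdeg i f \is i.-homog by apply: pihomogP.
apply: ((vanishes_homog Q hi).2 _ v vQ nzv); apply: ZQ hi _.
exact: ideal_homog.
Qed.

(** A product of elements of the two ideals, one from each, lies in both. *)
Lemma supp_union Z W Q : supp (union Z W) Q -> supp Z Q \/ supp W Q.
Proof.
move=> /supp_homog ZWQ; apply: contrapT => /not_orP[nZ nW].
have [k [f [hf Zf nzf]]] : exists k f, [/\ f \is k.-homog, Z f & evalv f (vpick Q) != 0].
  apply: contrapT => nex; apply: nZ; apply/supp_homog => k f hf Zf.
  by apply: contrapT => /eqP nzf; apply: nex; exists k, f.
have [l [g [hg Wg nzg]]] : exists k f, [/\ f \is k.-homog, W f & evalv f (vpick Q) != 0].
  apply: contrapT => nex; apply: nW; apply/supp_homog => l g hg Wg.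
  by apply: contrapT => /eqP nzg; apply: nex; exists l, g.
have Zfg : union Z W (f * g) by split; [rewrite mulrC; apply: idealM | apply: idealM].
have /eqP := ZWQ _ _ (dhomogM hf hg) Zfg.
by rewrite evalvM mulf_eq0 (negPf nzf) (negPf nzg).
Qed.

(** The linear forms vanishing on E and, for j > 0, the powers x_j^r of the coordinates
   along the germ lie in the ideal. *)
Lemma germ_support Z (E : seq 'rV[K]_m.+1) Q : (0 < size E)%N -> free E ->
  has_germ Z E ->
  supp Z Q -> vpick Q \in <[E`_0]>%VS.
Proof.
move=> E0 fE ZE /supp_homog ZQ; set v := vpick Q in ZQ *.
have vE : v \in <<E>>%VS.
  apply: contraT => /separating_form[l [hl l0 l1]].
  have : evalv l v = 0.
    apply: ZQ (hl) _; apply/(ZE _ _ hl) => j lt_j.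
    by rewrite along_lin // lt_j l0 // memv_span // mem_nth.
  by rewrite l1 => /eqP; rewrite oner_eq0.
have [x xP] := dual_form fE.
have xv j : (0 < j < size E)%N -> evalv (x j) v = 0.
  case/andP=> j0 lt_j; have [hx xE] := xP j.
  suff : evalv (x j ^+ size E) v = 0.
    by rewrite evalvX => /eqP; rewrite expf_eq0 => /andP[_ /eqP].
  have hxx := dhomog_lin_exp (size E) hx.
  apply: ZQ (hxx) _; apply/(ZE _ _ hxx) => i lt_i.
  rewrite alongXn (along_dual hx lt_j xE) -exprM coefXn.
  by rewrite ltn_eqF // (leq_trans lt_i) // leq_pmull.
apply/vlineP; exists (evalv (x 0%N) v); rewrite {1}(dual_form_expand xP vE).
rewrite (bigD1 (Ordinal E0)) //= big1 ?addr0 // => i.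
by rewrite -val_eqE /= -lt0n => i0; rewrite xv ?scale0r // i0 ltn_ord.
Qed.

End Supports.

Section Component.
Variables (K : closedFieldType) (m d : nat) (E : seq 'rV[K]_m.+1) (Z : subscheme K m).
Hypothesis charK0 : [pchar K] =i pred0.
Hypotheses (E_gt1 : (1 < size E)%N) (freeE : free E).
Hypothesis ZE : has_germ Z E.
Variables (P : point K (vdim m d.+2)) (B : {fset point K m}).
Hypotheses (germP : germ_functional (one_germ E) d.+2 (vfun (vpick P))) (PB : spanned_by B P).

Lemma evinces_unique : #|` B|%fset = ((size E).-1 * d.+1).+1 ->
  exists! P1 : point K (vdim m d.+2), (P1 <= scheme_span (veronese_scheme d.+2 Z))%VS /\ evinces_rank P1 B.
Proof.
move=> cardB; exists P; split=> [|P' [P'Z [P'B _]]].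
  split; last by split=> //; rewrite cardB (one_germ_rank E_gt1 freeE charK0 germP).
  have [p _ phiE] := (one_germP d.+2 E _).1 germP.
  apply/mem_veronese_span => f hf /(ZE hf) f0.
  by rewrite phiE // (low_coefs_mul _ f0) // ltn_predL ltnW.
by apply/esym; apply: (germ_point_unique E_gt1 freeE ZE germP cardB PB P'B P'Z).
Qed.

End Component.

Section ConicThrough.
Variables (K : closedFieldType) (m d : nat) (E : seq 'rV[K]_m.+1) (Z : subscheme K m).
Hypotheses (size_E : size E = 3%N) (freeE : free E) (span_E : <<E>>%VS = scheme_span Z).
Hypothesis nz2 : 2 != 0 :> K.
Hypothesis ZE : has_germ Z E.

(** The restriction to the germ of the equation of a conic of the net vanishes to order
   three, so that the conic contains Z. *)
Lemma conic_through phi (B : {fset point K m}) : germ_functional (one_germ E) d.+3 phi ->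
  decomposes d.+3 phi [seq vpick Q | Q : point K m <- B] ->
  uniq [seq vpick Q | Q : point K m <- B] ->
  (forall v, v \in [seq vpick Q | Q : point K m <- B] -> v \in scheme_span Z) ->
  (size [seq vpick Q | Q : point K m <- B] <= 2 * d.+2 + 1)%N ->
  exists C : subscheme K m, [/\ conic_in (scheme_span Z) C, reduced_scheme C
    & subscheme_le (union Z (reduced_set B)) C].
Proof.
move=> gphi dec us sZ sizeB; have [x xP] := dual_form freeE.
have hx i : x i \is 1.-homog by case: (xP i).
have xE i j : (j < 3)%N -> evalv (x i) E`_j = (i == j)%:R.
  by rewrite -size_E; case: (xP i) => _; apply.
have [a nza net0] := exists_conic size_E hx xE gphi dec us sizeB.
have [C [conicC redC CE]] := conic_scheme_exists size_E hx xE nz2 nza.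
exists C; rewrite -span_E; split=> // f Cf.
have Ck k : exists g, forall v, v \in <<E>>%VS ->
    evalv (pihomog mdeg k f) v = evalv g v * evalv (conic_net x a) v.
  by apply/CE; apply: ideal_homog.
split.
  have [n ->] := sum_pihomog f; elim/big_ind: _ => [|g h|k _]; [exact: ideal0|exact: idealD|].
  apply/(ZE (pihomogP _ _ _)) => j; have [g fgq] := Ck k.
  have -> : along E (pihomog mdeg k f) = along E g * along E (conic_net x a).
    apply: poly_ext => z; rewrite hornerM !horner_along fgq //.
    by apply: rpred_sum => i _; rewrite rpredZ // memv_span // mem_nth.
  by apply: low_coefs_mul => i; rewrite size_E => /(along_conic_net size_E hx xE).
move=> k Q QB; apply/(vanishes_homog Q (pihomogP _ _ _)); have [g fgq] := Ck k.
have vQ : vpick Q \in [seq vpick Q | Q : point K m <- B] by apply/mapP; exists Q.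
by rewrite fgq ?net0 ?mulr0 // span_E sZ.
Qed.

End ConicThrough.

Section TwoGerms.
Variables (K : closedFieldType) (d : nat) (A1 A2 : subscheme K 4) (E1 E2 : seq 'rV[K]_5).
Hypothesis charK0 : [pchar K] =i pred0.
Hypotheses (size_E1 : size E1 = 3%N) (size_E2 : size E2 = 2%N).
Hypothesis freeE : free (E1 ++ E2).
Hypotheses (span_E1 : <<E1>>%VS = scheme_span A1) (span_E2 : <<E2>>%VS = scheme_span A2).
Hypothesis A1E : has_germ A1 E1.
Hypothesis A2E : has_germ A2 E2.
Implicit Types (P R : point K (vdim 4 d.+3)) (B : {fset point K 4}) (Q : point K 4).

Let E1_gt1 : (1 < size E1)%N. Proof. by rewrite size_E1. Qed.
Let E2_gt1 : (1 < size E2)%N. Proof. by rewrite size_E2. Qed.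
Let freeE1 : free E1. Proof. by move: freeE; rewrite cat_free => /and3P[]. Qed.
Let freeE2 : free E2. Proof. by move: freeE; rewrite cat_free => /and3P[]. Qed.
Let capE : (<<E1>> :&: <<E2>>)%VS = 0%VS.
Proof. by move: freeE; rewrite cat_free => /and3P[_ _ /directv_addP]. Qed.
Let nz2 : 2 != 0 :> K. Proof. exact: (natf_neq0 charK0 (k := 2)). Qed.

Let two_gt0 i : (0 < size (two_germs E1 E2 i))%N.
Proof. by case: i; rewrite /= ?size_E1 ?size_E2. Qed.
Let two_dual := two_germs_dual freeE.

Lemma union_minimal P : spanned_minimally_by (union A1 A2) P ->
  germ_functional (two_germs E1 E2) d.+3 (vfun (vpick P)).
Proof.
apply: (minimal_germ_functional two_gt0 two_dual) => k f hf.
split=> [[/(A1E hf) f1 /(A2E hf) f2] [] j|f0]; first exact: f1; first exact: f2.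
split; first by apply/(A1E hf) => j; apply: (f0 true).
by apply/(A2E hf) => j; apply: (f0 false).
Qed.

Lemma germ_minimal (Z : subscheme K 4) (E : seq 'rV[K]_5) P : (0 < size E)%N -> free E ->
  has_germ Z E ->
  spanned_minimally_by Z P -> germ_functional (one_germ E) d.+3 (vfun (vpick P)).
Proof.
move=> E0 fE ZE; apply: (minimal_germ_functional (fun=> E0) (one_germ_dual fE)) => k f hf.
split=> [/(ZE _ _ hf) f0 i|f0]; first exact: f0.
by apply/(ZE _ _ hf) => j; apply: (f0 tt).
Qed.

Lemma two_germs_card_ge P B : germ_functional (two_germs E1 E2) d.+3 (vfun (vpick P)) ->
  spanned_by B P -> (3 * d.+2 + 2 <= #|` B|%fset)%N.
Proof.
move=> gP /spanned_byP dec.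
have := two_germs_ge (two_gt0 true) (two_gt0 false) freeE gP dec.
by rewrite size_E1 size_E2 size_map.
Qed.

Lemma two_germs_combination a b phi1 phi2 phi : a != 0 -> b != 0 ->
  germ_functional (one_germ E1) d.+3 phi1 -> germ_functional (one_germ E2) d.+3 phi2 ->
  (forall f, f \is d.+3.-homog -> phi f = a * phi1 f + b * phi2 f) ->
  germ_functional (two_germs E1 E2) d.+3 phi.
Proof.
move=> nza nzb /one_germP[p p0 p1E] /one_germP[q q0 p2E] phiE.
exists (fun i => if i then a *: p else b *: q) => [[]|f hf].
- by rewrite coefZ mulf_neq0.
- by rewrite coefZ mulf_neq0.
by rewrite phiE // p1E // p2E // big_bool /= -!scalerAl !coefZ.
Qed.

Lemma germ_points P : germ_functional (two_germs E1 E2) d.+3 (vfun (vpick P)) ->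
  exists P1 P2 (p1 p2 : {poly K}) (a1 a2 : K),
    [/\ germ_functional (one_germ E1) d.+3 (vfun (vpick P1)),
        germ_functional (one_germ E2) d.+3 (vfun (vpick P2)),
        forall f, f \is d.+3.-homog -> vfun (vpick P1) f = a1 * (p1 * along E1 f)`_(size E1).-1,
        forall f, f \is d.+3.-homog -> vfun (vpick P2) f = a2 * (p2 * along E2 f)`_(size E2).-1 &
        (P <= P1 + P2)%VS /\ forall f, f \is d.+3.-homog -> vfun (vpick P) f =
          (p1 * along E1 f)`_(size E1).-1 + (p2 * along E2 f)`_(size E2).-1].
Proof.
move=> [p p0 phiE].
have point E (q : {poly K}) : (1 < size E)%N -> free E -> q`_0 != 0 -> exists R : point K (vdim 4 d.+3),
    exists2 a : K, a != 0 & germ_functional (one_germ E) d.+3 (vfun (vpick R)) /\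
      forall f, f \is d.+3.-homog -> vfun (vpick R) f = a * (q * along E f)`_(size E).-1.
  move=> E_gt1 fE q0.
  have gq : germ_functional (one_germ E) d.+3 (fun f => (q * along E f)`_(size E).-1).
    by apply/one_germP; exists q.
  have [R [a nza RE]] := exists_germ_point E_gt1 fE gq; exists R, a => //; split=> //.
  apply/one_germP; exists (a *: q) => [|f hf]; first by rewrite coefZ mulf_neq0.
  by rewrite RE // -scalerAl coefZ.
have [P1 [a1 nza1 [g1 P1E]]] := point E1 _ E1_gt1 freeE1 (p0 true).
have [P2 [a2 nza2 [g2 P2E]]] := point E2 _ E2_gt1 freeE2 (p0 false).
have PE f : f \is d.+3.-homog -> vfun (vpick P) f =
    (p true * along E1 f)`_(size E1).-1 + (p false * along E2 f)`_(size E2).-1.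
  by move=> hf; rewrite phiE // big_bool.
exists P1, P2, (p true), (p false), a1, a2; split=> //; split=> //.
rewrite point_le; have -> : vpick P = a1^-1 *: vpick P1 + a2^-1 *: vpick P2.
  apply: (@vfun_inj K 4 d.+3) => f hf; rewrite vfunD !vfunZ P1E // P2E // PE //.
  by rewrite !mulKf.
by rewrite memv_add // rpredZ // memv_pick.
Qed.

Lemma two_germs_rank P : germ_functional (two_germs E1 E2) d.+3 (vfun (vpick P)) ->
  rank P = (3 * d.+2 + 2)%N.
Proof.
move=> gP; have [P1 [P2 [p1 [p2 [a1 [a2 [g1 g2 _ _ [PP _]]]]]]]] := germ_points gP.
have [B1 PB1 le1] := one_germ_spanned E1_gt1 freeE1 charK0 g1.
have [B2 PB2 le2] := one_germ_spanned E2_gt1 freeE2 charK0 g2.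
have PB := spanned_by_union PB1 PB2 PP.
apply/eqP; rewrite eqn_leq; apply/andP; split.
  apply: leq_trans (rank_le PB) _; rewrite cardfsU; apply: leq_trans (leq_subr _ _) _.
  by move: le1 le2; rewrite size_E1 size_E2 /=; lia.
by have [B <- /(two_germs_card_ge gP)] := rank_attained PB.
Qed.

Let disj_spans Q : (Q <= scheme_span A1)%VS -> (Q <= scheme_span A2)%VS -> False.
Proof.
move=> Q1 Q2; have [nz _] := point_vpick Q; case/eqP: nz; apply/eqP; rewrite -memv0 -capE.
by rewrite memv_cap span_E1 span_E2 -!point_le Q1.
Qed.

Let in_span (A : subscheme K 4) B := [fset Q in B | (Q <= scheme_span A)%VS]%fset.

(** By [two_germs_split], each point lies on one of the two spans, and the projections
   to the spans separate the functional. The lower bounds for the two parts of B add up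
   to the rank, so that they are both attained. *)
Lemma sort_decomposition P B : germ_functional (two_germs E1 E2) d.+3 (vfun (vpick P)) ->
  evinces_rank P B ->
  rank_decomposition d.+3 A1 A2 B (in_span A1 B) (in_span A2 B) /\
  exists C : subscheme K 4, [/\ conic_in (scheme_span A1) C, reduced_scheme C
             & subscheme_le (union A1 (reduced_set (in_span A1 B))) C].
Proof.
move=> gP [/spanned_byP decB cardB]; rewrite two_germs_rank // in cardB.
set B1 := in_span A1 B; set B2 := in_span A2 B.
pose vs (X : {fset point K 4}) := [seq vpick Q | Q : point K 4 <- X].
have Bsplit Q : Q \in B -> (Q \in B1) || (Q \in B2).
  move=> QB.
  have vQ : vpick Q \in vs B by apply/mapP; exists Q.
  have sizeE : (size E1 + size E2 = 5)%N by rewrite size_E1 size_E2.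
  have sizeB : (size (vs B) <= 3 * d.+2 + 2)%N by rewrite size_map cardB.
  have [vE|vE] := two_germs_split E1_gt1 E2_gt1 sizeE freeE gP decB sizeB vQ.
    by rewrite !inE QB /= point_le -span_E1 vE.
  by rewrite !inE QB /= orbC point_le -span_E2 vE.
have disj Q : Q \in B1 -> Q \in B2 -> False.
  by rewrite !inE => /andP[_ Q1] /andP[_ Q2]; apply: disj_spans Q1 Q2.
have defB : B = (B1 `|` B2)%fset.
  apply/fsetP => Q; rewrite in_fsetU; apply/idP/idP => [/Bsplit //|].
  by rewrite !inE => /orP[]/andP[].
have capB : (B1 `&` B2 = fset0)%fset.
  apply/fsetP => Q; rewrite in_fsetI inE; apply/negP => /andP[]; exact: disj.
have permB : perm_eq (vs B) (vs B1 ++ vs B2).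
  rewrite -map_cat perm_map //; apply: uniq_perm; first exact: fset_uniq.
    rewrite cat_uniq !fset_uniq andbT /=; apply/hasPn => Q Q2; apply/negP => Q1.
    exact: disj Q1 Q2.
  by move=> Q; rewrite mem_cat {1}defB in_fsetU.
have uvs X : uniq (vs X) by rewrite map_inj_uniq ?fset_uniq //; apply: vpick_inj.
have vsE (A : subscheme K 4) v : v \in vs (in_span A B) -> v \in scheme_span A.
  by case/mapP => Q; rewrite !inE => /andP[_ QA] ->; rewrite -point_le.
have [P1 [P2 [p1 [p2 [a1 [a2 [g1 g2 P1E P2E [_ PE]]]]]]]] := germ_points gP.
have [c decE] := decB.
have eq_dec f : f \is d.+3.-homog ->
    (p1 * along E1 f)`_(size E1).-1 + (p2 * along E2 f)`_(size E2).-1 =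
    \sum_(v <- vs B1) c v * evalv f v + \sum_(v <- vs B2) c v * evalv f v.
  by move=> hf; rewrite -PE // decE // (perm_big _ permB) big_cat.
have dec1 := decomposition_component capE _ _ eq_dec.
have dec2 : forall f, f \is d.+3.-homog ->
    (p2 * along E2 f)`_(size E2).-1 = \sum_(v <- vs B2) c v * evalv f v.
  apply: (@decomposition_component _ _ E2 E1 d.+2 p2 p1 _ (vs B1)) => [|v|v|f hf].
  - by rewrite capvC.
  - by rewrite span_E2; apply: vsE.
  - by rewrite span_E1; apply: vsE.
  by rewrite addrC eq_dec // addrC.
have {}dec1 : forall f, f \is d.+3.-homog ->
    (p1 * along E1 f)`_(size E1).-1 = \sum_(v <- vs B1) c v * evalv f v.
  by apply: dec1 => v; rewrite ?span_E1 ?span_E2; apply: vsE.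
have spanned (E : seq 'rV[K]_5) (p : {poly K}) (a : K) (R : point K (vdim 4 d.+3)) X :
    (forall f, f \is d.+3.-homog -> vfun (vpick R) f = a * (p * along E f)`_(size E).-1) ->
    (forall f, f \is d.+3.-homog ->
      (p * along E f)`_(size E).-1 = \sum_(v <- vs X) c v * evalv f v) ->
    spanned_by X R.
  move=> RE dec; apply/spanned_byP; exists (fun v => a * c v) => f hf.
  by rewrite RE // dec // mulr_sumr; apply: eq_bigr => v _; rewrite mulrA.
have PB1 := spanned _ _ _ _ _ P1E dec1; have PB2 := spanned _ _ _ _ _ P2E dec2.
have le1 := one_germ_card E1_gt1 freeE1 g1 PB1.
have le2 := one_germ_card E2_gt1 freeE2 g2 PB2.
have cardB12 : (#|` B1| + #|` B2| = 3 * d.+2 + 2)%N.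
  by rewrite -cardfsUI -defB capB cardfs0 addn0.
have cards (b1 b2 : nat) : (2 * d.+2 < b1)%N -> (1 * d.+2 < b2)%N -> (b1 + b2 = 3 * d.+2 + 2)%N ->
    b1 = (2 * d.+2).+1 /\ b2 = (1 * d.+2).+1 by lia.
rewrite size_E1 in le1; rewrite size_E2 in le2.
have [card1 card2] := cards _ _ le1 le2 cardB12.
split.
  split; first by [].
  - by rewrite card1 card2; split; lia.
  - by move=> Q; rewrite !inE => /andP[].
  - by move=> Q; rewrite !inE => /andP[].
  split.
    by apply: (evinces_unique charK0 E1_gt1 freeE1 A1E g1 PB1); rewrite size_E1.
  by apply: (evinces_unique charK0 E2_gt1 freeE2 A2E g2 PB2); rewrite size_E2.
have dec : decomposes d.+3 (vfun (vpick P1)) (vs B1) by apply/spanned_byP.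
apply: (conic_through size_E1 freeE1 span_E1 nz2 A1E g1 dec (uvs _) (@vsE A1)).
by rewrite size_map card1; lia.
Qed.

Lemma decomposition_off_support P B Q : germ_functional (two_germs E1 E2) d.+3 (vfun (vpick P)) ->
  evinces_rank P B -> Q \in B -> ~ supp (union A1 A2) Q.
Proof.
move=> gP [/spanned_byP decB cardB] QB.
rewrite two_germs_rank // in cardB.
have off i : vpick Q \notin <[(two_germs E1 E2 i)`_0]>%VS.
  apply: (two_germs_off_pole E1_gt1 E2_gt1 _ freeE gP decB).
  - by rewrite size_E1 size_E2.
  - by rewrite size_map cardB.
  by apply/mapP; exists Q.
move=> /supp_union[/(germ_support (two_gt0 true) freeE1 A1E)|/(germ_support (two_gt0 false) freeE2 A2E)].
  exact/negP/(off true).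
exact/negP/(off false).
Qed.

(** The two spans have no point in common. *)
Lemma rank_decomposition_unique B B1 B2 : rank_decomposition d.+3 A1 A2 B B1 B2 ->
  B1 = in_span A1 B /\ B2 = in_span A2 B.
Proof.
move=> [[defB _] _ B1A B2A _].
split; apply/fsetP => Q; rewrite !inE defB in_fsetU.
  apply/idP/andP => [QB|[/orP[//|/B2A Q2] Q1]]; first by rewrite QB B1A.
  by case: (disj_spans Q1 Q2).
apply/idP/andP => [QB|[/orP[/B1A Q1|//] Q2]]; first by rewrite QB orbT B2A.
by case: (disj_spans Q1 Q2).
Qed.

(** Both coefficients of P on P1 and P2 are nonzero, so that P is spanned minimally by
   the union; a common point of B1 and B2 would contradict the lower bound. *)
Lemma decomposition_join P1 P2 P B1 B2 : spanned_minimally_by A1 P1 ->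
  spanned_minimally_by A2 P2 -> evinces_rank P1 B1 -> evinces_rank P2 B2 ->
  (P <= P1 + P2)%VS -> P <> P1 -> P <> P2 ->
  (B1 `&` B2 = fset0)%fset /\ evinces_rank P (B1 `|` B2)%fset.
Proof.
move=> /(germ_minimal (two_gt0 true) freeE1 A1E) g1 /(germ_minimal (two_gt0 false) freeE2 A2E) g2.
move=> [PB1 card1] [PB2 card2] PP neq1 neq2.
rewrite (one_germ_rank E1_gt1 freeE1 charK0 g1) size_E1 in card1.
rewrite (one_germ_rank E2_gt1 freeE2 charK0 g2) size_E2 in card2.
have PB := spanned_by_union PB1 PB2 PP.
have gP : germ_functional (two_germs E1 E2) d.+3 (vfun (vpick P)).
  have [_ defP1] := point_vpick P1; have [_ defP2] := point_vpick P2.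
  move: (PP); rewrite point_le defP1 defP2 => /memv_addP[_ /vlineP[a ->] [_ /vlineP[b ->] def_P]].
  apply: (two_germs_combination _ _ g1 g2) => [||f _]; last by rewrite def_P vfunD !vfunZ.
    by apply: contra_notN neq2 => /eqP a0; apply: point_eq; rewrite def_P a0 scale0r add0r rpredZ // memv_pick.
  by apply: contra_notN neq1 => /eqP b0; apply: point_eq; rewrite def_P b0 scale0r addr0 rpredZ // memv_pick.
have geB := two_germs_card_ge gP PB.
have := cardfsUI B1 B2; rewrite card1 card2 => cardU.
have cards (u i : nat) : (3 * d.+2 + 2 <= u)%N -> (u + i = (2 * d.+2).+1 + (1 * d.+2).+1)%N ->
  u = (3 * d.+2 + 2)%N /\ i = 0%N by lia.
have [cU cI] := cards _ _ geB cardU.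
split; first exact: cardfs0_eq.
by split=> //; rewrite cU two_germs_rank.
Qed.

End TwoGerms.

Unset Implicit Arguments.

Theorem proposition3 (K : closedFieldType) (charK0 : [pchar K] =i pred0)
  (d : nat) (d_ge9 : (9 <= d)%N) (A1 A2 : subscheme K 4)
  (A1_deg : zerodim_of_degree A1 3) (A1_conn : connected_scheme A1)
  (A1_curv : curvilinear A1) (A1_plane : \dim (scheme_span A1) = 3%N)
  (A2_deg : zerodim_of_degree A2 2) (A2_conn : connected_scheme A2)
  (A2_curv : curvilinear A2)
  (A12_disj : (scheme_span A1 :&: scheme_span A2)%VS = 0%VS) :
  (forall P : point K (vdim 4 d), spanned_minimally_by (union A1 A2) P ->
    rank P = (3 * d - 1)%N /\
    forall B : {fset point K 4}, evinces_rank P B ->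
      (forall Q, Q \in B -> ~ supp (union A1 A2) Q) /\
      exists B1 B2 : {fset point K 4},
        rank_decomposition d A1 A2 B B1 B2 /\
        (forall B1' B2', rank_decomposition d A1 A2 B B1' B2' ->
           B1' = B1 /\ B2' = B2) /\
        (exists C : subscheme K 4,
           [/\ conic_in (scheme_span A1) C, reduced_scheme C
             & subscheme_le (union A1 (reduced_set B1)) C]))
  /\
  (forall P1 P2 : point K (vdim 4 d),
    spanned_minimally_by A1 P1 -> spanned_minimally_by A2 P2 ->
    forall B1 B2 : {fset point K 4},
      evinces_rank P1 B1 -> evinces_rank P2 B2 ->
    forall P : point K (vdim 4 d),
      (P <= P1 + P2)%VS -> P <> P1 -> P <> P2 ->
      (B1 `&` B2 = fset0)%fset /\ evinces_rank P (B1 `|` B2)%fset).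
Proof.
have nz2 : 2 != 0 :> K by apply: (natf_neq0 charK0 (k := 2)).
have [E1 [size_E1 freeE1 span_E1 A1E]] := curvilinear_triple_germ nz2 A1_deg A1_conn A1_curv A1_plane.
have le2 : (\dim (scheme_span A2) <= 2)%N.
  have := dimvS (subvf (scheme_span A1 + scheme_span A2)%VS).
  by rewrite dimv_disjoint_sum // A1_plane dimvf /dim /= mul1n !add3n !ltnS => /leq_trans; apply.
have [E2 [size_E2 freeE2 span_E2 A2E]] := double_germ A2_deg A2_conn le2.
have freeE : free (E1 ++ E2).
  by rewrite cat_free freeE1 freeE2; apply/directv_addP; rewrite span_E1 span_E2.
(* The degree is e + 3 from now on. *)
case: d d_ge9 => [|[|[|e]]] // _; split=> [P minP|P1 P2 min1 min2 B1 B2 ev1 ev2 P PP ne1 ne2].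
  have gP := union_minimal size_E1 size_E2 freeE A1E A2E minP.
  split=> [|B evB].
    rewrite (two_germs_rank charK0 size_E1 size_E2 freeE gP).
    by rewrite [RHS](_ : _ = (3 * e.+2 + 2)%N) //; lia.
  split=> [Q|]; first exact: (decomposition_off_support charK0 size_E1 size_E2 freeE A1E A2E gP evB).
  have [decB conic] := sort_decomposition charK0 size_E1 size_E2 freeE span_E1 span_E2 A1E A2E gP evB.
  eexists; eexists; split; first exact: decB.
  split; last exact: conic.
  by move=> B1' B2'; apply: (rank_decomposition_unique freeE span_E1 span_E2).
exact: (decomposition_join charK0 size_E1 size_E2 freeE A1E A2E min1 min2 ev1 ev2 PP ne1 ne2).
Qed.
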